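(* Let $M$ be a stationary positive weighted point measure on $\mathbb R$ of intensity $K\in(0,\infty)$. Suppose there is a finite nonnegative measurable function $h$ on $[1,\infty)$ such that \[ \mathbb E|N_M(x)-Kx|\le h(|x|)\quad(|x|\ge1),\qquad\int_1^\infty\frac{h(r)}{r^2}\,dr<\infty. \] Then: (i) Almost surely, the symmetric principal values \[ F_M(s)=\lim_{A\to\infty}\int_{[-A,A]}\frac{dM(x)}{s-x} \] exist simultaneously for every real $s\notin\operatorname{supp}M$. The same limit (with $s$ replaced by $z\in\mathbb C\setminus\mathbb R$) defines a holomorphic function off the real axis, with locally uniform convergence there, and $G_M=-F_M$ is Herglotz--Pick on the upper half-plane. (ii) On one event of probability one, for every $t\in\mathbb R$, $F_{\theta_tM}(z)=F_M(z+t)$ off the real axis and at every real point where either side is defined. In particular, $F_M$ is a stationary random function. (iii) Almost surely, as $L\to\infty$, \[ \frac1L\int_{-L/2}^{L/2}\delta_{F_M(s)/(\pi K)}\,ds\ \Longrightarrow\ \mathrm{Cauchy}(0,1). \] Thus almost every realization is shift amenable, with a nonrandom spatial law. (iv) For every deterministic $s\in\mathbb R$, \[ \mathrm{Law}\left(\left.\frac{F_M(s)}{\pi K}\,\right|\mathcal I\right)=\mathrm{Cauchy}(0,1)\quad\text{almost surely}. \] In particular the normalized transform is independent of $\mathcal I$.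
   Context: A positive weighted point measure is a measure $M=\sum_{x\in X}w_x\delta_x$ on $\mathbb R$ with $X=\operatorname{supp}M$ a locally finite subset of $\mathbb R$ and weights $w_x>0$, finite on bounded sets. Random measures are random elements of the space of such measures with its vague Borel sigma-algebra. Shifts: $\theta_tM(B)=M(B+t)$; $M$ is stationary if $\theta_tM$ has the law of $M$ for every $t\in\mathbb R$. Its intensity is $K=\mathbb E M((0,1])$. Signed counting function: $N_M(x)=M((0,x])$ for $x\ge0$, $N_M(x)=-M((x,0])$ for $x<0$. $\mathcal I$ is the sigma-field of events (in the vague Borel sigma-algebra, pulled back by $M$) invariant under every real shift. Herglotz--Pick on the upper half-plane: holomorphic there with nonnegative imaginary part. A measurable real function $f$ is shift amenable if its empirical measures $\frac1L\int_{-L/2}^{L/2}\delta_{f(s)}\,ds$ converge weakly to a probability measure as $L\to\infty$. Each deterministic point is almost surely outside the support; values of $F_M$ at atoms may be assigned arbitrarily in spatial integrals. $\mathrm{Cauchy}(0,1)$ has density $[\pi(1+x^2)]^{-1}$. *)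

(* Defs.v *)
From HB Require Import structures.
From mathcomp Require Import all_boot all_order all_algebra.
From mathcomp Require Import complex.
From mathcomp Require Import all_classical all_reals all_analysis.
From mathcomp Require Import measurable_realfun.

Set Implicit Arguments.
Unset Strict Implicit.
Unset Printing Implicit Defensive.

Import Order.TTheory GRing.Theory Num.Theory.
Import numFieldNormedType.Exports.

Local Open Scope classical_set_scope.
Local Open Scope ring_scope.
Local Open Scope complex_scope.

(* [complex R] has no topology in the libraries; this gives it the one carried
   by every numFieldType, namely the usual topology of the modulus. *)
HB.instance Definition _ (R : rcfType) := NormedModule.copy R[i] R[i]^o.

Section point_measure.
Context {R : realType}.
Implicit Type mu : {measure set (measurableTypeR R) -> \bar R}.

Definition supp mu : set R :=
  [set x | forall U : set R, open U -> U x -> (0 < mu U)%E].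

Definition locally_finite (X : set R) :=
  forall a b : R, finite_set (X `&` `[a, b]).

Definition is_wpm mu : Prop :=
  locally_finite (supp mu) /\
  exists w : R -> R, (forall x, supp mu x -> 0 < w x) /\
    forall A : set (measurableTypeR R), measurable A ->
      mu A = \esum_(x in supp mu) ((w x)%:E * \d_x A)%E.

End point_measure.

Record wpm (R : realType) := WPM {
  wpm_measure :> {measure set (measurableTypeR R) -> \bar R} ;
  wpmP : is_wpm wpm_measure }.

Section zero.
Context {R : realType}.

Lemma is_wpm0 : is_wpm (@mzero _ (measurableTypeR R) R).
Proof.
have s0 : supp (@mzero _ (measurableTypeR R) R) = set0.
  by rewrite -subset0 => x /= /(_ setT openT I); rewrite ltxx.
split; first by move=> a b; rewrite s0 set0I.
by exists (fun=> 1); split=> [x|A mA]; rewrite s0// esum_set0.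
Qed.

HB.instance Definition _ := gen_eqMixin (wpm R).
HB.instance Definition _ := gen_choiceMixin (wpm R).
HB.instance Definition _ := isPointed.Build (wpm R) (WPM is_wpm0).
End zero.

Definition test_function (R : realType) :=
  {f : R -> R | continuous f /\ compact (closure [set x | f x != 0])}.

(* The vague topology is the initial topology of [vague_eval]: the coarsest one
   that makes every mu |-> \int f dmu continuous, f continuous with compact
   support. *)
Definition vague_eval (R : realType) (mu : wpm R) :
    prod_topology (fun _ : test_function R => R) :=
  fun f => (\int[mu]_x (sval f x))%R.

HB.instance Definition _ (R : realType) :=
  Topological.copy (wpm R) (initial_topology (@vague_eval R)).

HB.instance Definition _ (R : realType) :=
  Measurable.copy (wpm R) (g_sigma_algebraType (@open (wpm R))).

Section shift.
Context {R : realType}.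
Implicit Types (t : R) (mu : {measure set (measurableTypeR R) -> \bar R}).

Definition mshift t mu (B : set (measurableTypeR R)) : \bar R :=
  mu [set x + t | x in B].

Lemma image_addrE t (B : set R) :
  [set x + t | x in B] = (fun x => x - t) @^-1` B.
Proof.
apply/seteqP; split=> [_ [x Bx <-]|x Bx] /=; first by rewrite addrK.
by exists (x - t); rewrite ?subrK.
Qed.

Let measurable_addr t (B : set (measurableTypeR R)) : measurable B ->
  measurable ([set x + t | x in B] : set (measurableTypeR R)).
Proof.
move=> mB; rewrite image_addrE -[X in measurable X]setTI.
by apply: measurable_funD => //; exact: measurable_cst.
Qed.

Let mshift0 t mu : mshift t mu set0 = 0%E.
Proof. by rewrite /mshift image_set0 measure0. Qed.

Let mshift_ge0 t mu B : (0 <= mshift t mu B)%E.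
Proof. exact: measure_ge0. Qed.

Let mshift_sigma_additive t mu : semi_sigma_additive (mshift t mu).
Proof.
move=> F mF tF mUF; rewrite /mshift image_bigcup.
apply: measure_semi_sigma_additive.
- by move=> n; exact: measurable_addr.
- apply/trivIsetP => i j _ _ ij; rewrite !image_addrE -preimage_setI.
  by move/trivIsetP : tF => /(_ _ _ I I ij) ->; rewrite preimage_set0.
- by rewrite -image_bigcup; exact: measurable_addr.
Qed.

HB.instance Definition _ t mu := isMeasure.Build _ _ _ (mshift t mu)
  (mshift0 t mu) (mshift_ge0 t mu) (@mshift_sigma_additive t mu).

Lemma supp_mshift t mu : supp (mshift t mu) = [set x | supp mu (x + t)].
Proof.
have op (U : set R) (s : R) : open U -> open [set x + s | x in U].
  move=> oU; rewrite image_addrE; apply: open_comp => // y _.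
  by apply: cvgB; [exact: cvg_id|exact: cvg_cst].
apply/seteqP; split=> x /= sx U oU Ux; last first.
  by apply: sx; [exact: op|exists x].
have /= := sx _ (op _ (- t) oU).
rewrite /mshift (_ : [set y + t | y in _] = U); last first.
  by rewrite !image_addrE opprK; apply/seteqP; split=> y /=; rewrite subrK.
by apply; exists (x + t); rewrite ?addrK.
Qed.

Lemma is_wpm_mshift t (mu : wpm R) : is_wpm (mshift t mu).
Proof.
have [lf [w [w0 muE]]] := wpmP mu.
split.
  move=> a b; apply: sub_finite_set (finite_image (fun x => x - t)
    (lf (a + t) (b + t))) => x [].
  rewrite supp_mshift/= in_itv/= => sx /andP[ax xb]; exists (x + t).
    by split=> //=; rewrite in_itv/= !lerD2r ax.
  by rewrite addrK.
exists (fun x => w (x + t)); split=> [x|A mA].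
  by rewrite supp_mshift => /w0.
transitivity (mu [set x + t | x in A]) => //.
rewrite muE; last exact: measurable_addr.
rewrite (@reindex_esum _ _ _ (supp (mshift t mu)) _ (fun x => x + t)).
  apply: eq_esum => x _; congr (_ * _)%E; rewrite /dirac !indicE.
  by rewrite image_addrE; congr ((_ : bool)%:R%:E); apply/asboolP/asboolP; rewrite /= addrK.
rewrite supp_mshift; split=> [x//|x y _ _ /addIr//|x sx].
by exists (x - t) => /=; rewrite subrK.
Qed.

Definition theta t (mu : wpm R) : wpm R := WPM (is_wpm_mshift t mu).

End shift.

Section hypotheses_on_M.
Context {R : realType}.

Definition signed_count (mu : wpm R) (x : R) : R :=
  if 0 <= x then fine (mu `]0, x]%classic) else - fine (mu `]x, 0]%classic).

Context d (Omega : measurableType d) (P : probability Omega R).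

Definition stationary (M : {RV P >-> wpm R}) :=
  forall (t : R) (S : set (wpm R)), measurable S ->
    pushforward P (theta t \o M) S = pushforward P M S.

Definition has_intensity (M : {RV P >-> wpm R}) (K : R) :=
  (\int[P]_omega M omega `]0%R, 1%R]%classic)%E = K%:E.

Definition invariant_field (M : {RV P >-> wpm R}) : set (set Omega) :=
  [set M @^-1` S | S in
    [set S : set (wpm R) | measurable S /\ forall t, theta t @^-1` S = S]].

End hypotheses_on_M.

Section transform.
Context {R : realType}.
Implicit Types (mu : wpm R) (z : R[i]).

Definition cintegral (nu : {measure set (measurableTypeR R) -> \bar R})
    (D : set R) (f : R -> R[i]) : R[i] :=
  (\int[nu]_(x in D) complex.Re (f x))%R +i*
  (\int[nu]_(x in D) complex.Im (f x))%R.

Definition pv_trunc mu (A : R) z : R[i] :=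
  cintegral mu `[- A, A] (fun x => (z - x%:C)^-1).

Lemma pv_trunc_real mu A (s : R) :
  pv_trunc mu A s%:C = (\int[mu]_(x in `[- A, A]) (s - x)^-1)%R%:C.
Proof.
rewrite /pv_trunc /cintegral.
have E x : (s%:C - x%:C)^-1 = ((s - x)^-1)%:C :> R[i].
  by rewrite -rmorphB -fmorphV.
under eq_Rintegral do rewrite E /=.
under [X in _ +i* X]eq_Rintegral do rewrite E /=.
by rewrite /Rintegral integral0.
Qed.

(* With 1 / 0 = 0, [pv_trunc] also takes a (meaningless) value at the atoms,
   which are therefore excluded explicitly below. *)
Definition real_atom mu z := [set x%:C | x in supp mu] z.

Definition transform_defined mu z :=
  ~ real_atom mu z /\ cvg (pv_trunc mu A z @[A --> +oo]).

(* The value 0 at the atoms is a placeholder. *)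
Definition transform mu z : R[i] :=
  if `[< real_atom mu z >] then 0 else lim (pv_trunc mu A z @[A --> +oo]).

(* On the real axis [transform] is real by [pv_trunc_real]. *)
Definition transformR mu (s : R) : R := complex.Re (transform mu s%:C).

Definition atom_version mu (f : R -> R) :=
  forall s, ~ supp mu s -> f s = transformR mu s.

End transform.

Section complex_analysis.
Context {R : realType}.

Definition off_axis : set R[i] := [set z | complex.Im z != 0].
Definition upper_half_plane : set R[i] := [set z | 0 < complex.Im z].

Definition holomorphic_on (D : set R[i]) (f : R[i] -> R[i]) :=
  forall z, D z -> derivable f z 1.

Definition herglotz_pick (G : R[i] -> R[i]) :=
  holomorphic_on upper_half_plane G /\
  forall z, upper_half_plane z -> 0 <= complex.Im (G z).

Definition locally_uniform_cvg (D : set R[i]) (f_ : R -> R[i] -> R[i])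
    (f : R[i] -> R[i]) :=
  forall z, D z -> exists2 U, nbhs z U & {uniform U, f_ A @[A --> +oo] --> f}.

End complex_analysis.

Section cauchy.
Context {R : realType}.
Notation mu := (@lebesgue_measure R).

Definition cauchy_pdf (x : R) : R := (pi * (1 + x ^+ 2))^-1.

Definition cauchy01 : set (measurableTypeR R) -> \bar R :=
  fun B => (\int[mu]_(x in B) (cauchy_pdf x)%:E)%E.

Let cauchy_pdf_ge0 x : 0 <= cauchy_pdf x.
Proof. by rewrite invr_ge0 mulr_ge0 ?pi_ge0// addr_ge0// sqr_ge0. Qed.

Let cauchy_pdfE x : cauchy_pdf x = pi^-1 * (oneDsqr x)^-1.
Proof. by rewrite /cauchy_pdf invfM. Qed.

Let measurable_oneDsqrV :
  measurable_fun [set: R] (fun x : R => (oneDsqr x)^-1).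
Proof. by apply: continuous_measurable_fun; exact: continuous_oneDsqrV. Qed.

Let measurable_cauchy_pdf : measurable_fun [set: R] cauchy_pdf.
Proof.
rewrite (_ : cauchy_pdf = (fun x => pi^-1 * (oneDsqr x)^-1)).
  by apply: measurable_funM => //; exact: measurable_cst.
by apply/funext => x; rewrite cauchy_pdfE.
Qed.

Let integral_cauchy_pdf : (\int[mu]_x (cauchy_pdf x)%:E = 1)%E.
Proof.
under eq_integral do rewrite cauchy_pdfE EFinM.
rewrite ge0_integralZl//=; last 2 first.
- exact/measurable_EFinP.
- by rewrite lee_fin invr_ge0 pi_ge0.
rewrite ge0_symfun_integralT//; last 2 first.
- exact: continuous_oneDsqrV.
- by move=> x; rewrite /= /oneDsqr sqrrN.
rewrite (_ : [set x | (0 <= x)%R] = `[0%R, +oo[%classic); last first.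
  by apply/seteqP; split=> x /=; rewrite in_itv/= andbT.
rewrite integral0y_oneDsqr -!EFinM; congr EFin.
by rewrite [2 * _]mulrC divfK// mulVf// gt_eqF// pi_gt0.
Qed.

Let cauchy0 : cauchy01 set0 = 0%E.
Proof. by rewrite /cauchy01 integral_set0. Qed.

Let cauchy_ge0 A : (0 <= cauchy01 A)%E.
Proof. by apply: integral_ge0 => x _; rewrite lee_fin. Qed.

Let cauchy_sigma_additive : semi_sigma_additive cauchy01.
Proof.
move=> /= F mF tF mUF; rewrite /cauchy01 ge0_integral_bigcup//=.
- apply: is_cvg_ereal_nneg_natsum_cond => n _ _.
  by apply: integral_ge0 => /= x ?; rewrite lee_fin.
- by apply: measurable_funTS; exact/measurable_EFinP.
- by move=> x _; rewrite lee_fin.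
Qed.

HB.instance Definition _ := isMeasure.Build _ _ _
  cauchy01 cauchy0 cauchy_ge0 cauchy_sigma_additive.

HB.instance Definition _ :=
  @Measure_isProbability.Build _ _ R cauchy01 integral_cauchy_pdf.

End cauchy.

Section spatial_law.
Context {R : realType}.

Definition empirical_measure (f : R -> R) (L : R)
    (B : set (measurableTypeR R)) : \bar R :=
  ((L^-1)%R%:E *
   \int[lebesgue_measure]_(s in `[(- (L / 2))%R, (L / 2)%R]) \d_(f s) B)%E.

Definition weak_cvg (nu_ : R -> set (measurableTypeR R) -> \bar R)
    (nu : probability (measurableTypeR R) R) :=
  forall phi : R -> R, continuous phi -> (exists C, forall x, `|phi x| <= C) ->
    (\int[nu_ L]_x (phi x)%:E)%E @[L --> +oo] --> (\int[nu]_x (phi x)%:E)%E.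

Definition has_spatial_law (f : R -> R)
    (nu : probability (measurableTypeR R) R) :=
  measurable_fun [set: R] f /\ weak_cvg (empirical_measure f) nu.

Definition shift_amenable (f : R -> R) := exists nu, has_spatial_law f nu.

End spatial_law.

Section laws.
Context {R : realType} d (Omega : measurableType d) (P : probability Omega R).

(* The product sigma-algebra on [T -> V], generated by the coordinates. *)
Definition cylinder_algebra (T : Type) d' (V : measurableType d') :
    set (set (T -> V)) :=
  <<s \bigcup_(z in [set: T])
        preimage_set_system [set: T -> V] (fun f => f z) measurable >>.

Definition stationary_random_function (T : Type) d' (V : measurableType d')
    (act : R -> T -> T) (X : Omega -> T -> V) :=
  (forall z, measurable_fun [set: Omega] (X ^~ z)) /\
  forall t S, cylinder_algebra S ->
    P [set omega | S (fun z => X omega (act t z))] = P [set omega | S (X omega)].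

(* [kappa] is a regular version of Law(X | G), for a sigma-algebra [G]. *)
Definition is_cond_law (G : set (set Omega)) (X : Omega -> R)
    (kappa : R.-pker (g_sigma_algebraType G) ~> (measurableTypeR R)) :=
  forall E B, G E -> measurable B ->
    (\int[P]_(omega in E) kappa omega B)%E = P (E `&` X @^-1` B).

(* Law(X | G) = nu almost surely, for every regular version of Law(X | G). *)
Definition cond_law_eq (G : set (set Omega)) (X : Omega -> R)
    (nu : probability (measurableTypeR R) R) :=
  [/\ measurable_fun [set: Omega] X, exists kappa, @is_cond_law G X kappa &
   forall kappa, @is_cond_law G X kappa -> \forall omega \ae P,
     forall B : set (measurableTypeR R), measurable B -> kappa omega B = nu B].

Definition independent_of_field (G : set (set Omega)) (X : Omega -> R) :=
  forall E B, G E -> measurable B ->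
    P (E `&` X @^-1` B) = (P E * P (X @^-1` B))%E.

End laws.

(* Main.v *)
Require Import Defs.
From HB Require Import structures.
From mathcomp Require Import all_boot all_order all_algebra finmap.
From mathcomp Require Import complex.
From mathcomp Require Import all_classical all_reals all_analysis.
From mathcomp Require Import measurable_realfun ring lra.

Import Order.TTheory GRing.Theory Num.Theory.
Import numFieldNormedType.Exports.

Set Implicit Arguments.
Unset Strict Implicit.
Unset Printing Implicit Defensive.

Local Open Scope classical_set_scope.
Local Open Scope ring_scope.
Local Open Scope complex_scope.

(** Write [D r = N r - K r] for the discrepancy between the signed counting
    function of the measure and its mean, and [F] for the transform. The whole
    theorem rests on one deterministic condition, [summable_disc]: the integral
    of [|D r| / (1 + r ^ 2)] over the line is finite. By Tonelli and the moment
    hypothesis it holds almost surely ([summable_disc_ae]), and parts (i), (ii)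
    and (iii) are proved for every measure that satisfies it.

    Since [N] is nondecreasing, a large value of [D] at one point forces large
    values on a whole interval, so the condition also gives [D r = o(r)]
    ([disc_small]). Abel summation turns a sum over the atoms into
    [K] times a Lebesgue integral, minus the integral of [D] against the
    derivative of the kernel, plus boundary terms that vanish ([abel_lim]).
    For the kernel [1 / (z - x)] with [z = i] this shows that the masses are
    summable against [1 / (1 + x ^ 2)] and that the odd part
    [x / (1 + x ^ 2)] has a symmetric limit; the other points [z] differ from
    these by an absolutely convergent Nevanlinna series ([nevanlinna]), locally
    uniformly in [z] away from the support. This gives (i). A shift of the
    measure changes a symmetric truncation only near its end points, where
    the masses are [o(A)] and the kernel is [O(1 / A)]; this gives (ii).

    For (iii), fix [t] and [ep > 0]. The resolvent [1 / (t - i ep + F z)] is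
    holomorphic and bounded by [1 / ep] in the upper half-plane because
    [Im F <= 0] there. On the real axis its imaginary part is
    [ep / ((t + F s) ^ 2 + ep ^ 2)], up to a factor [pi] a Poisson kernel
    evaluated at [F s]. Moving the segment of integration of length [L] up to
    the height [d L] costs at most [2 d L / ep] ([contour_shift]), and at that
    height [F] is close to [- i pi K], once more by Abel summation
    ([transform_far]).
    Hence the spatial averages of all Poisson kernels of [F / (pi K)] converge
    to those of the Cauchy law ([poisson_average]). Averages of Poisson kernels
    are integrals against mollified laws, and the mollification of a bounded
    Lipschitz function is uniformly close to it, so the empirical laws
    converge weakly ([cauchy_weak_limit]).

    For (iv), on an invariant event [E] the expectation of [phi (F s)] does not
    depend on [s], by stationarity and (ii), so it equals that of the spatial
    average; by (iii) and dominated convergence it is [P E] times the Cauchy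
    integral of [phi] ([integral_on_invariant]). Letting [phi] increase to
    indicators of rays gives the law of [F s] on every invariant event. *)

(** * Sums over the atoms in a window *)

Section atoms.
Context {R : realType}.
Implicit Types (mu : wpm R) (A B x : R).

Lemma mwin A : @measurable _ (measurableTypeR R) `[- A, A]%classic.
Proof. exact: measurable_itv. Qed.

Definition mass mu x : R := fine (mu [set x]).

Definition atoms mu A : seq R := fset_set (supp mu `&` `[- A, A]).

Lemma mem_atoms mu A x :
  (x \in atoms mu A) = (`|x| <= A) && `[< supp mu x >].
Proof.
have [lf _] := wpmP mu.
rewrite /atoms in_fset_set//; apply/idP/idP.
  by rewrite inE/= in_itv/= ler_norml => -[/asboolT -> ->].
by rewrite ler_norml inE/= in_itv/= => /andP[-> /asboolP].
Qed.

Lemma uniq_atoms mu A : uniq (atoms mu A).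
Proof. exact: fset_uniq. Qed.

Lemma wpm_null mu (B : set (measurableTypeR R)) : measurable B ->
  B `&` supp mu = set0 -> mu B = 0%E.
Proof.
have [_ [w [_ muE]]] := wpmP mu.
move=> mB Bs; rewrite muE//; apply: esum1 => x sx.
rewrite diracE memNset ?mule0// => Bx.
by have : (B `&` supp mu) x by []; rewrite Bs.
Qed.

Lemma wpm_atom mu x : supp mu x -> exists2 w : R, 0 < w & mu [set x] = w%:E.
Proof.
have [_ [w [w0 muE]]] := wpmP mu.
move=> sx; exists (w x); first exact: w0.
rewrite muE//.
rewrite (esumID [set x])//; last first.
  by move=> y /w0 /ltW wy; rewrite mule_ge0 ?lee_fin.
rewrite [X in (_ + X)%E]esum1 ?adde0; last first.
  by move=> y [_ /=] yx; rewrite diracE memNset ?mule0.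
rewrite setIidr; last by move=> y ->.
by rewrite esum_set1 ?diracE ?mem_set ?mule1// lee_fin ltW// w0.
Qed.

Lemma mu1E mu x : mu [set x] = (mass mu x)%:E.
Proof.
have [sx|nsx] := pselect (supp mu x).
  by have [w _] := wpm_atom sx; rewrite /mass => ->.
rewrite /mass (@wpm_null mu [set x])//.
by rewrite -subset0 => y [/= ->].
Qed.

Lemma mass_gt0 mu x : supp mu x -> 0 < mass mu x.
Proof. by move=> sx; have [w w0] := wpm_atom sx; rewrite /mass => ->. Qed.

Lemma mass_notin mu x : ~ supp mu x -> mass mu x = 0.
Proof.
move=> nsx; rewrite /mass (@wpm_null mu [set x])//.
by rewrite -subset0 => y [/= ->].
Qed.

Lemma mass_ge0 mu x : 0 <= mass mu x.
Proof. by rewrite /mass fine_ge0. Qed.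

Lemma integral_seq mu (s : seq R) (f : R -> R) : uniq s ->
  measurable_fun setT f ->
  (\int[mu]_(x in [set` s]) (f x)%:E = (\sum_(x <- s) mass mu x * f x)%:E)%E.
Proof.
move=> + mf; elim: s => [|x s ih] /=.
  by move=> _; rewrite set_nil integral_set0 big_nil.
move=> /andP[xs us].
have ms t : @measurable _ (measurableTypeR R) [set` (t : seq R)].
  by apply: countable_measurable => //; exact/finite_set_countable/finite_seq.
rewrite (_ : [set` x :: s] = [set x] `|` [set` s]); last first.
  by apply/seteqP; split=> y /=; rewrite in_cons; move/predU1P.
rewrite integral_setU//=.
- rewrite big_cons EFinD ih//; congr (_ + _)%E.
  rewrite (@eq_integral _ _ _ _ _ (cst (f x)%:E)); last first.
    by move=> y; rewrite inE/= => ->.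
  by rewrite integral_cst//= mu1E -EFinM mulrC.
- exact/measurable_EFinP/measurable_funTS.
- by apply/disj_setPS => y [/= ->]; exact/negP.
Qed.

(** The truncated integrals of the problem are finite sums; working with sums
    over a list of atoms makes Abel summation and rearrangements elementary. *)
Definition rsum mu A (g : R -> R) : R := \sum_(x <- atoms mu A) mass mu x * g x.

(** Only the finitely many atoms in the window carry mass. *)
Lemma integral_window mu A (f : R -> R) : measurable_fun setT f ->
  (\int[mu]_(x in `[(- A)%R, A]) (f x)%:E)%E = (rsum mu A f)%:E.
Proof.
move=> mf.
have [lf _] := wpmP mu.
have Efin : finite_set (supp mu `&` `[- A, A]) by exact: lf.
have mE : @measurable _ (measurableTypeR R) (supp mu `&` `[- A, A]).
  by apply: countable_measurable => //; exact: finite_set_countable.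
rewrite (_ : `[- A, A]%classic =
  (supp mu `&` `[- A, A]) `|` (`[- A, A] `\` (supp mu `&` `[- A, A])))%classic; last first.
  by rewrite setDUK// => x [].
rewrite integral_setU//=; last 3 first.
- by apply: measurableD => //; exact: mwin.
- exact/measurable_EFinP/measurable_funTS.
- by apply/disj_setPS => x [[sx Ax] [_ /=]]; apply.
rewrite [X in (_ + X)%E]null_set_integral ?adde0; last 3 first.
- by apply: measurableD => //; exact: mwin.
- exact/measurable_EFinP/measurable_funTS.
- apply: wpm_null; first by apply: measurableD => //; exact: mwin.
  by rewrite -subset0 => x [[/= Ax nx sx]]; apply: nx.
rewrite -integral_seq ?uniq_atoms//; congr integral.
by rewrite /atoms; apply/seteqP; split=> x /=; rewrite in_fset_set ?inE.
Qed.

Lemma Rintegral_window mu A (f : R -> R) : measurable_fun setT f ->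
  \int[mu]_(x in `[- A, A]) f x = rsum mu A f.
Proof. by move=> mf; rewrite /Rintegral integral_window. Qed.

Lemma mu_window mu A (B : set (measurableTypeR R)) : measurable B ->
  B `<=` `[- A, A] -> mu B = (\sum_(x <- atoms mu A | x \in B) mass mu x)%:E.
Proof.
move=> mB BA.
rewrite -[in LHS](setIidl BA) -integral_indic//.
rewrite integral_window//; rewrite /rsum [in RHS]big_mkcond/=.
congr EFin; apply: eq_bigr => x _.
by rewrite indicE; case: (x \in B); rewrite ?mulr1 ?mulr0.
Qed.

Lemma wpm_bounded_fin mu A (B : set (measurableTypeR R)) : measurable B ->
  B `<=` `[- A, A] -> (mu B < +oo)%E.
Proof. by move=> mB BA; rewrite (mu_window _ mB BA) ltry. Qed.

Lemma atoms_filter mu A B (P : pred R) : A <= B ->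
  perm_eq [seq x <- atoms mu A | P x]
          [seq x <- atoms mu B | (`|x| <= A) && P x].
Proof.
move=> AB; apply: uniq_perm; [exact/filter_uniq/uniq_atoms..|move=> x].
rewrite !mem_filter !mem_atoms; case: (P x); rewrite ?andbF//= andbT.
by have [xA|//] := leP `|x| A; rewrite (le_trans xA AB).
Qed.

(** The wider window is kept as index set, so that two truncations can be
    compared term by term. *)
Lemma rsum_widen mu A B g : A <= B -> rsum mu B g = rsum mu A g +
  \sum_(x <- atoms mu B | ~~ (`|x| <= A)) mass mu x * g x.
Proof.
move=> AB; rewrite /rsum (bigID (fun x => `|x| <= A))/=; congr (_ + _).
rewrite -[in RHS](filter_predT (atoms mu A)) (perm_big _ (atoms_filter _ _ AB)).
rewrite big_filter; apply: eq_bigl => x; by rewrite andbT.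
Qed.

End atoms.

(** * Counting functions and Abel summation *)

Section segment.
Context {R : realType}.
Notation leb := (@lebesgue_measure R).
Implicit Types (a b C : R) (f g : R -> R).

Lemma seg_integrable a b C g : measurable_fun setT g ->
  (forall x, a <= x <= b -> `|g x| <= C) -> leb.-integrable `[a, b] (EFin \o g).
Proof.
move=> mg gC; apply: (@le_integrable _ _ _ leb _ _ _ (cst C%:E)) => //=.
- exact/measurable_EFinP/measurable_funTS.
- move=> x; rewrite in_itv/= => /gC; rewrite lee_fin => xC;
  by rewrite (le_trans xC)// ler_norm.
- apply/integrableP; split=> //.
  rewrite integral_cst//= lebesgue_measure_itv/=.
  by case: ifP => _; rewrite ?mule0 ?ltry// -EFinD -EFinM ltry.
Qed.

Lemma continuous_mfun f : continuous f -> measurable_fun setT f.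
Proof. exact: continuous_measurable_fun. Qed.

Lemma continuous_seg_integrable a b f : continuous f ->
  leb.-integrable `[a, b] (EFin \o f).
Proof.
move=> cf; apply: continuous_compact_integrable; first exact: segment_compact.
exact: continuous_subspaceT.
Qed.

Lemma Rintegral_FTC f f' a b : continuous f' ->
  (forall x, is_derive x (1 : R) f (f' x)) -> a <= b ->
  \int[leb]_(x in `[a, b]) f' x = f b - f a.
Proof.
move=> cf' df; rewrite le_eqVlt => /predU1P[->|ab].
  by rewrite set_itv1 Rintegral_set1 subrr.
have cf : continuous f.
  move=> x; apply: differentiable_continuous; apply/derivable1_diffP.
  by have [] := df x.
rewrite /Rintegral (@continuous_FTC2 _ f' f)//.
- exact: continuous_subspaceT.
- split; first by move=> x _; have [] := df x.
  + by apply: cvg_at_right_filter; exact: cf.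
  + by apply: cvg_at_left_filter; exact: cf.
- by move=> x _; rewrite derive1E; apply: derive_val; exact: df.
Qed.

(** Writes a tail integral as an integral over the fixed segment, so that sums
    of tails can be exchanged with the integral. *)
Lemma Rintegral_tail f a b x : a <= x <= b ->
  \int[leb]_(r in `[x, b]) f r = \int[leb]_(r in `[a, b]) ((x <= r)%R%:R * f r).
Proof.
move=> /andP[ax xb].
rewrite (_ : `[x, b]%classic = `[a, b] `&` `[x, +oo[)%classic; last first.
  apply/seteqP; split=> r /=; rewrite !in_itv/= ?andbT.
    by move=> /andP[xr ->]; rewrite xr (le_trans ax).
  by move=> [/andP[_ ->] ->].
rewrite Rintegral_mkcondr; apply: eq_Rintegral => r _.
rewrite patchE mem_setE/= in_itv/= andbT.
by case: ifP; rewrite ?mul1r ?mul0r.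
Qed.

(** The sum is over a list, and the summands depend on an index in [R]; this is
    the exchange behind Abel summation. *)
Lemma Rintegral_sum a b (s : seq R) (c : R -> R) (g : R -> R -> R) :
  (forall x, leb.-integrable `[a, b] (EFin \o g x)) ->
  leb.-integrable `[a, b] (EFin \o (fun r => \sum_(x <- s) c x * g x r)) /\
  \int[leb]_(r in `[a, b]) (\sum_(x <- s) c x * g x r) =
  \sum_(x <- s) c x * \int[leb]_(r in `[a, b]) g x r.
Proof.
move=> ig; elim: s => [|x s [ih1 ih2]].
  split.
    by under [X in EFin \o X]eq_fun do rewrite big_nil; exact: integrable0.
  rewrite big_nil; under eq_Rintegral do rewrite big_nil.
  by rewrite Rintegral_cst// mul0r.
have iZ : leb.-integrable `[a, b] (EFin \o (fun r => c x * g x r)).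
  exact: (integrableZl _ (c x) (ig x)).
split.
  under [X in EFin \o X]eq_fun do rewrite big_cons.
  exact: (integrableD _ iZ ih1).
under eq_Rintegral do rewrite big_cons.
by rewrite big_cons RintegralD// RintegralZl// ih2.
Qed.

End segment.

Section count.
Context {R : realType}.
Notation leb := (@lebesgue_measure R).
Implicit Types (mu : wpm R) (A r x K : R).

Definition wcount mu A (P : pred R) : R := \sum_(x <- atoms mu A | P x) mass mu x.

Lemma wcount_le mu A (P Q : pred R) : (forall x, P x -> Q x) ->
  wcount mu A P <= wcount mu A Q.
Proof.
move=> PQ; rewrite /wcount big_mkcond [leRHS]big_mkcond/=; apply: ler_sum => x _.
by case: ifP => [/PQ ->//|_]; case: ifP => // _; exact: mass_ge0.
Qed.

Lemma wcount_widen mu A B (P : pred R) : A <= B -> (forall x, P x -> `|x| <= A) ->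
  wcount mu B P = wcount mu A P.
Proof.
move=> AB PA; rewrite /wcount -[RHS]big_filter (perm_big _ (atoms_filter _ _ AB)).
rewrite big_filter; apply: eq_bigl => x.
by apply/idP/andP => [Px|[]//]; split => //; exact: PA.
Qed.

Lemma wcountID mu A (P Q : pred R) : wcount mu A P =
  wcount mu A (fun x => P x && Q x) + wcount mu A (fun x => P x && ~~ Q x).
Proof. exact: bigID. Qed.

Lemma eq_wcount mu A (P Q : pred R) : (forall x, `|x| <= A -> P x = Q x) ->
  wcount mu A P = wcount mu A Q.
Proof.
move=> PQ; rewrite /wcount big_seq_cond [RHS]big_seq_cond; apply: eq_bigl => x.
by rewrite mem_atoms; have [/PQ ->|] := boolP (`|x| <= A).
Qed.

Lemma signed_count_ge0E mu A r : 0 <= r <= A ->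
  signed_count mu r = wcount mu A (fun x => 0 < x <= r).
Proof.
move=> /andP[r0 rA]; rewrite /signed_count r0 (@mu_window _ mu A)//=.
- by apply: eq_bigl => x; rewrite mem_setE in_itv.
- move=> x /=; rewrite !in_itv/= => /andP[x0 xr].
  by rewrite (le_trans xr rA) andbT; lra.
Qed.

Lemma signed_count_lt0E mu A r : - A <= r < 0 ->
  signed_count mu r = - wcount mu A (fun x => r < x <= 0).
Proof.
move=> /andP[rA r0]; rewrite /signed_count leNgt r0/= (@mu_window _ mu A)//=.
- by congr (- _); apply: eq_bigl => x; rewrite mem_setE in_itv.
- by move=> x /=; rewrite !in_itv/= => /andP[x0 xr]; lra.
Qed.

(** Up to the constant mass of the nonpositive part, the signed counting
    function is the ordinary distribution function of the window; this avoids a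
    case split on the sign of [r]. *)
Lemma signed_count_window mu A r : `|r| <= A ->
  wcount mu A (fun x => x <= r) = signed_count mu r + wcount mu A (fun x => x <= 0).
Proof.
rewrite ler_norml => /andP[Ar rA].
have [r0|r0] := leP 0 r.
  rewrite (@signed_count_ge0E mu A) ?r0// (wcountID _ _ _ (fun x => 0 < x)).
  congr (_ + _); apply: eq_wcount => x _; first by rewrite andbC.
  by apply/idP/idP; lra.
rewrite (@signed_count_lt0E mu A) ?r0 ?Ar//.
rewrite (wcountID _ _ (fun x => x <= 0) (fun x => r < x)).
rewrite (_ : wcount mu A (fun x => (x <= 0) && (r < x)) =
  wcount mu A (fun x => r < x <= 0)); last first.
  by apply: eq_wcount => x _; rewrite andbC.
by rewrite addKr; apply: eq_wcount => x _; apply/idP/idP; lra.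
Qed.

Lemma signed_count_nd mu : {homo signed_count mu : x y / x <= y}.
Proof.
move=> r s rs; pose A := Num.max `|r| `|s|.
have rA : `|r| <= A by rewrite le_max lexx.
have sA : `|s| <= A by rewrite le_max lexx orbT.
rewrite -(lerD2r (wcount mu A (fun x => x <= 0))) -!signed_count_window//.
by apply: wcount_le => x xr; exact: le_trans rs.
Qed.

Lemma measurable_signed_count mu : measurable_fun setT (signed_count mu).
Proof. by apply: nondecreasing_measurable => // x y; exact: signed_count_nd. Qed.

Definition disc mu K r : R := signed_count mu r - K * r.

Lemma measurable_disc mu K : measurable_fun setT (disc mu K).
Proof.
apply: measurable_funB; first exact: measurable_signed_count.
by apply: measurable_funM => //; exact: measurable_cst.
Qed.

Lemma disc_bounded mu K A r : 0 <= K -> `|r| <= A ->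
  `|disc mu K r| <= wcount mu A predT + K * A.
Proof.
move=> K0 rA; rewrite (le_trans (ler_normB _ _))// lerD//; last first.
  by rewrite normrM ger0_norm// ler_wpM2l.
move: (rA); rewrite ler_norml => /andP[Ar rA'].
have [r0|r0] := leP 0 r.
  rewrite (@signed_count_ge0E mu A) ?r0// ger0_norm; first exact: wcount_le.
  by apply: sumr_ge0 => x _; exact: mass_ge0.
rewrite (@signed_count_lt0E mu A) ?r0 ?Ar// normrN ger0_norm; first exact: wcount_le.
by apply: sumr_ge0 => x _; exact: mass_ge0.
Qed.

Lemma disc_integrable mu K A (g : R -> R) : 0 <= K -> continuous g ->
  leb.-integrable `[- A, A] (EFin \o (fun r => disc mu K r * g r)).
Proof.
move=> K0 cg.
have [A0|A0] := leP 0 A; last first.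
  rewrite set_itv_ge; first exact: integrable_set0.
  by rewrite -leNgt bnd_simp; lra.
have [C0 [_ HC]] : bounded_set (g @` `[- A, A]).
  apply: compact_bounded; apply: continuous_compact; last exact: segment_compact.
  exact: continuous_subspaceT.
pose C := Num.max 0 (C0 + 1).
have gC x : - A <= x <= A -> `|g x| <= C.
  move=> xA; apply: (HC C); last by exists x => //=; rewrite in_itv.
  by rewrite lt_max ltrDl ltr01 orbT.
apply: (@seg_integrable _ _ _ ((wcount mu A predT + K * A) * C)).
  apply: measurable_funM; first exact: measurable_disc.
  exact: continuous_mfun.
move=> x xA; rewrite normrM ler_pM ?gC// disc_bounded//.
by rewrite ler_norml.
Qed.

(** Replace [f x] by [f A] minus the integral of [f'] from [x] to [A], exchange
    sum and integral, and split the resulting distribution function into [K r]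
    and the discrepancy. The terms in [K] are integrated by parts back. *)
Lemma abel_summation mu K A (f f' : R -> R) : 0 <= K -> 0 <= A ->
  continuous f' -> (forall x, is_derive x (1 : R) f (f' x)) ->
  rsum mu A f = disc mu K A * f A
    + (wcount mu A (fun x => x <= 0) - K * A) * f (- A)
    + K * (\int[leb]_(r in `[- A, A]) f r)
    - \int[leb]_(r in `[- A, A]) (disc mu K r * f' r).
Proof.
move=> K0 A0 cf' df.
have cf : continuous f.
  move=> x; apply: differentiable_continuous; apply/derivable1_diffP.
  by have [] := df x.
have AA : - A <= A by lra.
set q := wcount mu A (fun x => x <= 0).
have -> : rsum mu A f = wcount mu A predT * f A - \sum_(x <- atoms mu A)
    mass mu x * \int[leb]_(r in `[- A, A]) ((x <= r)%R%:R * f' r).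
  rewrite /rsum /wcount mulr_suml -sumrB big_seq [RHS]big_seq.
  apply: eq_bigr => x; rewrite mem_atoms ler_norml => /andP[xA _].
  rewrite -Rintegral_tail// (Rintegral_FTC cf' df); last by case/andP: xA.
  by ring.
have iP x : leb.-integrable `[- A, A] (EFin \o (fun r => (x <= r)%R%:R * f' r)).
  apply: (@le_integrable _ _ _ leb _ _ _ (EFin \o f')) => //=.
  - apply/measurable_EFinP/measurable_funTS/measurable_funM; last exact: continuous_mfun.
    apply: nondecreasing_measurable => // r s rs; rewrite ler_nat.
    by have [xr|//] := leP x r; rewrite (le_trans xr rs).
  - move=> r _; rewrite lee_fin normrM ler_piMl// normr_nat lern1.
    by case: (x <= r).
  - exact: continuous_seg_integrable.
have [_ <-] := @Rintegral_sum _ (- A) A (atoms mu A) (mass mu) _ iP.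
have -> : \int[leb]_(r in `[- A, A])
     (\sum_(x <- atoms mu A) mass mu x * ((x <= r)%R%:R * f' r)) =
   \int[leb]_(r in `[- A, A]) (disc mu K r * f' r + (K * r + q) * f' r).
  apply: eq_Rintegral => r; rewrite inE/= in_itv/= -ler_norml => rA.
  rewrite /disc -mulrDl addrA subrK -/q -signed_count_window// /wcount.
  rewrite [in RHS]big_mkcond/= mulr_suml.
  by apply: eq_bigr => x _; rewrite mulrA; congr (_ * _); case: (x <= r);
    rewrite /= ?mulr1 ?mulr0.
have cl : continuous (fun r => (K * r + q : R)).
  by move=> r; apply: cvgD; [apply: cvgM; [exact: cvg_cst|exact: cvg_id]|exact: cvg_cst].
rewrite RintegralD//; last 2 first.
- exact: disc_integrable.
- by apply: continuous_seg_integrable => r; apply: cvgM; [exact: cl|exact: cf'].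
have dG x : is_derive x (1 : R) (fun r => (K * r + q) * f r) (K * f x + (K * x + q) * f' x).
  by apply: is_derive_eq; rewrite /GRing.scale/=; ring.
have cG : continuous (fun x => K * f x + (K * x + q) * f' x).
  move=> r; apply: cvgD; last by apply: cvgM; [exact: cl|exact: cf'].
  by apply: cvgM; [exact: cvg_cst|exact: cf].
have := Rintegral_FTC cG dG AA.
rewrite RintegralD//; last 2 first.
- by apply: continuous_seg_integrable => r; apply: cvgM; [exact: cvg_cst|exact: cf].
- by apply: continuous_seg_integrable => r; apply: cvgM; [exact: cl|exact: cf'].
rewrite RintegralZl//; last exact: continuous_seg_integrable.
move=> E.
have -> : wcount mu A predT = signed_count mu A + q.
  rewrite -signed_count_window ?ger0_norm//; apply: eq_wcount => x.
  by rewrite ler_norml => /andP[_ ->].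
rewrite /disc -/q; lra.
Qed.

End count.

(** * Summable discrepancy *)

Section limits_at_infinity.
Context {R : realType}.
Implicit Types (f g : R -> R) (e l A B : R).

Lemma cvgyP f l : f A @[A --> +oo] --> l <->
  forall e, 0 < e -> exists A0, forall A, A0 <= A -> `|f A - l| <= e.
Proof.
split=> [/cvgrPdist_le fl e e0|fl].
  have /= [A0 [_ A0P]] := fl e e0.
  by exists (A0 + 1) => A AA; rewrite distrC; apply: A0P; lra.
apply/cvgrPdist_le => e e0; have [A0 A0P] := fl e e0.
by exists A0; split; [exact: num_real|move=> A /ltW AA; rewrite distrC A0P].
Qed.

Lemma cauchyy f :
  (forall e, 0 < e -> exists A0, forall A B, A0 <= A -> A <= B -> `|f B - f A| <= e) ->
  cvg (f A @[A --> +oo]).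
Proof.
move=> fC; apply/cauchy_cvgP/cauchy_exP => e e0.
have [A0 A0P] := fC (e / 2) ltac:(lra).
exists (f A0); exists A0; split; [exact: num_real|move=> A /ltW AA].
rewrite -ball_normE/= distrC.
by apply: le_lt_trans (A0P _ _ _ AA) _; [exact: lexx|lra].
Qed.

(** A bounded nondecreasing function has a limit, so its late increments are
    small. *)
Lemma nd_bounded_cauchy f C : {homo f : x y / x <= y} -> (forall x, f x <= C) ->
  forall e, 0 < e -> exists A0, forall A B, A0 <= A -> A <= B -> f B - f A <= e.
Proof.
move=> fnd fC e e0; have hs : has_sup (range f).
  by split; [exists (f 0), 0|exists C => _ [x _ <-]].
have [_ [A0 _ <-] A0P] := sup_adherent e0 hs.
exists A0 => A B A0A AB.
have : f B <= sup (range f) by apply: sup_upper_bound => //; exists B.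
by have := fnd _ _ A0A; lra.
Qed.

Lemma is_derive_quot (n m : R -> R) (x n' m' d' : R) : m x != 0 ->
  is_derive x (1 : R) n n' -> is_derive x (1 : R) m m' ->
  d' = (n' * m x - n x * m') / (m x) ^+ 2 ->
  is_derive x (1 : R) (fun r => n r / m r) d'.
Proof.
move=> m0 dn dm ->.
have dV := is_deriveV m0 dm.
apply: is_derive_eq.
by rewrite /GRing.scale/=; field.
Qed.

End limits_at_infinity.

Section summable_disc.
Context {R : realType}.
Notation leb := (@lebesgue_measure R).
Variables (mu : wpm R) (K : R).
Hypothesis K0 : 0 < K.
Implicit Types (A B r x : R) (g f : R -> R).
Local Notation D := (disc mu K).

(** The weight of the Cauchy kernel at infinity. *)
Definition wt x : R := (1 + x ^+ 2)^-1.

Lemma wt_gt0 x : 0 < wt x.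
Proof. by rewrite invr_gt0; nra. Qed.

Lemma wt_den x : 1 + x ^+ 2 != 0 :> R.
Proof. by rewrite gt_eqF//; nra. Qed.

Lemma continuous_wt : continuous wt.
Proof.
move=> x; apply: cvgV; first exact: wt_den.
by apply: cvgD; [exact: cvg_cst|apply: cvgM; exact: cvg_id].
Qed.

Definition disc_norm A : R := \int[leb]_(r in `[- A, A]) (`|D r| * wt r).

Lemma dabs_integrable A : leb.-integrable `[- A, A] (EFin \o (fun r => `|D r| * wt r)).
Proof.
have := @disc_integrable _ mu K A wt (ltW K0) continuous_wt.
move=> /integrable_abse; apply: eq_integrable => // x _ /=.
by rewrite normrM (ger0_norm (ltW (wt_gt0 x))).
Qed.

Lemma Rint_sub (U V : set (measurableTypeR R)) g : measurable U -> measurable V -> U `<=` V ->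
  leb.-integrable V (EFin \o g) ->
  \int[leb]_(r in V) g r = \int[leb]_(r in U) g r + \int[leb]_(r in V `\` U) g r.
Proof.
move=> mU mV UV ig; rewrite -[in LHS](setDUK UV) Rintegral_setU//.
- exact: measurableD.
- by rewrite setDUK.
- by apply/disj_setPS => x [Ux [_]].
Qed.

Lemma Rint_cst (a b c : R) : a <= b -> \int[leb]_(r in `[a, b]) c = c * (b - a).
Proof.
move=> ab; rewrite mulrBr.
apply: (@Rintegral_FTC _ (fun x => c * x) (fun=> c)) => // x.
- exact: cvg_cst.
- by apply: is_derive_eq; rewrite /GRing.scale/=; ring.
Qed.

Lemma sub_win A B : A <= B -> `[- A, A] `<=` (`[- B, B] : set R).
Proof. by move=> AB x /=; rewrite !in_itv/= => /andP[]; lra. Qed.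

Lemma mseg (a b : R) : @measurable _ (measurableTypeR R) `[a, b]%classic.
Proof. exact: measurable_itv. Qed.

(** Outside [[-A, A]] the integrand is dominated by the weighted
    discrepancy. *)
Lemma disc_int_diff A B c g : continuous g -> A <= B ->
  (forall r, A < `|r| <= B -> `|g r| <= c * wt r) ->
  `|\int[leb]_(r in `[- B, B]) (D r * g r) - \int[leb]_(r in `[- A, A]) (D r * g r)|
    <= c * (disc_norm B - disc_norm A).
Proof.
move=> cg AB gc.
have mW : @measurable _ (measurableTypeR R) (`[- B, B] `\` `[- A, A]).
  by apply: measurableD; exact: mseg.
have iDg := @disc_integrable _ mu K B g (ltW K0) cg.
rewrite /disc_norm (Rint_sub (mseg _ _) (mseg _ _) (sub_win AB) iDg).
rewrite (Rint_sub (mseg _ _) (mseg _ _) (sub_win AB) (dabs_integrable B)).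
rewrite addrC addKr [X in c * X]addrC addKr.
have sB : `[- B, B] `\` `[- A, A] `<=` (`[- B, B] : set R) by move=> x [].
rewrite -RintegralZl//; last exact: integrableS (dabs_integrable B).
have i1 := integrableS (mseg _ _) mW sB iDg.
apply: (le_trans (le_normr_Rintegral mW i1)).
apply: le_Rintegral => //.
- by have /integrable_abse := i1; apply: eq_integrable.
- exact: (integrableZl mW c (integrableS (mseg _ _) mW sB (dabs_integrable B))).
- move=> x [/=]; rewrite !in_itv/= -!ler_norml => xB /negP; rewrite -ltNge => xA.
  by rewrite normrM mulrCA ler_wpM2l// gc// xA.
Qed.

Lemma disc_norm_nd : {homo disc_norm : A B / A <= B}.
Proof.
move=> A B AB; rewrite -subr_ge0 /disc_norm.
rewrite (Rint_sub (mseg _ _) (mseg _ _) (sub_win AB) (dabs_integrable B)).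
rewrite addrC addKr; apply: Rintegral_ge0 => x _.
by rewrite mulr_ge0// ltW ?wt_gt0.
Qed.

(** The one property of a realization on which everything else depends. *)
Definition summable_disc := exists C, forall A, disc_norm A <= C.

Hypothesis mu_summable : summable_disc.

Lemma disc_norm_cauchy e : 0 < e ->
  exists A0, forall A B, A0 <= A -> A <= B -> disc_norm B - disc_norm A <= e.
Proof. by have [C HC] := mu_summable; exact: (nd_bounded_cauchy disc_norm_nd HC). Qed.

Lemma disc_int_cvg c g : continuous g -> (forall r, `|g r| <= c * wt r) ->
  cvg (\int[leb]_(r in `[- A, A]) (D r * g r) @[A --> +oo]).
Proof.
move=> cg gc; apply: cauchyy => e e0.
have c0 : 0 <= c.
  by have := gc 0; rewrite /wt expr0n addr0 invr1 mulr1; apply: le_trans.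
have [A0 A0P] := @disc_norm_cauchy (e / (c + 1)) ltac:(rewrite divr_gt0//; lra).
exists A0 => A B A0A AB.
apply: le_trans (disc_int_diff cg AB (fun r _ => gc r)) _.
have := A0P _ _ A0A AB; rewrite ler_pdivlMr; last lra.
have := disc_norm_nd AB; nra.
Qed.

(** Since the counting function is monotone, a large discrepancy at [r]
    propagates to an interval adjacent to [r] of length comparable to [|r|],
    whose contribution to the weighted integral is bounded below. Late
    contributions tend to zero. *)
Lemma disc_small e : 0 < e ->
  exists A0, forall r, A0 <= `|r| -> `|D r| <= e * `|r|.
Proof.
wlog : e / e <= K.
  move=> wl e0; have [A0 A0P] := wl (Num.min e K) ltac:(by rewrite ge_min lexx orbT)
    ltac:(by rewrite lt_min e0).
  exists A0 => r /A0P /le_trans; apply; rewrite ler_wpM2r//.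
  by rewrite ge_min lexx.
move=> eK e0.
have [A0 A0P] := @disc_norm_cauchy (e ^+ 2 / (14 * K)) ltac:(rewrite divr_gt0//; nra).
exists (4 * `|A0| + 1) => r rA; rewrite leNgt; apply/negP => eD.
have r1 : 1 <= `|r| by have := normr_ge0 A0; lra.
(* Over a length [l] the term [K r] changes by half of the assumed
   discrepancy, so that on one side of [r] the other half survives. *)
set l := e * `|r| / (2 * K).
have lK : l * K = e * `|r| / 2 by rewrite /l; field; rewrite gt_eqF.
have l0 : 0 < l by rewrite divr_gt0//; nra.
have lr : l <= `|r| / 2.
  by rewrite /l ler_pdivrMr; [nra|lra].
have [a [b [ab J Jr]]] : exists a b, [/\ b - a = l,
    (forall t, a <= t <= b -> e * `|r| / 2 <= `|D t|) &
    (forall t, a <= t <= b -> `|t - r| <= l)].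
  have [D0|D0] := leP 0 (D r).
    exists r, (r + l); split; first by lra.
    - move=> t /andP[rt tl]; rewrite (ger0_norm D0) in eD.
      apply: le_trans (ler_norm _); rewrite /disc in eD *.
      by have := signed_count_nd mu rt; have := ler_wpM2l (ltW K0) tl; rewrite mulrDr; lra.
    - by move=> t /andP[rt tl]; rewrite ger0_norm; lra.
  exists (r - l), r; split; first by lra.
  - move=> t /andP[rt tl]; rewrite (ltr0_norm D0) in eD.
    rewrite -[leRHS]normrN; apply: le_trans (ler_norm _); rewrite /disc in eD *.
    by have := signed_count_nd mu tl; have := ler_wpM2l (ltW K0) rt; rewrite mulrBr; lra.
  - by move=> t /andP[rt tl]; rewrite ler0_norm; lra.
have rr := normr_ge0 r.
have Jlo t : a <= t <= b -> `|r| / 2 <= `|t|.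
  move=> /Jr tr; have : `|r| <= `|r - t| + `|t| by rewrite -{1}(subrK t r) ler_normD.
  by rewrite distrC; lra.
have Jhi t : a <= t <= b -> `|t| <= 3 / 2 * `|r|.
  move=> /Jr tr; have : `|t| <= `|t - r| + `|r| by rewrite -{1}(subrK r t) ler_normD.
  by lra.
pose A := `|r| / 4; pose B := 3 / 2 * `|r|.
have AB : A <= B by rewrite /A /B; lra.
have AA0 : A0 <= A by rewrite /A; have := ler_norm A0; lra.
have := A0P _ _ AA0 AB; apply/negP; rewrite -ltNge.
rewrite /disc_norm (Rint_sub (mseg _ _) (mseg _ _) (sub_win AB) (dabs_integrable B)).
rewrite addrC addKr.
have mW : @measurable _ (measurableTypeR R) (`[- B, B] `\` `[- A, A]).
  by apply: measurableD; exact: mseg.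
have sB : `[- B, B] `\` `[- A, A] `<=` (`[- B, B] : set R) by move=> x [].
have JW : `[a, b] `<=` (`[- B, B] `\` `[- A, A] : set R).
  move=> t /=; rewrite !in_itv/= => tab; split; first by rewrite -ler_norml Jhi.
  rewrite -ler_norml; apply/negP; rewrite -ltNge; apply: lt_le_trans (Jlo t tab).
  by rewrite /A; lra.
rewrite (Rint_sub (mseg a b) mW JW); last first.
  exact: integrableS (mseg _ _) mW sB (dabs_integrable B).
set c := e * `|r| / 2 / (1 + B ^+ 2).
have le1 : c * l <= \int[leb]_(r in `[a, b]) (`|D r| * wt r).
  rewrite -[l in leLHS]ab.
  have -> : c * (b - a) = \int[leb]_(r in `[a, b]) c.
    by rewrite Rint_cst//; lra.
  apply: le_Rintegral => //.
  - by apply: continuous_seg_integrable => x; exact: cvg_cst.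
  - by apply: integrableS (dabs_integrable B) => //; exact: subset_trans sB.
  - move=> t /=; rewrite in_itv/= => tab; rewrite /c ler_pM//.
    + by rewrite divr_ge0// mulr_ge0// ltW.
    + by rewrite invr_ge0; nra.
    + exact: J.
    + rewrite lef_pV2 ?posrE; [|nra|nra].
      have := Jhi t tab; rewrite -(real_normK (num_real t)) /B.
      have := normr_ge0 t; nra.
have le2 : 0 <= \int[leb]_(r in (`[- B, B] `\` `[- A, A]) `\` `[a, b]) (`|D r| * wt r).
  by apply: Rintegral_ge0 => x _; rewrite mulr_ge0// ltW ?wt_gt0.
suff cl : e ^+ 2 / (14 * K) < c * l.
  by apply: lt_le_trans cl (le_trans le1 _); rewrite lerDl.
have -> : c * l = e ^+ 2 * `|r| ^+ 2 / (4 * K * (1 + B ^+ 2)).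
  rewrite /c /l; field; rewrite gt_eqF//=; nra.
rewrite ltr_pdivrMr; last lra.
rewrite mulrAC ltr_pdivlMr; last by nra.
have e2 : 0 < e ^+ 2 * K by rewrite mulr_gt0// exprn_gt0.
(* As [1 <= |r|] and [B = 3 / 2 |r|], the left-hand side is at most
   [13 |r| ^ 2]; this is where the 14 comes from. *)
have rB : 4 * (1 + B ^+ 2) < 14 * `|r| ^+ 2 by rewrite /B; nra.
have := rB; rewrite -(ltr_pM2l e2).
by congr (_ < _); ring.
Qed.

End summable_disc.

(** * Limits of sums over the atoms *)

Section abel_limits.
Context {R : realType}.
Notation leb := (@lebesgue_measure R).
Variables (mu : wpm R) (K : R).
Hypothesis K0 : 0 < K.
Implicit Types (A B r x : R) (g f : R -> R).
Local Notation D := (disc mu K).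

(** The mass of the closed half-window on the left; unlike [signed_count] it
    includes the end point [- A]. *)
Definition lowcount A := wcount mu A (fun x => x <= 0).

(** The signed count at [- A] misses a possible atom at [- A]; it is recovered
    by sandwiching the mass between the counts at [- A] and [- (A + 1)]. *)
Lemma lowcount_bound A : 0 < A ->
  `|lowcount A - K * A| <= `|D (- A)| + `|D (- (A + 1))| + K.
Proof.
have Kpos := K0; move=> A0.
have h1 : - signed_count mu (- A) <= lowcount A.
  rewrite (@signed_count_lt0E _ _ A) ?lexx ?oppr_lt0// opprK.
  by apply: wcount_le => x /andP[].
have h2 : lowcount A <= - signed_count mu (- (A + 1)).
  rewrite (@signed_count_lt0E _ _ (A + 1)) ?lexx ?oppr_lt0 ?addr_gt0// opprK.
  rewrite /lowcount (@eq_wcount _ _ _ _ (fun x => - A <= x <= 0)); last first.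
    by move=> x; rewrite ler_norml => /andP[-> _].
  rewrite -(@wcount_widen _ mu A (A + 1)); first last.
  - by move=> x; rewrite ler_norml; lra.
  - by lra.
  by apply: wcount_le => x /andP[xA ->]; rewrite andbT; lra.
have absle (d : R) : [/\ d <= `|d|, (0 : R) <= `|d| & - `|d| <= d].
  by split; rewrite ?ler_norm// lerNl -normrN ler_norm.
have [n1 n3 m1] := absle (D (- A)); have [n2 n4 m2] := absle (D (- (A + 1))).
have E1 : D (- A) = signed_count mu (- A) + K * A by rewrite /disc; ring.
have E2 : D (- (A + 1)) = signed_count mu (- (A + 1)) + K * A + K by rewrite /disc; ring.
by rewrite ler_norml; apply/andP; split; lra.
Qed.

Lemma abel_error A f f' : 0 <= A ->
  continuous f' -> (forall x, is_derive x (1 : R) f (f' x)) ->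
  `|rsum mu A f - K * (\int[leb]_(r in `[- A, A]) f r)
    + \int[leb]_(r in `[- A, A]) (D r * f' r)| <=
  `|D A| * `|f A| + `|lowcount A - K * A| * `|f (- A)|.
Proof.
move=> A0 cf' df; rewrite (abel_summation mu (ltW K0) A0 cf' df).
rewrite -!normrM; apply: le_trans (ler_normD _ _).
by rewrite le_eqVlt; apply/orP; left; apply/eqP; congr `|_|; rewrite /lowcount; ring.
Qed.

Hypothesis mu_summable : summable_disc mu K.

Lemma boundary_small e : 0 < e -> exists A0, 0 < A0 /\ forall A, A0 <= A ->
  `|D A| <= e * A /\ `|lowcount A - K * A| <= e * A.
Proof.
have Kpos := K0; move=> e0.
have [A1 A1P] := disc_small K0 mu_summable (e := e / 4) ltac:(lra).
exists (`|A1| + 1 + 4 * K / e); split.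
  by rewrite ltr_wpDr ?divr_ge0 ?mulr_ge0 ?(ltW K0) ?(ltW e0)// ltr_wpDl.
move=> A AA.
have Ke : 0 < 4 * K / e by rewrite divr_gt0// mulr_gt0.
have A1A := ler_norm A1; have nA1 := normr_ge0 A1.
have KA : K <= e * A / 4.
  have : 4 * K / e <= A by lra.
  by rewrite ler_pdivrMr//; lra.
have a0 : 0 < A by lra.
split.
  have /le_trans := A1P A ltac:(by rewrite gtr0_norm//; lra); apply.
  by rewrite gtr0_norm//; nra.
apply: le_trans (lowcount_bound a0) _.
have a1 : 0 < A + 1 by lra.
have := A1P (- A) ltac:(by rewrite normrN gtr0_norm//; lra).
have := A1P (- (A + 1)) ltac:(by rewrite normrN gtr0_norm//; lra).
rewrite !normrN (gtr0_norm a1) (gtr0_norm a0).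
have eA : e <= e * A by rewrite ler_peMr//; lra.
by lra.
Qed.

(** A kernel that decays like [1 / r], with derivative decaying like
    [1 / r ^ 2], kills the boundary terms because the discrepancy at the ends
    is [o(A)]. *)
Lemma abel_lim f f' c c' A1 l :
  continuous f' -> (forall x, is_derive x (1 : R) f (f' x)) ->
  (forall r, A1 <= `|r| -> `|f r| * `|r| <= c) ->
  (forall r, `|f' r| <= c' * wt r) ->
  \int[leb]_(r in `[- A, A]) f r @[A --> +oo] --> l ->
  exists2 m, \int[leb]_(r in `[- A, A]) (D r * f' r) @[A --> +oo] --> m &
    rsum mu A f @[A --> +oo] --> K * l - m.
Proof.
move=> cf' df fc f'c fl.
have /cvg_ex[m Hm] := disc_int_cvg K0 mu_summable cf' f'c.
exists m => //.
have err0 : (rsum mu A f - K * (\int[leb]_(r in `[- A, A]) f r)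
    + \int[leb]_(r in `[- A, A]) (D r * f' r)) @[A --> +oo] --> (0 : R).
  apply/cvgyP => e e0.
  have c0 : 0 <= `|c| by [].
  have [A0 [A00 A0P]] := boundary_small (e := e / (2 * (`|c| + 1)))
    ltac:(by rewrite divr_gt0//; lra).
  exists (Num.max A0 `|A1|) => A; rewrite ge_max => /andP[AA0 AA1].
  have a0 : 0 < A by exact: lt_le_trans AA0.
  have [b1 b2] := A0P A AA0.
  rewrite subr0; apply: le_trans (abel_error (ltW a0) cf' df) _.
  have A1A : A1 <= A by apply: le_trans AA1; exact: ler_norm.
  have f1 := fc A ltac:(by rewrite (gtr0_norm a0)).
  have f2 := fc (- A) ltac:(by rewrite normrN (gtr0_norm a0)).
  rewrite normrN (gtr0_norm a0) in f2; rewrite (gtr0_norm a0) in f1.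
  have cc := ler_norm c.
  have h1 : `|D A| * `|f A| <= e / (2 * (`|c| + 1)) * `|c|.
    apply: le_trans (ler_wpM2r (normr_ge0 _) b1) _.
    rewrite -[leLHS]mulrA ler_wpM2l//; first by rewrite divr_ge0//; lra.
    by rewrite mulrC; lra.
  have h2 : `|lowcount A - K * A| * `|f (- A)| <= e / (2 * (`|c| + 1)) * `|c|.
    apply: le_trans (ler_wpM2r (normr_ge0 _) b2) _.
    rewrite -[leLHS]mulrA ler_wpM2l//; first by rewrite divr_ge0//; lra.
    by rewrite mulrC; lra.
  have : e / (2 * (`|c| + 1)) * `|c| <= e / 2.
    rewrite mulrAC ler_pdivrMr; last lra.
    by nra.
  by lra.
have E : (rsum mu ^~ f) = (fun A => (rsum mu A f
    - K * (\int[leb]_(r in `[- A, A]) f r)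
    + \int[leb]_(r in `[- A, A]) (D r * f' r)) + K * (\int[leb]_(r in `[- A, A]) f r)
    - \int[leb]_(r in `[- A, A]) (D r * f' r)).
  by apply/funext => A; ring.
rewrite E -[K * l - m](add0r) addrA.
apply: cvgB => //; apply: cvgD => //.
by apply: cvgM => //; exact: cvg_cst.
Qed.

End abel_limits.

(** * The Cauchy kernel *)

Section smallness.
Context {R : realType}.
Notation leb := (@lebesgue_measure R).
Variables (mu : wpm R) (K : R).
Hypothesis K0 : 0 < K.
Hypothesis mu_summable : summable_disc mu K.
Local Notation D := (disc mu K).
Local Notation disc_norm := (disc_norm mu K).

Lemma disc_int_le A c (g : R -> R) : continuous g ->
  (forall r, `|r| <= A -> `|g r| <= c * wt r) ->
  `|\int[leb]_(r in `[- A, A]) (D r * g r)| <= c * disc_norm A.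
Proof.
move=> cg gc; have [A0|A0] := leP 0 A; last first.
  have E : `[- A, A]%classic = set0 :> set R.
    by rewrite set_itv_ge// -leNgt bnd_simp; lra.
  by rewrite /disc_norm E !Rintegral_set0 normr0 mulr0.
have E : `[- (-1), -1]%classic = set0 :> set R.
  by rewrite set_itv_ge// -leNgt bnd_simp; lra.
have := @disc_int_diff _ mu K K0 (-1) A c g cg ltac:(lra)
  (fun r H => gc r ltac:(by case/andP: H)).
by rewrite /disc_norm E !Rintegral_set0 !subr0.
Qed.

(** At height [d L] the derivative of the kernel is at most of order
    [1 / (r ^ 2 + L ^ 2)], uniformly in [|s| <= L]. It is tiny on any fixed
    window and dominated by the weight elsewhere. *)
Lemma poisson_small (d e : R) : 0 < d -> 0 < e ->
  exists L0 : R, 0 < L0 /\ forall (L s : R) (g : R -> R), L0 <= L -> `|s| <= L -> continuous g ->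
    (forall r, `|g r| <= ((s - r) ^+ 2 + (d * L) ^+ 2)^-1) ->
    forall A, `|\int[leb]_(r in `[- A, A]) (D r * g r)| <= e.
Proof.
move=> d0 e0; set C := 2 + 3 / d ^+ 2.
have d2 : 0 < d ^+ 2 by rewrite exprn_gt0.
have d3 : 0 < 3 / d ^+ 2 by rewrite divr_gt0.
have C0 : 0 < C by rewrite /C; lra.
have [B0 B0P] := @disc_norm_cauchy _ mu K K0 mu_summable (e / (2 * C))
  ltac:(rewrite divr_gt0//; lra).
set B : R := `|B0|.
have dB : 0 <= disc_norm B.
  by apply: Rintegral_ge0 => x _; rewrite mulr_ge0// ltW// wt_gt0.
have BB0 : B0 <= B by rewrite /B ler_norm.
pose X := 2 * C * (1 + B ^+ 2) * (disc_norm B + 1) / e.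
have X0 : 0 <= X by rewrite /X divr_ge0 ?mulr_ge0//; nra.
exists (1 + X); split; first lra.
move=> L s g LL sL cg gL A.
have L1 : 1 <= L by lra.
have L20 : 0 < L ^+ 2 by rewrite exprn_gt0//; lra.
have dL : 0 < (d * L) ^+ 2 by rewrite exprn_gt0// mulr_gt0//; lra.
(* The constant [C] absorbs the shift by [s], which is at most [L]. *)
have key r : `|g r| <= C / (r ^+ 2 + L ^+ 2).
  apply: le_trans (gL r) _; rewrite -[C]invrK -invfM lef_pV2 ?posrE; last 2 first.
  - by rewrite ltr_wpDl// sqr_ge0.
  - by rewrite mulr_gt0 ?invr_gt0// ltr_wpDl// sqr_ge0.
  rewrite mulrC ler_pdivrMr// /C.
  have -> : ((s - r) ^+ 2 + (d * L) ^+ 2) * (2 + 3 / d ^+ 2) =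
    2 * (s - r) ^+ 2 + 2 * d ^+ 2 * L ^+ 2 + 3 * L ^+ 2 + 3 * (s - r) ^+ 2 / d ^+ 2.
    by field; rewrite gt_eqF.
  have : 0 <= 3 * (s - r) ^+ 2 / d ^+ 2.
    by rewrite divr_ge0 ?(ltW d2)// mulr_ge0// sqr_ge0.
  have sL2 : s ^+ 2 <= L ^+ 2 by move: sL; rewrite ler_norml; nra.
  have := sqr_ge0 (2 * s - r); have := sqr_ge0 L; nra.
have gwt r : `|g r| <= C * wt r.
  apply: le_trans (key r) _; rewrite ler_wpM2l ?(ltW C0)// lef_pV2 ?posrE.
  - by nra.
  - by rewrite ltr_wpDl// sqr_ge0.
  - by nra.
(* Inside the fixed window [[-B, B]] the kernel is of order [L ^ -2]; beyond
   it the tail of the weighted discrepancy is already small. *)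
have small A' : A' <= B -> `|\int[leb]_(r in `[- A', A']) (D r * g r)| <= e / 2.
  move=> A'B.
  apply: (@le_trans _ _ (C * (1 + B ^+ 2) / L ^+ 2 * disc_norm A')).
    apply: disc_int_le => // r rA; apply: le_trans (key r) _.
    rewrite -mulrA -mulrA ler_wpM2l ?(ltW C0)// /wt.
    rewrite mulrAC -[X in _ <= X]invrK lef_pV2 ?posrE ?invf_div; last 2 first.
    - by nra.
    - by rewrite mulr_gt0// divr_gt0//; nra.
    rewrite mulrA ler_pdivrMr; last by nra.
    have rB : r ^+ 2 <= B ^+ 2.
      by rewrite -(real_normK (num_real r)); have := le_trans rA A'B; have := normr_ge0 r; nra.
    by have := sqr_ge0 r; have := sqr_ge0 L; nra.
  have dA' : disc_norm A' <= disc_norm B by apply: disc_norm_nd.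
  have L2 : X <= L ^+ 2 by nra.
  apply: (@le_trans _ _ (C * (1 + B ^+ 2) / L ^+ 2 * (disc_norm B + 1))).
    by rewrite ler_wpM2l; [|rewrite divr_ge0 ?mulr_ge0//; nra|lra].
  rewrite mulrAC ler_pdivrMr; last by nra.
  have : X * e = 2 * C * (1 + B ^+ 2) * (disc_norm B + 1).
    by rewrite /X -mulrA mulVf ?mulr1// gt_eqF.
  have := ler_wpM2r (ltW e0) L2; nra.
have [AB|/ltW AB] := leP A B; first by have := small _ AB; lra.
have := small _ (lexx B).
have := @disc_int_diff _ mu K K0 B A C g cg AB (fun r _ => gwt r).
have := B0P _ _ BB0 AB; rewrite ler_pdivlMr; last lra.
set u := Rintegral _ _ _; set v := Rintegral _ _ _ => h1 h2 h3.
have : `|u| <= `|u - v| + `|v| by rewrite -{1}(subrK v u) ler_normD.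
nra.
Qed.

End smallness.

Section kernels.
Context {R : realType}.
Notation leb := (@lebesgue_measure R).
Implicit Types (s y r : R).

Lemma continuous_quot (n m : R -> R) : continuous n -> continuous m ->
  (forall r, m r != 0) -> continuous (fun r => n r / m r).
Proof. by move=> cn cm m0 r; apply: cvgM; [exact: cn|apply: cvgV; [exact: m0|exact: cm]]. Qed.

Lemma continuous_sqr (n : R -> R) : continuous n -> continuous (fun r => n r ^+ 2).
Proof. by move=> cn r; apply: cvgM; exact: cn. Qed.

Definition kden s y r : R := (s - r) ^+ 2 + y ^+ 2.

Lemma kden_gt0 s y r : y != 0 -> 0 < kden s y r.
Proof. by move=> y0; rewrite /kden ltr_wpDl ?sqr_ge0// exprn_even_gt0. Qed.

Lemma continuous_subr s : continuous (fun r => s - r).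
Proof. by move=> r; apply: cvgB; [exact: cvg_cst|exact: cvg_id]. Qed.

Lemma continuous_kden s y : continuous (kden s y).
Proof.
move=> r; apply: cvgD; last exact: cvg_cst.
exact: (continuous_sqr (@continuous_subr s)).
Qed.

(** Real part of [1 / (s + i y - r)]; for [y = 0] and [r = s] it is 0, like the
    inverse of 0. *)
Definition krel s y r : R := (s - r) / kden s y r.
(** Imaginary part of [1 / (s + i y - r)]. *)
Definition kiml s y r : R := - y / kden s y r.
(** Derivative of [krel] in its last argument. *)
Definition dkrel s y r : R := ((s - r) ^+ 2 - y ^+ 2) / (kden s y r) ^+ 2.
(** Derivative of [kiml] in its last argument. *)
Definition dkiml s y r : R := (- 2 * y * (s - r)) / (kden s y r) ^+ 2.

Variables (s y : R).
Hypothesis y0 : y != 0.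

Let den_neq0 r : kden s y r != 0. Proof. by rewrite gt_eqF// kden_gt0. Qed.

Lemma is_derive_kden r : is_derive r (1 : R) (kden s y) (- 2 * (s - r)).
Proof. by rewrite /kden; apply: is_derive_eq; rewrite /GRing.scale/=; ring. Qed.

Lemma is_derive_krel r : is_derive r (1 : R) (krel s y) (dkrel s y r).
Proof.
apply: (is_derive_quot (n' := -1) (den_neq0 r) _ (is_derive_kden r)).
  by apply: is_derive_eq; rewrite /GRing.scale/=; ring.
by rewrite /dkrel; congr (_ / _); rewrite /kden; ring.
Qed.

Lemma is_derive_kiml r : is_derive r (1 : R) (kiml s y) (dkiml s y r).
Proof.
apply: (is_derive_quot (n' := 0) (den_neq0 r) _ (is_derive_kden r)).
by rewrite /dkiml; congr (_ / _); ring.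
Qed.

Lemma continuous_dkrel : continuous (dkrel s y).
Proof.
apply: continuous_quot.
- move=> r; apply: cvgB; last exact: cvg_cst.
  exact: (continuous_sqr (@continuous_subr s)).
- exact/continuous_sqr/continuous_kden.
- by move=> r; rewrite expf_neq0.
Qed.

Lemma continuous_dkiml : continuous (dkiml s y).
Proof.
apply: continuous_quot.
- by move=> r; apply: cvgM; [exact: cvg_cst|exact: continuous_subr].
- exact/continuous_sqr/continuous_kden.
- by move=> r; rewrite expf_neq0.
Qed.

Lemma continuous_krel : continuous (krel s y).
Proof.
by apply: continuous_quot => //; [exact: continuous_subr|exact: continuous_kden].
Qed.

Lemma continuous_kiml : continuous (kiml s y).
Proof.
apply: continuous_quot => //; last exact: continuous_kden.
by move=> r; exact: cvg_cst.
Qed.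

Lemma dkrel_le r : `|dkrel s y r| <= (kden s y r)^-1.
Proof.
have k0 := kden_gt0 s r y0.
rewrite normrM (@ger0_norm _ (_ ^-1)) ?invr_ge0 ?sqr_ge0// ler_pdivrMr ?exprn_gt0//.
rewrite expr2 mulKf ?gt_eqF// /kden ler_norml.
by have := sqr_ge0 (s - r); have := sqr_ge0 y; lra.
Qed.

Lemma dkiml_le r : `|dkiml s y r| <= (kden s y r)^-1.
Proof.
have k0 := kden_gt0 s r y0.
rewrite normrM (@ger0_norm _ (_ ^-1)) ?invr_ge0 ?sqr_ge0// ler_pdivrMr ?exprn_gt0//.
rewrite expr2 mulKf ?gt_eqF// /kden ler_norml.
by have := sqr_ge0 (s - r + y); have := sqr_ge0 (s - r - y); nra.
Qed.

(** The two quadratic polynomials are comparable, so the derivatives of the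
    kernel at any point off the axis are dominated by the weight. *)
Lemma kden_wt : exists c, forall r, (kden s y r)^-1 <= c * wt r.
Proof.
have y2 : 0 < y ^+ 2 by rewrite exprn_even_gt0.
exists (2 + (1 + 2 * s ^+ 2) / y ^+ 2) => r.
rewrite -[leLHS]mul1r ler_pdivrMr ?kden_gt0// mulrAC /wt ler_pdivlMr; last first.
  by have := sqr_ge0 r; lra.
rewrite mul1r /kden.
have -> : (2 + (1 + 2 * s ^+ 2) / y ^+ 2) * ((s - r) ^+ 2 + y ^+ 2) =
  2 * (s - r) ^+ 2 + 2 * y ^+ 2 + 1 + 2 * s ^+ 2 +
  (1 + 2 * s ^+ 2) * (s - r) ^+ 2 / y ^+ 2 by field.
have : 0 <= (1 + 2 * s ^+ 2) * (s - r) ^+ 2 / y ^+ 2.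
  by rewrite divr_ge0 ?(ltW y2)// mulr_ge0 ?sqr_ge0//; have := sqr_ge0 s; lra.
by have := sqr_ge0 (2 * s - r); lra.
Qed.

Lemma krel_decay r : 2 * `|s| + 1 <= `|r| -> `|krel s y r| * `|r| <= 2.
Proof.
move=> sr; have k0 := kden_gt0 s r y0.
rewrite normrM (@ger0_norm _ (_ ^-1)) ?invr_ge0 ?(ltW k0)//.
rewrite mulrAC ler_pdivrMr// /kden -(real_normK (num_real (s - r))).
have : `|r| <= `|r - s| + `|s| by rewrite -{1}(subrK s r) ler_normD.
rewrite distrC; set a := `|s - r|; set b := `|s| in sr *; set c := `|r| in sr *.
have a0 : (0 : R) <= a by exact: normr_ge0. 
have b0 : (0 : R) <= b by exact: normr_ge0.
move=> cab; have := sqr_ge0 y; nra.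
Qed.

Lemma kiml_decay r : 2 * `|s| + 1 <= `|r| -> `|kiml s y r| * `|r| <= 2 * `|y|.
Proof.
move=> sr; have k0 := kden_gt0 s r y0.
rewrite normrM normrN (@ger0_norm _ (_ ^-1)) ?invr_ge0 ?(ltW k0)//.
rewrite mulrAC ler_pdivrMr// /kden -(real_normK (num_real (s - r))).
have : `|r| <= `|r - s| + `|s| by rewrite -{1}(subrK s r) ler_normD.
rewrite distrC; set a := `|s - r|; set b := `|s| in sr *; set c := `|r| in sr *.
have a0 : (0 : R) <= a by exact: normr_ge0. 
have b0 : (0 : R) <= b by exact: normr_ge0.
move=> cab; rewrite -[leRHS]mulrA [leRHS]mulrCA ler_wpM2l//.
by have := sqr_ge0 y; nra.
Qed.

(** Mean value bound for the logarithm on a half-line away from 0. *)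
Lemma ln_dist (a b c : R) : 0 < c -> c <= a -> c <= b ->
  `|ln a - ln b| <= `|a - b| / c.
Proof.
move=> c0 ca cb.
have H (u v : R) : c <= u -> c <= v -> ln u - ln v <= `|u - v| / c.
  move=> cu cv; have v0 : 0 < v by lra.
  have u0 : 0 < u by lra.
  rewrite -ln_div ?posrE// (_ : u / v = 1 + (u - v) / v); last first.
    by field; rewrite gt_eqF.
  apply: le_trans (le_ln1Dx _) _.
    by have := divr_gt0 u0 v0; rewrite mulrBl divff ?gt_eqF//; lra.
  apply: (@le_trans _ _ (`|u - v| / v)).
    by rewrite ler_wpM2r ?invr_ge0 ?(ltW v0)// ler_norm.
  by rewrite ler_wpM2l// lef_pV2.
by rewrite ler_norml -lerNl opprB distrC {1}H//= distrC H.
Qed.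

(** The primitive is, up to sign, half the logarithm of the denominator, whose
    values at the two ends of a symmetric window have ratio tending to 1; this
    is where the symmetry of the truncation matters. *)
Lemma int_krel_lim : \int[leb]_(r in `[- A, A]) krel s y r @[A --> +oo] --> (0 : R).
Proof.
apply/cvgyP => e e0.
exists (2 * `|s| + 1 + 16 * `|s| / e) => A; rewrite subr0.
have s0 : (0 : R) <= `|s| by exact: normr_ge0.
have se : 0 <= 16 * `|s| / e by rewrite divr_ge0 ?mulr_ge0// ltW.
move=> AA; have A1 : 2 * `|s| + 1 <= A by lra.
have df r : is_derive r (1 : R) (fun x => - (ln (kden s y x) / 2)) (krel s y r).
  have d1 := is_derive_kden r.
  have d2 := @is_derive1_ln _ (kden s y r) (kden_gt0 s r y0).
  have d3 := is_derive1_comp d2 d1.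
  apply: is_derive_eq; rewrite /krel/GRing.scale/=; field.
  exact: den_neq0.
rewrite (Rintegral_FTC continuous_krel df); last by lra.
rewrite -opprD normrN -mulrBl normrM (@ger0_norm _ 2^-1) ?invr_ge0//.
have c0 : 0 < A ^+ 2 / 4 by rewrite divr_gt0// exprn_gt0//; lra.
have := normr_ge0 s; rewrite -{1}normrN => _.
have sA : - A <= 2 * s <= A by rewrite -ler_norml normrM ger0_norm//; lra.
have h t : 0 <= A / 2 -> A / 2 <= t -> A ^+ 2 / 4 <= t ^+ 2 by nra.
have A2 : 0 <= A / 2 by lra.
case/andP: sA => sA1 sA2.
have kA1 : A ^+ 2 / 4 <= kden s y A.
  rewrite /kden -[(s - A) ^+ 2]sqrrN opprB.
  by have := h (A - s) A2 ltac:(lra); have := sqr_ge0 y; lra.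
have kA2 : A ^+ 2 / 4 <= kden s y (- A).
  rewrite /kden opprK.
  by have := h (s + A) A2 ltac:(lra); have := sqr_ge0 y; lra.
have := ln_dist c0 kA1 kA2.
move=> H; rewrite ler_pdivrMr//; apply: le_trans H _.
rewrite ler_pdivrMr// /kden.
rewrite (_ : _ - _ = - (4 * A * s)); last by ring.
rewrite normrN !normrM (@ger0_norm _ A) ?(@ger0_norm _ 4)//; last lra.
have : 16 * `|s| <= e * A.
  by rewrite -ler_pdivrMl// mulrC; lra.
nra.
Qed.

(** The primitive is an arctangent, whose total variation is [pi]. *)
Lemma int_kiml_lim : 0 < y -> \int[leb]_(r in `[- A, A]) kiml s y r @[A --> +oo] --> (- pi : R).
Proof.
move=> ypos.
have df r : is_derive r (1 : R) (fun x => atan ((s - x) / y)) (kiml s y r).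
  have d1 : is_derive r (1 : R) (fun x => (s - x) / y) (- y^-1).
    by apply: is_derive_eq; rewrite /GRing.scale/=; ring.
  have d2 : is_derive ((fun x => (s - x) / y) r) (1 : R) atan (1 + ((s - r) / y) ^+ 2)^-1.
    exact: is_derive1_atan.
  have d3 := @is_derive1_comp _ _ (fun x => (s - x) / y) _ _ _ d2 d1.
  apply: is_derive_eq; rewrite /kiml/kden/GRing.scale/=; field.
  rewrite y0/= gt_eqF//=; last by have := kden_gt0 s r y0; rewrite /kden addrC.
have E A : 0 <= A -> \int[leb]_(r in `[- A, A]) kiml s y r =
    - atan ((A - s) / y) - atan ((A + s) / y).
  move=> A0; rewrite (Rintegral_FTC continuous_kiml df); last by lra.
  by rewrite opprK (addrC s A); congr (_ - _); rewrite -atanN -mulNr opprB.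
have lim t : atan ((A + t) / y) @[A --> +oo] --> (pi / 2 : R).
  apply: cvg_comp (@cvgy_atan R).
  apply/cvgryPge => M; near=> A.
  rewrite ler_pdivlMr// -lerBlDr; near: A; apply: nbhs_pinfty_ge; exact: num_real.
have -> : - pi = - (pi / 2) - pi / 2 :> R by field.
have H : - atan ((A - s) / y) - atan ((A + s) / y) @[A --> +oo] --> (- (pi / 2) - pi / 2 : R).
  by apply: cvgB; [apply: cvgN|]; exact: lim.
apply: cvg_trans H; apply: near_eq_cvg; near=> A.
by rewrite -E//; near: A; apply: nbhs_pinfty_ge; exact: num_real.
Unshelve. all: by end_near. Qed.

End kernels.

(** * Modulus and convergence in the complex numbers *)

Section modulus.
Context {R : realType}.
Implicit Types (z w : R[i]) (f g : R -> R[i]).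

(** The modulus as an element of [R]; the norm of [R[i]] has its values in
    [R[i]]. *)
Definition cm z : R := ComplexField.Normc.normc z.

Lemma normrC z : `|z| = (cm z)%:C. Proof. by []. Qed.

Lemma cmE z : cm z = Num.sqrt (complex.Re z ^+ 2 + complex.Im z ^+ 2).
Proof. by case: z. Qed.

Lemma sqr_cm z : cm z ^+ 2 = complex.Re z ^+ 2 + complex.Im z ^+ 2.
Proof. by rewrite cmE sqr_sqrtr// addr_ge0// sqr_ge0. Qed.

Lemma cm_ge0 z : 0 <= cm z.
Proof. by rewrite cmE sqrtr_ge0. Qed.

Lemma cm0 : cm 0 = 0. Proof. exact: ComplexField.Normc.normc0. Qed.

Lemma cm0_eq0 z : cm z = 0 -> z = 0.
Proof. exact: ComplexField.Normc.eq0_normc. Qed.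

Lemma cm_gt0 z : z != 0 -> 0 < cm z.
Proof. by move=> z0; rewrite lt_def cm_ge0 andbT; apply: contra z0 => /eqP/cm0_eq0->. Qed.

Lemma cmM z w : cm (z * w) = cm z * cm w.
Proof. exact: ComplexField.Normc.normcM. Qed.

Lemma cmV z : cm z^-1 = (cm z)^-1.
Proof. exact: ComplexField.Normc.normcV. Qed.

Lemma cmN z : cm (- z) = cm z.
Proof. exact: normcN. Qed.

Lemma cmB z w : cm (z - w) = cm (w - z).
Proof. by rewrite -cmN opprB. Qed.

Lemma le_cmD z w : cm (z + w) <= cm z + cm w.
Proof. exact: le_normcD. Qed.

Lemma cm_real (x : R) : cm x%:C = `|x|.
Proof. by rewrite cmE/= expr0n/= addr0 sqrtr_sqr. Qed.

Lemma cm_i : cm 'i = 1.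
Proof. by rewrite cmE/= expr0n/= add0r expr1n sqrtr1. Qed.

Lemma Re_le_cm z : `|complex.Re z| <= cm z.
Proof. by rewrite cmE -sqrtr_sqr ler_wsqrtr// lerDl sqr_ge0. Qed.

Lemma Im_le_cm z : `|complex.Im z| <= cm z.
Proof. by rewrite cmE -sqrtr_sqr ler_wsqrtr// lerDr sqr_ge0. Qed.

Lemma cm_le_ReIm z : cm z <= `|complex.Re z| + `|complex.Im z|.
Proof.
rewrite -(ler_pXn2r (n := 2))// ?nnegrE ?cm_ge0 ?addr_ge0//.
rewrite sqr_cm sqrrD !real_normK ?num_real// lerD2r lerDl.
by rewrite mulrn_wge0// mulr_ge0.
Qed.

Lemma ReD z w : complex.Re (z + w) = complex.Re z + complex.Re w.
Proof. by case: z w => [a b] [c d]. Qed.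
Lemma ImD z w : complex.Im (z + w) = complex.Im z + complex.Im w.
Proof. by case: z w => [a b] [c d]. Qed.
Lemma ReN z : complex.Re (- z) = - complex.Re z.
Proof. by case: z. Qed.
Lemma ImN z : complex.Im (- z) = - complex.Im z.
Proof. by case: z. Qed.

Lemma cm_dist z w v : cm (z - w) <= cm (z - v) + cm (v - w).
Proof. by rewrite -(subrKA v z) le_cmD. Qed.

(** The topology of [R[i]] is the one of the real-valued modulus. *)
Lemma cvgCP {T} {F : set_system T} {FF : Filter F} (f : T -> R[i]) (l : R[i]) :
  f @ F --> l <-> forall e : R, 0 < e -> \forall t \near F, cm (f t - l) <= e.
Proof.
split=> [/cvgrPdist_le fl e e0|fl].
  have := fl e%:C; rewrite ltcR => /(_ e0); apply: filterS => t.
  by rewrite normrC lecR cmB.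
apply/cvgrPdist_le => e; rewrite ltcE => /andP[/eqP e2 /= e1].
have := fl _ e1; apply: filterS => t; rewrite cmB => H.
by rewrite normrC lecE/= H; case: e {e1 H} e2 => ? ? /= ->; rewrite eqxx.
Qed.

Lemma cvgyCP f l : f A @[A --> +oo] --> l <->
  forall e : R, 0 < e -> exists A0, forall A, A0 <= A -> cm (f A - l) <= e.
Proof.
rewrite cvgCP; split=> fl e e0.
  have [A0 [_ A0P]] := fl e e0.
  by exists (A0 + 1) => A AA; apply: A0P; lra.
have [A0 A0P] := fl e e0.
by exists A0; split; [exact: num_real|move=> A /ltW; exact: A0P].
Qed.

Lemma cvgC_comp {T} {F : set_system T} {FF : Filter F} (f : T -> R[i]) (a b : R) :
  complex.Re (f t) @[t --> F] --> a -> complex.Im (f t) @[t --> F] --> b ->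
  f @ F --> a +i* b.
Proof.
move=> /cvgrPdist_le fa /cvgrPdist_le fb; apply/cvgCP => e e0.
have e2 : 0 < e / 2 by lra.
have := fb _ e2; have := fa _ e2; apply: filterS2 => t h1 h2.
apply: le_trans (cm_le_ReIm _) _; move: h1 h2; case: (f t) => c d /=.
by rewrite distrC (distrC b); lra.
Qed.

Lemma cvgC_Re {T} {F : set_system T} {FF : Filter F} (f : T -> R[i]) (l : R[i]) :
  f @ F --> l -> complex.Re (f t) @[t --> F] --> complex.Re l.
Proof.
move=> /cvgCP fl; apply/cvgrPdist_le => e /fl; apply: filterS => t.
by apply: le_trans; rewrite distrC -ReN -ReD Re_le_cm.
Qed.

Lemma cvgC_Im {T} {F : set_system T} {FF : Filter F} (f : T -> R[i]) (l : R[i]) :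
  f @ F --> l -> complex.Im (f t) @[t --> F] --> complex.Im l.
Proof.
move=> /cvgCP fl; apply/cvgrPdist_le => e /fl; apply: filterS => t.
by apply: le_trans; rewrite distrC -ImN -ImD Im_le_cm.
Qed.

Lemma cauchyCy f :
  (forall e : R, 0 < e -> exists A0, forall A B, A0 <= A -> A <= B ->
     cm (f B - f A) <= e) ->
  exists l : R[i], f A @[A --> +oo] --> l.
Proof.
move=> fC.
have /cvg_ex[a Ha] : cvg (complex.Re (f A) @[A --> +oo]).
  apply: cauchyy => e /fC[A0 H]; exists A0 => A B AA AB.
  by rewrite -ReN -ReD; apply: le_trans (Re_le_cm _) (H _ _ AA AB).
have /cvg_ex[b Hb] : cvg (complex.Im (f A) @[A --> +oo]).
  apply: cauchyy => e /fC[A0 H]; exists A0 => A B AA AB.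
  by rewrite -ImN -ImD; apply: le_trans (Im_le_cm _) (H _ _ AA AB).
by exists (a +i* b); exact: cvgC_comp.
Qed.

Lemma limC_le f (l : R[i]) (c : R) (w : R[i]) : f A @[A --> +oo] --> l ->
  (forall A, cm (f A - w) <= c) -> cm (l - w) <= c.
Proof.
move=> /cvgyCP fl fc; apply/ler_addgt0Pr => e e0.
have [A0 /(_ A0 (lexx _)) H] := fl e e0.
apply: le_trans (cm_dist _ _ (f A0)) _.
by rewrite addrC lerD// ?fc// cmB.
Qed.

End modulus.

(** * Truncated transforms as complex sums *)

Section csum.
Context {R : realType}.
Implicit Types (mu : wpm R) (A B x s : R) (z : R[i]) (g : R -> R[i]).

Definition csum mu A g : R[i] := \sum_(x <- atoms mu A) (mass mu x)%:C * g x.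

Lemma Re_csum mu A g : complex.Re (csum mu A g) = rsum mu A (fun x => complex.Re (g x)).
Proof.
rewrite /csum /rsum; elim: (atoms mu A) => [|x t ih]; first by rewrite !big_nil.
by rewrite !big_cons ReD ih; case: (g x) => a b /=; rewrite mul0r subr0.
Qed.

Lemma Im_csum mu A g : complex.Im (csum mu A g) = rsum mu A (fun x => complex.Im (g x)).
Proof.
rewrite /csum /rsum; elim: (atoms mu A) => [|x t ih]; first by rewrite !big_nil.
by rewrite !big_cons ImD ih; case: (g x) => a b /=; rewrite mul0r addr0.
Qed.

Lemma csumD mu A g g' : csum mu A (fun x => g x + g' x) = csum mu A g + csum mu A g'.
Proof. by rewrite /csum -big_split; apply: eq_bigr => x _; rewrite mulrDr. Qed.

Lemma csumN mu A g : csum mu A (fun x => - g x) = - csum mu A g.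
Proof. by rewrite /csum -sumrN; apply: eq_bigr => x _; rewrite mulrN. Qed.

Lemma csumB mu A g g' : csum mu A (fun x => g x - g' x) = csum mu A g - csum mu A g'.
Proof. by rewrite csumD csumN. Qed.

Lemma csumZ mu A (c : R[i]) g : csum mu A (fun x => c * g x) = c * csum mu A g.
Proof. by rewrite /csum mulr_sumr; apply: eq_bigr => x _; rewrite mulrCA. Qed.

Lemma csum_real mu A (f : R -> R) : csum mu A (fun x => (f x)%:C) = (rsum mu A f)%:C.
Proof.
apply/eqP; rewrite eq_complex Re_csum Im_csum/= eqxx/=.
by rewrite /rsum big1// => x _; rewrite mulr0.
Qed.

Lemma eq_csum mu A g g' : (forall x, supp mu x -> g x = g' x) ->
  csum mu A g = csum mu A g'.
Proof.
move=> gg; rewrite /csum big_seq [RHS]big_seq; apply: eq_bigr => x.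
by rewrite mem_atoms => /andP[_ /asboolP /gg ->].
Qed.

Lemma cm_sum (s : seq R) (P : pred R) g (p : R -> R) :
  (forall x, x \in s -> P x -> cm (g x) <= p x) ->
  cm (\sum_(x <- s | P x) g x) <= \sum_(x <- s | P x) p x.
Proof.
move=> gp; rewrite big_seq_cond [leRHS]big_seq_cond.
elim/big_rec2: _ => [|x a b /andP[xs Px] ab]; first by rewrite cm0.
by apply: le_trans (le_cmD _ _) _; rewrite lerD// gp.
Qed.

Lemma cm_csum mu A g p : (forall x, supp mu x -> cm (g x) <= p x) ->
  cm (csum mu A g) <= rsum mu A p.
Proof.
move=> gp; apply: cm_sum => x; rewrite mem_atoms => /andP[_ /asboolP /gp gx] _.
by rewrite cmM cm_real ger0_norm ?mass_ge0// ler_wpM2l// mass_ge0.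
Qed.

Lemma cm_csum_diff mu A B g p : A <= B -> (forall x, supp mu x -> cm (g x) <= p x) ->
  cm (csum mu B g - csum mu A g) <= rsum mu B p - rsum mu A p.
Proof.
move=> AB gp; rewrite (rsum_widen _ _ AB) addrAC subrr add0r.
rewrite (_ : _ - _ = \sum_(x <- atoms mu B | ~~ (`|x| <= A)) (mass mu x)%:C * g x).
  apply: cm_sum => x; rewrite mem_atoms => /andP[_ /asboolP /gp gx] _.
  by rewrite cmM cm_real ger0_norm ?mass_ge0// ler_wpM2l// mass_ge0.
rewrite /csum (bigID (fun x => `|x| <= A))/=.
rewrite -[X in _ - \sum_(x <- X) _](filter_predT (atoms mu A)).
rewrite (perm_big _ (atoms_filter _ _ AB)) big_filter.
rewrite [X in _ - X](_ : _ = \sum_(x <- atoms mu B | `|x| <= A) (mass mu x)%:C * g x).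
  by rewrite addrAC subrr add0r.
by apply: eq_bigl => x; rewrite andbT.
Qed.

Lemma rsumZ mu A (c : R) (f : R -> R) : rsum mu A (fun x => c * f x) = c * rsum mu A f.
Proof. by rewrite /rsum mulr_sumr; apply: eq_bigr => x _; rewrite mulrCA. Qed.

Lemma ReV (z : R[i]) (x : R) :
  complex.Re (z - x%:C)^-1 = krel (complex.Re z) (complex.Im z) x.
Proof. by case: z => a b /=; rewrite subr0. Qed.

Lemma ImV (z : R[i]) (x : R) :
  complex.Im (z - x%:C)^-1 = kiml (complex.Re z) (complex.Im z) x.
Proof. by case: z => a b /=; rewrite subr0 /kiml mulNr. Qed.

Lemma measurable_invr : measurable_fun [set: R] (fun x : R => x^-1).
Proof.
have m0 : measurable ([set 0] : set R) by exact: measurable_set1.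
rewrite -(setUv [set 0]).
apply/(measurable_funU _ m0 (measurableC m0)); split.
  exact: measurable_fun_set1.
apply: open_continuous_measurable_fun; first exact: closed_openC.
by move=> x; rewrite inE/= => /eqP x0; exact: inv_continuous.
Qed.

Lemma measurable_quot (f g : R -> R) : measurable_fun setT f -> measurable_fun setT g ->
  measurable_fun setT (fun x => f x / g x).
Proof.
move=> mf mg; apply: measurable_funM => //.
exact: (measurableT_comp measurable_invr mg).
Qed.

Lemma measurable_krel s y : measurable_fun setT (krel s y).
Proof.
apply: measurable_quot; apply: continuous_mfun; first exact: continuous_subr.
exact: continuous_kden.
Qed.

Lemma measurable_kiml s y : measurable_fun setT (kiml s y).
Proof.
apply: measurable_quot; apply: continuous_mfun; last exact: continuous_kden.
by move=> x; exact: cvg_cst.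
Qed.

Lemma pv_truncE mu A z : pv_trunc mu A z = csum mu A (fun x => (z - x%:C)^-1).
Proof.
apply/eqP; rewrite eq_complex Re_csum Im_csum /pv_trunc/cintegral/=; apply/andP; split.
  under eq_Rintegral do rewrite ReV; rewrite Rintegral_window; last exact: measurable_krel.
  by apply/eqP; apply: eq_bigr => x _; rewrite ReV.
under eq_Rintegral do rewrite ImV; rewrite Rintegral_window; last exact: measurable_kiml.
by apply/eqP; apply: eq_bigr => x _; rewrite ImV.
Qed.

Lemma pv_trunc_Re mu A z : complex.Re (pv_trunc mu A z) =
  rsum mu A (krel (complex.Re z) (complex.Im z)).
Proof. by rewrite pv_truncE Re_csum; apply: eq_bigr => x _; rewrite ReV. Qed.

Lemma pv_trunc_Im mu A z : complex.Im (pv_trunc mu A z) =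
  rsum mu A (kiml (complex.Re z) (complex.Im z)).
Proof. by rewrite pv_truncE Im_csum; apply: eq_bigr => x _; rewrite ImV. Qed.

(** A lower bound for the distance of [z] to the support. It covers both the
    points off the real axis and the real points outside the support, so that
    the two cases of the transform are treated together. *)
Definition separated mu (d : R) z := 0 < d /\ forall x, supp mu x -> d <= cm (z - x%:C).

Lemma separated_off_axis mu z : complex.Im z != 0 -> separated mu `|complex.Im z| z.
Proof.
move=> z0; split; first by rewrite normr_gt0.
move=> x _; apply: le_trans (Im_le_cm (z - x%:C)).
by rewrite ImD ImN/= subr0.
Qed.

Lemma separated_im mu z (y : R) : 0 < y -> y <= complex.Im z -> separated mu y z.
Proof.
move=> y0 yz; split=> // x _; apply: le_trans (Im_le_cm (z - x%:C)).
by rewrite ImD ImN/= subr0; apply: le_trans yz (ler_norm _).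
Qed.

(** The support is locally finite, hence closed. *)
Lemma separated_real mu s : ~ supp mu s -> exists d, separated mu d s%:C.
Proof.
move=> ns; apply: contrapT => H; apply: ns => U oU Us.
have /nbhs_ballP[e /= e0 eU] : nbhs s U by exact: open_nbhs_nbhs.
have [x [sx xe]] : exists x, supp mu x /\ `|s - x| < e.
  apply: contrapT => nx; apply: H; exists e; split=> // x sx.
  rewrite -rmorphB cm_real leNgt; apply/negP => xe; apply: nx.
  by exists x.
by apply: sx => //; apply: eU; rewrite -ball_normE.
Qed.

Lemma separated_not_atom mu d z : separated mu d z -> ~ real_atom mu z.
Proof.
move=> [d0 H] [x sx xz]; have := H x sx.
by rewrite -xz subrr cm0 leNgt d0.
Qed.

End csum.

(** * Convergence of the principal values *)

Section transform.
Context {R : realType}.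
Notation leb := (@lebesgue_measure R).
Variables (mu : wpm R) (K : R).
Hypothesis K0 : 0 < K.
Hypothesis mu_summable : summable_disc mu K.
Local Notation D := (disc mu K).
Implicit Types (A B x s y : R) (z w k : R[i]) (g : R -> R[i]).

(** Abel summation at a point of the upper half-plane. The limits [m1] and [m2]
    are kept explicit, because they become negligible far from the axis. *)
Lemma half_plane_lim s y : 0 < y -> exists m1 m2 : R,
  [/\ \int[leb]_(r in `[- A, A]) (D r * dkrel s y r) @[A --> +oo] --> m1,
      \int[leb]_(r in `[- A, A]) (D r * dkiml s y r) @[A --> +oo] --> m2,
      rsum mu A (krel s y) @[A --> +oo] --> - m1 &
      rsum mu A (kiml s y) @[A --> +oo] --> - (K * pi) - m2].
Proof.
move=> y0; have y1 : y != 0 by rewrite gt_eqF.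
have [c cP] := kden_wt s y1.
have [m1 H1 H2] := abel_lim K0 mu_summable (@continuous_dkrel _ s y y1)
  (@is_derive_krel _ s y y1) (@krel_decay _ s y y1)
  (fun r => le_trans (dkrel_le s y1 r) (cP r)) (int_krel_lim s y1).
have [m2 H3 H4] := abel_lim K0 mu_summable (@continuous_dkiml _ s y y1)
  (@is_derive_kiml _ s y y1) (@kiml_decay _ s y y1)
  (fun r => le_trans (dkiml_le s y1 r) (cP r)) (int_kiml_lim s y1 y0).
by exists m1, m2; split=> //; [move: H2; rewrite mulr0 sub0r|move: H4; rewrite mulrN].
Qed.

Lemma kiml01 x : kiml 0 1 x = - wt x.
Proof. by rewrite /kiml /kden/wt expr1n sub0r sqrrN addrC mulNr mul1r. Qed.

Lemma krel01 x : krel 0 1 x = - (x * wt x).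
Proof. by rewrite /krel /kden/wt expr1n sub0r sqrrN addrC mulNr. Qed.

Lemma rsumN A (f : R -> R) : rsum mu A (fun x => - f x) = - rsum mu A f.
Proof. by rewrite /rsum -sumrN; apply: eq_bigr => x _; rewrite mulrN. Qed.

Lemma wt_sum_nd : {homo (rsum mu ^~ wt) : A B / A <= B}.
Proof.
move=> A B AB; rewrite (rsum_widen _ _ AB) lerDl sumr_ge0// => x _.
by rewrite mulr_ge0 ?mass_ge0// ltW// wt_gt0.
Qed.

(** The imaginary part of the truncated transform at [i] is minus the weighted
    sum and converges. *)
Lemma wt_sum_bounded : exists Q, 0 <= Q /\ forall A, rsum mu A wt <= Q.
Proof.
have [m1 [m2 [_ _ _]]] := half_plane_lim 0 (y := 1) ltr01.
move=> /cvgyP /(_ 1 ltr01)[A0 H].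
exists (`|K * pi + m2| + 1); split; first by rewrite addr_ge0.
move=> A; apply: le_trans (wt_sum_nd (_ : A <= Num.max A A0)) _.
  by rewrite le_max lexx.
have := H (Num.max A A0); rewrite le_max lexx orbT => /(_ isT).
have -> : rsum mu (Num.max A A0) (kiml 0 1) = - rsum mu (Num.max A A0) wt.
  by rewrite -rsumN; apply: eq_bigr => x _; rewrite kiml01.
rewrite ler_norml => /andP[+ _]; have := ler_norm (K * pi + m2).
set u := rsum _ _ _; set v := `|_|; lra.
Qed.

(** The real part of the transform at [i]. *)
Lemma odd_sum_cvg : exists l : R, rsum mu A (fun x => x * wt x) @[A --> +oo] --> l.
Proof.
have [m1 [m2 [_ _ H _]]] := half_plane_lim 0 (y := 1) ltr01.
exists m1; rewrite -[m1]opprK.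
have -> : (fun A => rsum mu A (fun x => x * wt x)) = (fun A => - rsum mu A (krel 0 1)).
  apply/funext => A; rewrite -rsumN; apply: eq_bigr => x _.
  by rewrite krel01 opprK.
exact: cvgN.
Qed.

Lemma wt_sum_cauchy e : 0 < e ->
  exists A0, forall A B, A0 <= A -> A <= B -> rsum mu B wt - rsum mu A wt <= e.
Proof. have [Q [_ HQ]] := wt_sum_bounded; exact: (nd_bounded_cauchy wt_sum_nd HQ). Qed.

(** The threshold depends on the majorant only, which is what makes the later
    estimates uniform in [z]. *)
Lemma csum_cauchy (e C : R) : 0 < e -> 0 <= C -> exists A0, forall A B g,
  (forall x, supp mu x -> cm (g x) <= C * wt x) -> A0 <= A -> A <= B ->
  cm (csum mu B g - csum mu A g) <= e.
Proof.
move=> e0 C0.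
have [A0 H] := @wt_sum_cauchy (e / (C + 1)) ltac:(by rewrite divr_gt0//; lra).
exists A0 => A B g gC AA AB; apply: le_trans (cm_csum_diff AB gC) _.
rewrite !rsumZ -mulrBr; have := H A B AA AB; rewrite ler_pdivlMr; last lra.
have := wt_sum_nd AB => /=; set u := rsum _ _ _; set v := rsum _ _ _; nra.
Qed.

Lemma csum_cvg (C : R) g : 0 <= C -> (forall x, supp mu x -> cm (g x) <= C * wt x) ->
  exists l : R[i], csum mu A g @[A --> +oo] --> l.
Proof.
move=> C0 gC; apply: cauchyCy => e e0.
have [A0 H] := csum_cauchy e0 C0; exists A0 => A B; exact: H.
Qed.

(** Comparison constant between the kernel based at [z] and the one based at
    [- i]. *)
Definition rho (d : R) z := 1 + cm (z + 'i) / d.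

Lemma rho_ge1 d z : 0 < d -> 1 <= rho d z.
Proof. by move=> d0; rewrite /rho lerDl divr_ge0 ?cm_ge0// ltW. Qed.

Lemma wtC x : wt x = (cm (x%:C + 'i)) ^- 2.
Proof. by rewrite sqr_cm/= /wt addr0 add0r expr1n addrC. Qed.

Lemma cm_xi_gt0 x : 0 < cm (x%:C + 'i).
Proof. by apply: cm_gt0; rewrite eq_complex/= add0r oner_eq0 andbF. Qed.

(** The ratio [(x + i) / (z - x)] equals [(z + i) / (z - x) - 1]. *)
Lemma cm_inv_le d z x : separated mu d z -> supp mu x ->
  cm (z - x%:C)^-1 <= rho d z / cm (x%:C + 'i).
Proof.
move=> [d0 H] /H xz; rewrite cmV ler_pdivlMr ?cm_xi_gt0//.
have zx : 0 < cm (z - x%:C) by apply: lt_le_trans xz.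
rewrite mulrC ler_pdivrMr//.
have -> : x%:C + 'i = (z + 'i) - (z - x%:C) by ring.
apply: le_trans (le_cmD _ _) _; rewrite cmN /rho mulrDl mul1r addrC lerD2l.
by rewrite mulrAC ler_pdivlMr// ler_wpM2l// cm_ge0.
Qed.

Lemma separated_neq d z x : separated mu d z -> supp mu x -> z - x%:C != 0.
Proof.
by move=> [d0 H] /H; apply: contraTneq => ->; rewrite cm0 -ltNge.
Qed.

Lemma cm_inv2_le d z w x : separated mu d z -> separated mu d w -> supp mu x ->
  cm ((z - x%:C)^-1 * (w - x%:C)^-1) <= rho d z * rho d w * wt x.
Proof.
move=> sz sw sx; rewrite cmM wtC -exprVn expr2 mulrACA.
by rewrite ler_pM ?cm_ge0// cm_inv_le.
Qed.

(** The Nevanlinna kernel, the part of [1 / (z - x)] that is absolutely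
    summable. *)
Definition nevanlinna z x : R[i] := (1 + z * x%:C) * (z - x%:C)^-1 * (wt x)%:C.

(** What is removed from the kernel does not depend on [z], so a single
    conditionally convergent sum serves all points. *)
Lemma nevE z x : z - x%:C != 0 -> (z - x%:C)^-1 = nevanlinna z x - (x * wt x)%:C.
Proof.
move=> zx; rewrite /nevanlinna /wt.
have x2 : (1 + x%:C ^+ 2) != 0 :> R[i].
  by rewrite -rmorphXn -(rmorph1 (real_complex R)) -rmorphD eq_complex/= eqxx andbT wt_den.
rewrite rmorphM/= fmorphV/= rmorphD/= rmorphXn/= rmorph1.
by field; rewrite x2 zx.
Qed.

Lemma nevanlinna_le d z x : separated mu d z -> supp mu x ->
  cm (nevanlinna z x) <= (cm z + cm (1 + z ^+ 2) / d) * wt x.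
Proof.
move=> sz sx; have zx := separated_neq sz sx.
rewrite /nevanlinna cmM cm_real (ger0_norm (ltW (wt_gt0 x))) ler_wpM2r ?(ltW (wt_gt0 x))//.
have -> : (1 + z * x%:C) * (z - x%:C)^-1 = (1 + z ^+ 2) * (z - x%:C)^-1 - z by field.
apply: le_trans (le_cmD _ _) _; rewrite cmN addrC lerD2l cmM ler_wpM2l ?cm_ge0//.
have [d0 /(_ x sx) H] := sz; rewrite cmV lef_pV2 ?posrE//.
exact: lt_le_trans H.
Qed.

Lemma pv_trunc_nev d z A : separated mu d z ->
  pv_trunc mu A z = csum mu A (nevanlinna z) - (rsum mu A (fun x => x * wt x))%:C.
Proof.
move=> sz; rewrite pv_truncE -csum_real -csumB; apply: eq_csum => x sx.
exact/nevE/(separated_neq sz).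
Qed.

(** Uniform in [z] on bounded sets at distance [d] from the support. *)
Lemma pv_trunc_cauchy (d M e : R) : 0 < d -> 0 < e ->
  exists A0, forall A B z, A0 <= A -> A <= B -> separated mu d z -> cm z <= M ->
    cm (pv_trunc mu B z - pv_trunc mu A z) <= e.
Proof.
move=> d0 e0; have e2 : 0 < e / 2 by lra.
have C0 : 0 <= `|M| + (1 + `|M| ^+ 2) / d.
  by rewrite addr_ge0// divr_ge0 ?(ltW d0)// addr_ge0// sqr_ge0.
have [A1 H1] := csum_cauchy e2 C0.
have [l /cvgyP Hl] := odd_sum_cvg.
have e4 : 0 < e / 4 by lra.
have [A2 H2] := Hl _ e4.
exists (Num.max A1 A2) => A B z; rewrite ge_max => /andP[AA1 AA2] AB sz zM.
rewrite !(pv_trunc_nev _ sz).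
set ca := rsum mu A _; set cb := rsum mu B _.
rewrite (_ : _ - _ = (csum mu B (nevanlinna z) - csum mu A (nevanlinna z)) + (ca - cb)%:C); last first.
  by rewrite rmorphB/=; ring.
apply: le_trans (le_cmD _ _) _.
have zM' : cm z <= `|M| by apply: le_trans zM (ler_norm _).
have h1 : cm (csum mu B (nevanlinna z) - csum mu A (nevanlinna z)) <= e / 2.
  apply: H1 => // x sx; apply: le_trans (nevanlinna_le sz sx) _.
  rewrite ler_wpM2r ?(ltW (wt_gt0 x))// lerD// ler_wpM2r ?invr_ge0 ?(ltW d0)//.
  apply: le_trans (le_cmD _ _) _.
  rewrite (_ : cm 1 = 1) ?lerD2l; last by rewrite -(rmorph1 (real_complex R)) cm_real normr1.
  by rewrite expr2 cmM -expr2 ler_pXn2r ?nnegrE ?cm_ge0.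
have h2 : cm (ca - cb)%:C <= e / 2.
  rewrite cm_real; have := H2 A AA2; have := H2 B (le_trans AA2 AB).
  rewrite -/ca -/cb !ler_norml => /andP[? ?] /andP[? ?]; apply/andP; split; lra.
by lra.
Qed.

Lemma transform_cvg d z : separated mu d z ->
  pv_trunc mu A z @[A --> +oo] --> transform mu z.
Proof.
move=> sz; have [d0 _] := sz.
have [l Hl] : exists l : R[i], pv_trunc mu A z @[A --> +oo] --> l.
  apply: cauchyCy => e e0; have [A0 H] := pv_trunc_cauchy (cm z) d0 e0.
  by exists A0 => A B AA AB; exact: H.
rewrite /transform asboolF; last exact: separated_not_atom sz.
by have -> : lim (pv_trunc mu A z @[A --> +oo]) = l by exact: cvg_lim.
Qed.

(** Lets the second truncation in the Cauchy estimate tend to infinity. *)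
Lemma transform_unif (d M e : R) : 0 < d -> 0 < e ->
  exists A0, forall A z, A0 <= A -> separated mu d z -> cm z <= M ->
    cm (pv_trunc mu A z - transform mu z) <= e.
Proof.
move=> d0 e0; have [A0 H] := pv_trunc_cauchy M d0 e0.
exists A0 => A z AA sz zM; apply/ler_addgt0Pr => e' e'0.
have /cvgyCP/(_ e' e'0)[A1 H1] := transform_cvg sz.
apply: le_trans (cm_dist _ _ (pv_trunc mu (Num.max A A1) z)) _.
rewrite lerD//; last by apply: H1; rewrite le_max lexx orbT.
by rewrite cmB; apply: H => //; rewrite le_max lexx.
Qed.

Lemma inv2_cvg d z : separated mu d z ->
  exists l : R[i], csum mu A (fun x => (z - x%:C)^-1 * (z - x%:C)^-1) @[A --> +oo] --> l.
Proof.
move=> sz; apply: (@csum_cvg (rho d z * rho d z)).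
  by rewrite mulr_ge0// (le_trans _ (rho_ge1 _ (proj1 sz))).
by move=> x; exact: cm_inv2_le.
Qed.

(** Minus the derivative of the transform. *)
Definition inv2sum z : R[i] :=
  lim (csum mu A (fun x => (z - x%:C)^-1 * (z - x%:C)^-1) @[A --> +oo]).

Lemma inv2sum_cvg d z : separated mu d z ->
  csum mu A (fun x => (z - x%:C)^-1 * (z - x%:C)^-1) @[A --> +oo] --> inv2sum z.
Proof.
move=> sz; have [l Hl] := inv2_cvg sz.
by have -> : inv2sum z = l by exact: cvg_lim.
Qed.

(** The difference of two kernels is [(w - z)] times a product of kernels,
    which is dominated by the weight. *)
Lemma transform_lipschitz (d M : R) : 0 < d -> exists C, 0 <= C /\
  forall z w, separated mu d z -> separated mu d w -> cm z <= M -> cm w <= M ->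
  cm (transform mu z - transform mu w) <= C * cm (z - w).
Proof.
move=> d0; have [Q [Q0 HQ]] := wt_sum_bounded.
set P := 1 + (`|M| + 1) / d.
have P0 : 0 <= P by rewrite /P addr_ge0// divr_ge0 ?(ltW d0)// addr_ge0.
exists (P * P * Q); split; first by rewrite !mulr_ge0.
have rP z : cm z <= M -> rho d z <= P.
  move=> zM; rewrite /rho /P lerD2l ler_wpM2r ?invr_ge0 ?(ltW d0)//.
  by rewrite (le_trans (le_cmD _ _))// cm_i lerD2r (le_trans zM)// ler_norm.
move=> z w sz sw zM wM.
have H : (pv_trunc mu A z - pv_trunc mu A w) @[A --> +oo] -->
    transform mu z - transform mu w.
  exact: (cvgB (transform_cvg sz) (transform_cvg sw)).
rewrite -[X in cm X]subr0; apply: (limC_le H) => A; rewrite subr0 !pv_truncE -csumB.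
rewrite (@eq_csum _ _ _ _ (fun x => (w - z) * ((z - x%:C)^-1 * (w - x%:C)^-1))); last first.
  by move=> x sx; field; rewrite (separated_neq sz sx) (separated_neq sw sx).
rewrite csumZ cmM cmB mulrC ler_wpM2r ?cm_ge0//.
apply: (@le_trans _ _ (rsum mu A (fun x => rho d z * rho d w * wt x))).
  by apply: cm_csum => x; exact: cm_inv2_le.
rewrite rsumZ; apply: (@le_trans _ _ (rho d z * rho d w * Q)).
  by rewrite ler_wpM2l// mulr_ge0// (le_trans _ (rho_ge1 _ d0)).
by rewrite ler_wpM2r// ler_pM ?rP// (le_trans _ (rho_ge1 _ d0)).
Qed.

(** Second order Taylor expansion of the kernel, summed over the atoms; it
    gives both the derivative and the step estimates of the contour
    argument. *)
Lemma transform_second_order (d M : R) : 0 < d -> exists C, 0 <= C /\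
  forall z k, separated mu d z -> separated mu d (z + k) -> cm z <= M ->
  cm (transform mu (z + k) - transform mu z + k * inv2sum z) <= C * cm k ^+ 2.
Proof.
move=> d0; have [Q [Q0 HQ]] := wt_sum_bounded.
set P := 1 + (`|M| + 1) / d.
have P0 : 0 <= P by rewrite /P addr_ge0// divr_ge0 ?(ltW d0)// addr_ge0.
exists (P * P * Q / d); split; first by rewrite divr_ge0 ?(ltW d0)// !mulr_ge0.
have rP z : cm z <= M -> rho d z <= P.
  move=> zM; rewrite /rho /P lerD2l ler_wpM2r ?invr_ge0 ?(ltW d0)//.
  by rewrite (le_trans (le_cmD _ _))// cm_i lerD2r (le_trans zM)// ler_norm.
move=> z k sz sw zM.
have H : (pv_trunc mu A (z + k) - pv_trunc mu A z +
      k * csum mu A (fun x => (z - x%:C)^-1 * (z - x%:C)^-1)) @[A --> +oo] -->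
    transform mu (z + k) - transform mu z + k * inv2sum z.
  have H1 := cvgB (transform_cvg sw) (transform_cvg sz).
  have H2 : k * csum mu A (fun x => (z - x%:C)^-1 * (z - x%:C)^-1) @[A --> +oo]
    --> k * inv2sum z := cvgM (cvg_cst k) (inv2sum_cvg sz).
  exact: (cvgD (H1 _) (H2 _ _)).
rewrite -[X in cm X]subr0; apply: (limC_le H) => A; rewrite subr0 !pv_truncE -csumB.
rewrite -csumZ -csumD.
rewrite (@eq_csum _ _ _ _ (fun x =>
   k ^+ 2 * ((z + k - x%:C)^-1 * ((z - x%:C)^-1 * (z - x%:C)^-1)))); last first.
  by move=> x sx; field; rewrite (separated_neq sz sx) (separated_neq sw sx).
rewrite csumZ cmM expr2 cmM -expr2 mulrC ler_wpM2r ?sqr_ge0//.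
apply: (@le_trans _ _ (rsum mu A (fun x => d^-1 * (rho d z * rho d z) * wt x))).
  apply: cm_csum => x sx; rewrite cmM -[leRHS]mulrA ler_pM ?cm_ge0//.
    rewrite cmV lef_pV2 ?posrE//; first by have [_ ->] := sw.
    by apply: lt_le_trans (proj2 sw x sx).
  exact: cm_inv2_le.
rewrite rsumZ [leRHS]mulrC -[leLHS]mulrA ler_wpM2l ?invr_ge0 ?(ltW d0)//.
apply: (@le_trans _ _ (rho d z * rho d z * Q)).
  by rewrite ler_wpM2l// mulr_ge0// (le_trans _ (rho_ge1 _ d0)).
by rewrite ler_wpM2r// ler_pM ?rP// (le_trans _ (rho_ge1 _ d0)).
Qed.

End transform.

(** * Holomorphy and translation equivariance *)

Section analytic.
Context {R : realType}.
Variables (mu : wpm R) (K : R).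
Hypothesis K0 : 0 < K.
Hypothesis mu_summable : summable_disc mu K.
Implicit Types (A B x s y t : R) (z w k : R[i]).

Lemma separated_shift d z k : separated mu (2 * d) z -> cm k <= d -> separated mu d (z + k).
Proof.
move=> [d0 H] kd; have d1 : 0 < d by lra.
split=> // x /H zx; have := le_cmD (z + k - x%:C) (- k); rewrite cmN.
have -> : z + k - x%:C - k = z - x%:C by ring.
by lra.
Qed.

Lemma transform_derivable z : complex.Im z != 0 -> derivable (transform mu) z 1.
Proof.
move=> z0; apply/cvg_ex; exists (- inv2sum mu z).
set d := `|complex.Im z| / 2.
have d0 : 0 < d by rewrite divr_gt0// normr_gt0.
have sz2 : separated mu (2 * d) z.
  rewrite /d mulrC divfK//; exact: separated_off_axis.
have sz : separated mu d z by have := @separated_shift d z 0 sz2; rewrite addr0 cm0; apply; lra.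
have [C [C0 HC]] := transform_second_order K0 mu_summable (cm z) d0.
apply/cvgCP => e e0.
near=> h.
have h0 : h != 0 by near: h; exact: nbhs_dnbhs_neq.
have hd : cm h <= d.
  by rewrite -lecR -normrC; near: h; apply: dnbhs0_le; rewrite ltcR.
have he : cm h <= e / (C + 1).
  rewrite -lecR -normrC; near: h; apply: dnbhs0_le; rewrite ltcR divr_gt0//; lra.
rewrite /= /shift/= {1}/GRing.scale/= {1}/GRing.scale/= mulr1 addrC (addrC h) opprK.
have -> : inv2sum mu z + h^-1 * (transform mu (z + h) - transform mu z) =
  h^-1 * (transform mu (z + h) - transform mu z + h * inv2sum mu z) by field.
rewrite cmM cmV ler_pdivrMl ?cm_gt0//.
apply: le_trans (HC z h sz (separated_shift sz2 hd) (lexx _)) _.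
rewrite expr2 mulrCA ler_wpM2l ?cm_ge0//.
by move: he; rewrite ler_pdivlMr; [have := cm_ge0 h; lra|lra].
Unshelve. all: by end_near. Qed.

(** A ball whose radius is half the distance to the axis is uniformly separated
    from the support. *)
Lemma transform_locally_uniform :
  locally_uniform_cvg off_axis (pv_trunc mu) (transform mu).
Proof.
move=> z z0; rewrite /off_axis/= in z0.
set d := `|complex.Im z| / 2.
have d0 : 0 < d by rewrite divr_gt0// normr_gt0.
have sz2 : separated mu (2 * d) z.
  rewrite /d mulrC divfK//; exact: separated_off_axis.
exists (ball z (d%:C)); first by apply: nbhsx_ballx; rewrite ltcR.
move=> P /uniform_nbhs[E [entE EP]].
move: entE; rewrite -entourage_ballE => -[e /= e0 eE].
move: e0; rewrite ltcE => /andP[/eqP /= eim ere].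
have ee : e = (complex.Re e)%:C by case: e eim {eE ere} => a b /= ->.
have ere2 : 0 < complex.Re e / 2 by lra.
have [A0 HA] := transform_unif K0 mu_summable (cm z + d) d0 ere2.
exists A0; split; [exact: num_real|move=> A /ltW AA].
apply: EP => w /=; rewrite -ball_normE/= normrC ltcR => zw.
apply: eE => /=; rewrite -ball_normE/= normrC ee ltcR cmB.
have kw : w = z + (w - z) by ring.
apply: le_lt_trans (HA A w AA _ _) _; last by lra.
  by rewrite kw; apply: separated_shift => //; rewrite cmB ltW.
rewrite kw; apply: le_trans (le_cmD _ _) _; rewrite lerD2l cmB; exact: ltW.
Qed.

(** Every kernel [1 / (z - x)] maps the upper half-plane to the lower one. *)
Lemma Im_transform_le0 z : 0 < complex.Im z -> complex.Im (transform mu z) <= 0.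
Proof.
move=> z0.
have := cvgC_Im (transform_cvg K0 mu_summable (separated_im mu z0 (lexx _))).
move=> /(_ _)/cvgyP H; apply/ler_addgt0Pr => e e0; have [A0 /(_ _ (lexx _))] := H e e0.
rewrite add0r pv_trunc_Im.
have : rsum mu A0 (kiml (complex.Re z) (complex.Im z)) <= 0.
  rewrite /rsum -oppr_ge0 -sumrN sumr_ge0// => x _; rewrite -mulrN mulr_ge0 ?mass_ge0//.
  rewrite /kiml mulNr opprK divr_ge0 ?(ltW z0)// ltW// kden_gt0//.
  by rewrite gt_eqF.
rewrite ler_norml => ? /andP[? ?]; lra.
Qed.

Lemma transform_analytic :
  [/\ forall s : R, ~ supp mu s -> cvg (pv_trunc mu A s%:C @[A --> +oo]),
      forall z, off_axis z -> cvg (pv_trunc mu A z @[A --> +oo]),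
      holomorphic_on off_axis (transform mu),
      locally_uniform_cvg off_axis (pv_trunc mu) (transform mu) &
      herglotz_pick (fun z => - transform mu z)].
Proof.
split.
- move=> s /separated_real[d sd]; apply/cvg_ex; exists (transform mu s%:C).
  exact (transform_cvg K0 mu_summable sd).
- move=> z /(separated_off_axis mu) sd; apply/cvg_ex; exists (transform mu z).
  exact (transform_cvg K0 mu_summable sd).
- by move=> z z0; exact: transform_derivable.
- exact: transform_locally_uniform.
- split; last by move=> z z0; rewrite ImN oppr_ge0 Im_transform_le0.
  move=> z z0; apply: derivableN; apply: transform_derivable.
  by rewrite gt_eqF.
Qed.

Lemma not_atom_separated z : ~ real_atom mu z -> exists d, separated mu d z.
Proof.
have [z0|z0] := eqVneq (complex.Im z) 0.
  have -> : z = (complex.Re z)%:C by case: z z0 => a b /= ->.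
  by move=> nz; apply: separated_real => sx; apply: nz; exists (complex.Re z).
by move=> _; exists `|complex.Im z|; exact: separated_off_axis.
Qed.

Lemma mass_theta t x : mass (theta t mu) x = mass mu (x + t).
Proof. by rewrite /mass /= /mshift image_set1. Qed.

Lemma supp_theta t x : supp (theta t mu) x = supp mu (x + t).
Proof. by rewrite /= supp_mshift. Qed.

Lemma real_atom_theta t z : real_atom (theta t mu) z <-> real_atom mu (z + t%:C).
Proof.
split=> [[x /= sx <-]|[x sx /= xz]].
  by exists (x + t); [rewrite -supp_theta|rewrite rmorphD].
exists (x - t); first by rewrite /= supp_theta subrK.
by rewrite rmorphB/= xz addrK.
Qed.

(** The atoms of the shifted measure are indexed by those of the original one,
    in a common window. *)
Lemma csum_theta t A (g : R -> R[i]) : csum (theta t mu) A g =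
  \sum_(x <- atoms mu (A + `|t|) | `|x - t| <= A) (mass mu x)%:C * g (x - t).
Proof.
rewrite -big_filter (perm_big (map (fun x => x + t) (atoms (theta t mu) A))).
  rewrite big_map /csum; apply: eq_bigr => x _.
  by rewrite mass_theta addrK.
apply: uniq_perm; first exact/filter_uniq/uniq_atoms.
  by rewrite map_inj_uniq ?uniq_atoms// => x y; exact: addIr.
move=> x; rewrite mem_filter; apply/idP/mapP.
  move=> /andP[xA]; rewrite mem_atoms => /andP[_ /asboolP sx].
  exists (x - t); last by rewrite subrK.
  by rewrite mem_atoms xA supp_theta subrK; exact/asboolP.
move=> [y]; rewrite mem_atoms supp_theta => /andP[yA /asboolP sy] ->.
rewrite addrK yA mem_atoms/=; apply/andP; split; last exact/asboolP.
by rewrite (le_trans (ler_normD _ _))// lerD.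
Qed.

(** A symmetric window is split at 0. *)
Lemma wcount_predT A : 0 <= A -> wcount mu A predT = signed_count mu A + lowcount mu A.
Proof.
move=> A0; rewrite -signed_count_window ?ger0_norm//; apply: eq_wcount => x.
by rewrite ler_norml => /andP[_ ->].
Qed.

(** The masses of the windows of half-lengths [A - |t|] and [A + |t|] are both
    [2 K A] up to [o(A)]. *)
Lemma annulus_small t e : 0 < e -> exists A0, 0 < A0 /\ forall A, A0 <= A ->
  wcount mu (A + `|t|) (fun x => A - `|t| < `|x|) <= e * A.
Proof.
have Kpos := K0.
move=> e0; have e8 : 0 < e / 8 by lra.
have [A1 [A10 H]] := boundary_small K0 mu_summable e8.
exists (A1 + `|t| + 8 * K * `|t| / e).
have t0 : (0 : R) <= `|t| by exact: normr_ge0.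
have Ke : 0 <= 8 * K * `|t| / e.
  by rewrite divr_ge0 ?(ltW e0)// !mulr_ge0// ltW.
split; first by lra.
move=> A AA.
have [h1 h2] := H (A + `|t|) ltac:(lra); have [h3 h4] := H (A - `|t|) ltac:(lra).
have := wcountID mu (A + `|t|) predT (fun x => A - `|t| < `|x|).
have -> : wcount mu (A + `|t|) (fun x => predT x && ~~ (A - `|t| < `|x|)) =
    wcount mu (A - `|t|) predT.
  rewrite (@wcount_widen _ mu (A - `|t|) (A + `|t|)); last 2 first.
  - by lra.
  - by move=> x; rewrite /= -leNgt.
  by apply: eq_wcount => x xA; rewrite /= -leNgt xA.
have -> : wcount mu (A + `|t|) (fun x => predT x && (A - `|t| < `|x|)) =
  wcount mu (A + `|t|) (fun x => A - `|t| < `|x|) by [].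
set W := wcount mu (A + `|t|) (fun x => A - `|t| < `|x|).
rewrite !wcount_predT; [|lra|lra].
have KA : 8 * K * `|t| <= A * e by rewrite -ler_pdivrMr//; lra.
move: h1 h2 h3 h4; rewrite !ler_norml /disc.
move=> /andP[? ?] /andP[? ?] /andP[? ?] /andP[? ?] E; lra.
Qed.

Lemma cm_sumB_le (s : seq R) (P Q S : pred R) (f : R -> R[i]) (p : R -> R) :
  (forall x, 0 <= p x) ->
  (forall x, x \in s -> P x != Q x -> S x /\ cm (f x) <= p x) ->
  cm (\sum_(x <- s | P x) f x - \sum_(x <- s | Q x) f x) <= \sum_(x <- s | S x) p x.
Proof.
move=> p0 H; rewrite big_mkcond [X in _ - X]big_mkcond/= -sumrB [leRHS]big_mkcond/=.
apply: cm_sum => x xs _; have := H x xs.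
have r0 : 0 <= (if S x then p x else 0) by case: ifP.
case: (P x); case: (Q x) => /= {}H; rewrite ?subrr ?subr0 ?sub0r ?cmN ?cm0//.
  by have [-> ->] := H isT.
  by have [-> ->] := H isT.
by rewrite -[leLHS]/(cm 0) cm0.
Qed.

(** A symmetric window around [t] differs from one around 0 by two strips of
    width [|t|], of mass [o(A)] where the kernel is [O(1 / A)]. *)
Lemma theta_cvg t d z : separated mu d (z + t%:C) ->
  pv_trunc (theta t mu) A z @[A --> +oo] --> transform mu (z + t%:C).
Proof.
move=> sz; have [d0 _] := sz; set w := z + t%:C.
have r1 := rho_ge1 w d0.
apply/cvgyCP => e e0; have e2 : 0 < e / 2 by lra.
have /cvgyCP/(_ _ e2)[A1 H1] := transform_cvg K0 mu_summable sz.
have [A2 [A20 H2]] := @annulus_small t (e / (4 * rho d w)) ltac:(by rewrite divr_gt0//; lra).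
have t0 : (0 : R) <= `|t| by exact: normr_ge0.
exists (Num.max A1 (A2 + 2 * `|t|)) => A; rewrite ge_max => /andP[AA1 AA2].
apply: le_trans (cm_dist _ _ (pv_trunc mu A w)) _.
suff : cm (pv_trunc (theta t mu) A z - pv_trunc mu A w) <= e / 2.
  by have := H1 A AA1; rewrite -/w; lra.
rewrite pv_truncE csum_theta pv_truncE.
have -> : csum mu A (fun x => (w - x%:C)^-1) =
   \sum_(x <- atoms mu (A + `|t|) | `|x| <= A) (mass mu x)%:C * (w - x%:C)^-1.
  rewrite /csum -[in LHS](filter_predT (atoms mu A)).
  rewrite (perm_big _ (@atoms_filter _ _ A (A + `|t|) _ _)); last by lra.
  by rewrite big_filter; apply: eq_bigl => x; rewrite andbT.
rewrite (eq_bigr (fun x => (mass mu x)%:C * (w - x%:C)^-1)); last first.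
  by move=> x _; congr (_ * _^-1); rewrite /w rmorphB/=; ring.
have At : 0 < A - `|t| by lra.
(* The two truncations differ only by atoms within [|t|] of the ends. *)
apply: le_trans (@cm_sumB_le _ _ _ (fun x => A - `|t| < `|x|) _
   (fun x => mass mu x * (rho d w / (A - `|t|))) _ _) _.
- by move=> x; rewrite mulr_ge0 ?mass_ge0// divr_ge0 ?(ltW At)//; lra.
- move=> x; rewrite mem_atoms => /andP[_ /asboolP sx] neq.
  have xA : A - `|t| < `|x|.
    rewrite ltNge; apply: contra neq => xA; apply/eqP.
    have -> : `|x| <= A by lra.
    by have := ler_normB x t; lra.
  split=> //; rewrite cmM cm_real ger0_norm ?mass_ge0// ler_wpM2l ?mass_ge0//.
  apply: le_trans (cm_inv_le sz sx) _; rewrite -/w ler_wpM2l//; first lra.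
  rewrite lef_pV2 ?posrE ?cm_xi_gt0//; apply: le_trans (ltW xA) _.
  by have := Re_le_cm (x%:C + 'i); rewrite /= addr0.
rewrite -mulr_suml -/(wcount _ _ _).
have := H2 A ltac:(lra); set W := wcount _ _ _ => HW.
rewrite mulrA ler_pdivrMr//; apply: le_trans (ler_wpM2r _ HW) _; first lra.
rewrite mulrAC; have -> : e / (4 * rho d w) * rho d w = e / 4.
  by field; rewrite gt_eqF//; lra.
nra.
Qed.

(** It also holds at the atoms, where both sides are 0. *)
Lemma theta_transform t z : transform (theta t mu) z = transform mu (z + t%:C).
Proof.
have [az|naz] := pselect (real_atom mu (z + t%:C)).
  by rewrite /transform !asboolT//; apply/real_atom_theta.
have [d sd] := not_atom_separated naz.
rewrite {1}/transform asboolF; last by move/real_atom_theta.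
by have -> : lim (pv_trunc (theta t mu) A z @[A --> +oo]) = transform mu (z + t%:C)
  by apply: cvg_lim => //; exact: theta_cvg sd.
Qed.

Lemma transform_equivariant t z :
  [\/ off_axis z, transform_defined (theta t mu) z |
       transform_defined mu (z + t%:C)] ->
  [/\ transform_defined (theta t mu) z, transform_defined mu (z + t%:C) &
      transform (theta t mu) z = transform mu (z + t%:C)].
Proof.
move=> H; have na : ~ real_atom mu (z + t%:C).
  case: H => [z0|[+ _]|[]//]; last by move=> H /real_atom_theta.
  apply: (@separated_not_atom _ _ `|complex.Im z|).
  have := @separated_off_axis _ mu (z + t%:C); rewrite ImD/= addr0; exact.
have [d sd] := not_atom_separated na.
split; last exact: theta_transform.
- split; first by move/real_atom_theta.
  by apply/cvg_ex; exists (transform mu (z + t%:C)); exact: (theta_cvg sd).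
- split=> //.
  by apply/cvg_ex; exists (transform mu (z + t%:C)); exact: (transform_cvg K0 mu_summable sd).
Qed.

End analytic.

(** * The resolvent of the transform *)

Opaque cm.

Section steps.
Context {R : realType}.
Notation leb := (@lebesgue_measure R).

(** Translation invariance on segments, obtained from a primitive. *)
Lemma Rintegral_translate (f : R -> R) (a b k : R) : continuous f -> a <= b ->
  \int[leb]_(s in `[a, b]) f (s + k) = \int[leb]_(s in `[a + k, b + k]) f s.
Proof.
move=> cf ab; have dF (x : R) : is_derive x (1 : R) (fun s => s + k) 1.
  by apply: is_derive_eq; rewrite addr0.
have F'1 : derive1 (fun s : R => s + k) = cst 1.
  by apply/funext => x; rewrite derive1E; apply: derive_val; exact: dF.
rewrite /Rintegral (@integration_by_substitution_increasing _ (fun s => s + k) f a b)//.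
- by congr fine; apply: eq_integral => x _; rewrite F'1/= /GRing.mul/= mulr1.
- by move=> x y _ _; rewrite ltrD2r.
- by rewrite F'1 => x _; exact: cvg_cst.
- by rewrite F'1; exact: is_cvg_cst.
- by rewrite F'1; exact: is_cvg_cst.
- have cF : continuous (fun s : R => s + k).
    by move=> x; apply: cvgD; [exact: cvg_id|exact: cvg_cst].
  split; first by move=> x _; have [] := dF x.
  + by apply: cvg_at_right_filter; exact: cF.
  + by apply: cvg_at_left_filter; exact: cF.
- exact: continuous_subspaceT.
Qed.

Lemma Rintegral_bound (f : R -> R) (a b c : R) : continuous f -> a <= b ->
  (forall x, a <= x <= b -> `|f x| <= c) ->
  `|\int[leb]_(s in `[a, b]) f s| <= c * (b - a).
Proof.
move=> cf ab fc; rewrite -Rint_cst//.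
have i1 := @continuous_seg_integrable _ a b _ cf.
apply: le_trans (le_normr_Rintegral _ i1) _; first exact: mseg.
apply: le_Rintegral; first exact: mseg.
- by have /integrable_abse := i1.
- by apply: continuous_seg_integrable => x; exact: cvg_cst.
- by move=> x /=; rewrite in_itv/=; exact: fc.
Qed.

Lemma Rintegral_split (f : R -> R) (a b c : R) : continuous f -> a <= b -> b <= c ->
  \int[leb]_(s in `[a, c]) f s =
  \int[leb]_(s in `[a, b]) f s + \int[leb]_(s in `[b, c]) f s.
Proof.
move=> cf ab bc.
have i1 := @continuous_seg_integrable _ a c _ cf.
have := @Rintegral_itvB _ f (BLeft a) (BRight c) b i1; rewrite !bnd_simp.
move=> /(_ ab bc) /eqP; rewrite subr_eq addrC => /eqP ->; congr (_ + _).
rewrite Rintegral_itv_obnd_cbnd//; apply: integrableS i1.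
- exact: measurable_itv.
- exact: measurable_itv.
- by move=> x /=; rewrite !in_itv/= => /andP[bx ->]; rewrite (le_trans ab (ltW bx)).
Qed.

(** The two integrals differ by two end pieces of length [k]. *)
Lemma translate_bound (f : R -> R) (a b c k : R) : continuous f -> a <= b -> 0 <= k ->
  (forall x, `|f x| <= c) ->
  `|\int[leb]_(s in `[a, b]) f (s + k) - \int[leb]_(s in `[a, b]) f s| <= 2 * c * k.
Proof.
move=> cf ab k0 fc; rewrite Rintegral_translate//.
have h1 : \int[leb]_(s in `[a, b + k]) f s =
  \int[leb]_(s in `[a, b]) f s + \int[leb]_(s in `[b, b + k]) f s.
  by apply: Rintegral_split => //; lra.
have h2 : \int[leb]_(s in `[a, b + k]) f s =
  \int[leb]_(s in `[a, a + k]) f s + \int[leb]_(s in `[a + k, b + k]) f s.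
  by apply: Rintegral_split => //; lra.
have b1 := @Rintegral_bound f b (b + k) c cf ltac:(lra) (fun x _ => fc x).
have b2 := @Rintegral_bound f a (a + k) c cf ltac:(lra) (fun x _ => fc x).
have -> : \int[leb]_(s in `[a + k, b + k]) f s - \int[leb]_(s in `[a, b]) f s =
  \int[leb]_(s in `[b, b + k]) f s - \int[leb]_(s in `[a, a + k]) f s.
  move: h1 h2; set u1 := Rintegral _ _ _; set u2 := Rintegral _ _ _.
  set u3 := Rintegral _ _ _; set u4 := Rintegral _ _ _; set u5 := Rintegral _ _ _.
  lra.
apply: le_trans (ler_normB _ _) _.
move: b1 b2; set u := `|_|; set v := `|_|; lra.
Qed.

(** The linear errors add up to a multiple of the length, while the quadratic
    ones disappear as the mesh tends to 0. It plays the part of Cauchy's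
    theorem on a rectangle. *)
Lemma subdivision (f : R -> R) (al be p q : R) : 0 <= be -> p <= q ->
  (forall y k, p <= y -> 0 <= k <= 1 -> y + k <= q ->
     `|f (y + k) - f y| <= al * k + be * k ^+ 2) ->
  `|f q - f p| <= al * (q - p).
Proof.
move=> be0 pq H; apply/ler_addgt0Pr => e e0.
have C0 : 0 <= be * (q - p) ^+ 2 by rewrite mulr_ge0// sqr_ge0.
have X0 : 0 <= be * (q - p) ^+ 2 / e by rewrite divr_ge0// ltW.
have qp0 : 0 <= q - p by rewrite subr_ge0.
(* With [n] steps the quadratic errors add up to [be (q - p) ^ 2 / n], and the
   steps have length at most 1. *)
set n := (Num.truncn (q - p + be * (q - p) ^+ 2 / e)).+1.
have nX : q - p + be * (q - p) ^+ 2 / e < n%:R.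
  by rewrite /n; apply: truncnS_gt.
have n0 : 0 < n%:R :> R by rewrite ltr0n.
set k := (q - p) / n%:R.
have nk : n%:R * k = q - p by rewrite /k; field; rewrite gt_eqF.
have k0 : 0 <= k by rewrite /k divr_ge0// ltW.
have k1 : k <= 1 by rewrite /k ler_pdivrMr// mul1r; lra.
have step i : (i <= n)%N -> `|f (p + i%:R * k) - f p| <= i%:R * (al * k + be * k ^+ 2).
  elim: i => [|i ih] lei; first by rewrite !mul0r addr0 subrr normr0.
  have := ih (ltnW lei).
  have iq : p + i%:R * k + k <= q.
    have : i.+1%:R * k <= n%:R * k by rewrite ler_wpM2r// ler_nat.
    by rewrite -natr1 mulrDl mul1r nk; lra.
  have pi : p <= p + i%:R * k by rewrite lerDl mulr_ge0.
  have := H (p + i%:R * k) k pi ltac:(by rewrite k0) iq.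
  have -> : p + i.+1%:R * k = p + i%:R * k + k by rewrite -natr1 mulrDl mul1r addrA.
  rewrite -[i.+1%:R]natr1 [(_ + 1) * _]mulrDl mul1r.
  set a := f (p + i%:R * k + k); set b := f (p + i%:R * k); set c := f p.
  move=> h1 h2; rewrite (_ : a - c = (a - b) + (b - c)); last by ring.
  by apply: le_trans (ler_normD _ _) _; rewrite addrC lerD.
have := step n (leqnn n); rewrite nk addrCA subrr addr0 => /le_trans; apply.
rewrite mulrDr mulrCA nk lerD2l.
have -> : n%:R * (be * k ^+ 2) = be * (q - p) ^+ 2 / n%:R.
  by rewrite /k; field; rewrite gt_eqF.
rewrite ler_pdivrMr//.
have : be * (q - p) ^+ 2 / e <= n%:R by lra.
by rewrite ler_pdivrMr// (mulrC e).
Qed.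

End steps.

(** With [a], [b], [c] the values at a point and at its vertical and horizontal
    neighbours, the inverses satisfy the discrete Cauchy-Riemann equation
    [b - a = j (c - a)] up to a second order error if the values do. *)
Lemma inv_step_bound (R : realType) (a b c j : R[i]) (e c1 c2 c3 : R) :
  a != 0 -> b != 0 -> c != 0 -> 0 <= e -> cm j = 1 ->
  cm a^-1 <= e -> cm b^-1 <= e -> cm c^-1 <= e ->
  cm (b - a - j * (c - a)) <= c2 -> cm (c - a) <= c1 -> cm (c - b) <= c3 ->
  cm (b^-1 - a^-1 - j * (c^-1 - a^-1)) <= e * e * (c2 + c1 * (c3 * e)).
Proof.
move=> a0 b0 c0 e0 j1 ha hb hc h2 h1 h3.
have -> : b^-1 - a^-1 - j * (c^-1 - a^-1) =
  - (a^-1 * b^-1 * ((b - a - j * (c - a)) + j * (c - a) * ((c - b) * c^-1))).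
  by field; rewrite a0 b0 c0.
rewrite cmN cmM cmM; apply: ler_pM.
- by apply: mulr_ge0; exact: cm_ge0.
- exact: cm_ge0.
- exact: ler_pM (cm_ge0 _) (cm_ge0 _) ha hb.
apply: le_trans (le_cmD _ _) _; apply: lerD h2 _.
rewrite !cmM j1 mul1r; apply: ler_pM h1 _; first exact: cm_ge0.
  by apply: mulr_ge0; exact: cm_ge0.
exact: ler_pM (cm_ge0 _) (cm_ge0 _) h3 hc.
Qed.

Section resolvent.
Context {R : realType}.
Notation leb := (@lebesgue_measure R).
Variables (mu : wpm R) (K : R).
Hypothesis K0 : 0 < K.
Hypothesis mu_summable : summable_disc mu K.
Variables (t ep : R).
Hypothesis ep0 : 0 < ep.
Implicit Types (A B x s y : R) (z w k : R[i]).
Local Notation F := (transform mu).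

(** A bounded holomorphic function of the upper half-plane whose imaginary part
    on the real axis is, up to the factor [pi], a Poisson kernel evaluated at
    the transform. *)
Definition resolvent z : R[i] := (t -i* ep + F z)^-1.

(** The imaginary part of the denominator is at most [- ep]. *)
Lemma resolvent_den z : complex.Im (F z) <= 0 -> ep <= cm (t -i* ep + F z).
Proof.
have ep1 := ep0; move=> F0; apply: le_trans (Im_le_cm _); rewrite ImD/= ler0_norm; last lra.
by lra.
Qed.

Lemma resolvent_neq0 z : complex.Im (F z) <= 0 -> t -i* ep + F z != 0.
Proof.
move=> /resolvent_den; apply: contraTneq => ->.
by rewrite cm0 -ltNge.
Qed.

Lemma resolvent_le z : complex.Im (F z) <= 0 -> cm (resolvent z) <= ep^-1.
Proof.
move=> F0; rewrite /resolvent cmV lef_pV2 ?posrE//; first exact: resolvent_den.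
by rewrite cm_gt0// resolvent_neq0.
Qed.

Lemma resolvent_dist z w : complex.Im (F z) <= 0 -> complex.Im (F w) <= 0 ->
  cm (resolvent z - resolvent w) <= ep ^- 2 * cm (F z - F w).
Proof.
move=> Fz Fw.
have E (a b : R[i]) : a != 0 -> b != 0 -> a^-1 - b^-1 = a^-1 * b^-1 * (b - a).
  by move=> a0 b0; field; rewrite a0 b0.
rewrite /resolvent E ?resolvent_neq0//.
rewrite (_ : _ + F w - (_ + F z) = F w - F z); last first.
  by rewrite opprD addrACA subrr add0r.
rewrite cmM (cmB (F w)); apply: ler_wpM2r; first exact: cm_ge0.
rewrite cmM -exprVn expr2; apply: ler_pM; [exact: cm_ge0|exact: cm_ge0|..];
  exact: resolvent_le.
Qed.

(** A discrete Cauchy-Riemann equation with step [k], uniform on bounded sets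
    away from the axis. *)
Lemma resolvent_step (eta M : R) : 0 < eta -> exists C, 0 <= C /\
  forall z (k : R), 0 <= k <= 1 -> eta <= complex.Im z -> cm z <= M ->
  cm (resolvent (z + 0 +i* k) - resolvent z - 'i * (resolvent (z + k%:C) - resolvent z))
    <= C * k ^+ 2.
Proof.
move=> eta0.
have [C1 [C10 H1]] := transform_lipschitz K0 mu_summable (M + 1) eta0.
have [C2 [C20 H2]] := transform_second_order K0 mu_summable M eta0.
have e0 : 0 <= ep^-1 by rewrite invr_ge0 ltW.
exists (ep^-1 * ep^-1 * (2 * C2 + C1 * (2 * C1 * ep^-1))).
split; first by rewrite !mulr_ge0// addr_ge0// !mulr_ge0.
move=> z k /andP[k0 k1] etaz zM.
pose ik : R[i] := 0 +i* k.
have cik : cm ik = k by rewrite cmE/= expr0n/= add0r sqrtr_sqr ger0_norm.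
have ck : cm k%:C = k by rewrite cm_real ger0_norm.
have ikE : ik = 'i * k%:C by apply/eqP; rewrite eq_complex/=; apply/andP; split; apply/eqP; ring.
have imik : complex.Im (z + ik) = complex.Im z + k by rewrite ImD.
have imk : complex.Im (z + k%:C) = complex.Im z by rewrite ImD/= addr0.
have z0 : 0 < complex.Im z by exact: lt_le_trans etaz.
have f0 := Im_transform_le0 K0 mu_summable z0.
have f1 : complex.Im (F (z + ik)) <= 0 by apply: (Im_transform_le0 K0 mu_summable); rewrite imik ltr_wpDr.
have f2 : complex.Im (F (z + k%:C)) <= 0 by apply: (Im_transform_le0 K0 mu_summable); rewrite imk.
have s0 : separated mu eta z by apply: separated_im.
have s1 : separated mu eta (z + ik) by apply: separated_im => //; rewrite imik (le_trans etaz)// lerDl.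
have s2 : separated mu eta (z + k%:C) by apply: separated_im => //; rewrite imk.
have M1 : cm (z + ik) <= M + 1 by apply: le_trans (le_cmD _ _) _; rewrite cik lerD.
have M2 : cm (z + k%:C) <= M + 1 by apply: le_trans (le_cmD _ _) _; rewrite ck lerD.
have M0 : cm z <= M + 1 by rewrite (le_trans zM)// lerDl.
have g1 := H2 z ik s0 s1 zM; have g2 := H2 z k%:C s0 s2 zM.
have l1 := H1 _ _ s2 s0 M2 M0; have l2 := H1 _ _ s2 s1 M2 M1.
have r0 := resolvent_neq0 f0; have r1 := resolvent_neq0 f1; have r2 := resolvent_neq0 f2.
rewrite -/ik.
set F0 := F z in f0 r0 g1 g2 l1 *; set F1 := F (z + ik) in f1 r1 g1 l2 *.
set F2 := F (z + k%:C) in f2 r2 g2 l1 l2 *.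
have d1 : cm (F1 - F0 - 'i * (F2 - F0)) <= 2 * C2 * k ^+ 2.
  rewrite (_ : _ - _ = (F1 - F0 + ik * inv2sum mu z) - 'i * (F2 - F0 + k%:C * inv2sum mu z)).
    apply: le_trans (le_cmD _ _) _; rewrite cmN cmM cm_i mul1r.
    rewrite cik in g1; rewrite ck in g2.
    by rewrite (_ : 2 * C2 * k ^+ 2 = C2 * k ^+ 2 + C2 * k ^+ 2) ?lerD//; ring.
  by rewrite ikE; ring.
have d2 : cm (F2 - F0) <= C1 * k.
  by move: l1; rewrite (addrC z) addrK ck.
have d3 : cm (F2 - F1) <= 2 * C1 * k.
  apply: le_trans l2 _; rewrite (_ : z + k%:C - (z + ik) = k%:C - ik); last by ring.
  have : cm (k%:C - ik) <= 2 * k.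
    by apply: le_trans (le_cmD _ _) _; rewrite cmN ck cik mulr_natl mulr2n.
  by move=> /(ler_wpM2l C10) /le_trans; apply; rewrite mulrCA mulrA.
have -> : ep^-1 * ep^-1 * (2 * C2 + C1 * (2 * C1 * ep^-1)) * k ^+ 2 =
  ep^-1 * ep^-1 * (2 * C2 * k ^+ 2 + C1 * k * (2 * C1 * k * ep^-1)) by ring.
have q0 := resolvent_le f0; have q1 := resolvent_le f1; have q2 := resolvent_le f2.
have sub (u v : R[i]) : (t -i* ep + u) - (t -i* ep + v) = u - v.
  by rewrite opprD addrACA subrr add0r.
apply: (inv_step_bound r0 r1 r2 e0 (@cm_i R) q0 q1 q2).
- by rewrite (sub F1 F0) (sub F2 F0); exact: d1.
- by rewrite sub; exact: d2.
- by rewrite sub; exact: d3.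
Qed.

Definition resolvent_re (y s : R) : R := complex.Re (resolvent (s +i* y)).
Definition resolvent_im (y s : R) : R := complex.Im (resolvent (s +i* y)).

Lemma continuous_resolvent y : 0 < y -> continuous (resolvent_re y) /\ continuous (resolvent_im y).
Proof.
move=> y0.
suff H (s e : R) : 0 < e -> \forall r \near s,
    cm (resolvent (s +i* y) - resolvent (r +i* y)) <= e.
  split=> s; apply/cvgrPdist_le => e /(H s); apply: filterS => r.
    by apply: le_trans; rewrite -ReN -ReD; exact: Re_le_cm.
  by apply: le_trans; rewrite -ImN -ImD; exact: Im_le_cm.
move=> e0.
have [C [C0 HC]] := transform_lipschitz K0 mu_summable (`|s| + 1 + y) y0.
have CE : 0 <= ep ^- 2 * C by rewrite mulr_ge0// invr_ge0 sqr_ge0.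
have e1 : 0 < Num.min 1 (e / (ep ^- 2 * C + 1)).
  by rewrite lt_min ltr01 divr_gt0//; lra.
have cs r : cm (r +i* y) <= `|r| + y.
  by apply: le_trans (cm_le_ReIm _) _; rewrite /= (gtr0_norm y0).
near=> r.
have : `|s - r| <= Num.min 1 (e / (ep ^- 2 * C + 1)).
  near: r; exact: cvgr_dist_le e1.
rewrite le_min => /andP[r1 re].
apply: le_trans (resolvent_dist _ _) _; [exact: (Im_transform_le0 K0 mu_summable)..|].
have rs : `|r| <= `|s| + 1.
  have := ler_normD s (r - s); rewrite addrC subrK distrC => h.
  by apply: le_trans h _; rewrite lerD2l.
have sep r' : separated mu y (r' +i* y) := @separated_im R mu (r' +i* y) y y0 (lexx y).
have ms : cm (s +i* y) <= `|s| + 1 + y by apply: le_trans (cs s) _; rewrite lerD2r lerDl.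
have mr : cm (r +i* y) <= `|s| + 1 + y by apply: le_trans (cs r) _; rewrite lerD2r.
have := HC _ _ (sep s) (sep r) ms mr.
have -> : s +i* y - r +i* y = (s - r)%:C.
  by apply/eqP; rewrite eq_complex/= subrr !eqxx.
rewrite cm_real => /(ler_wpM2l (_ : 0 <= ep ^- 2)) H.
apply: le_trans (H _) _; first by rewrite invr_ge0 sqr_ge0.
rewrite mulrA; move: re; rewrite ler_pdivlMr; last lra.
have := normr_ge0 (s - r); nra.
Unshelve. all: by end_near. Qed.

(** By the Cauchy-Riemann equation a vertical increment of the imaginary part
    is a horizontal increment of the real part up to [O(k ^ 2)], and the
    integral of the latter reduces to two end pieces of length [k]. *)
Lemma resolvent_im_increment (a b eta q : R) : 0 < eta -> a <= b ->
  exists be : R, 0 <= be /\ forall y (k : R), eta <= y -> 0 <= k <= 1 -> y + k <= q ->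
  `|\int[leb]_(s in `[a, b]) resolvent_im (y + k) s - \int[leb]_(s in `[a, b]) resolvent_im y s| <=
    2 / ep * k + be * k ^+ 2.
Proof.
move=> eta0 ab.
have [C [C0 HC]] := resolvent_step (`|a| + `|b| + `|q|) eta0.
exists (C * (b - a)); split; first by rewrite mulr_ge0// subr_ge0.
move=> y k etay /andP[k0 k1] ykq.
have y0 : 0 < y by lra.
have yk0 : 0 < y + k by lra.
have [cr ci] := continuous_resolvent y0; have [_ cik] := continuous_resolvent yk0.
have crk : continuous (fun s => resolvent_re y (s + k)).
  move=> s; apply: (@continuous_comp _ _ _ (fun s => s + k) (resolvent_re y)); last exact: cr.
  by apply: cvgD; [exact: cvg_id|exact: cvg_cst].
pose err s := resolvent_im (y + k) s - resolvent_im y s - (resolvent_re y (s + k) - resolvent_re y s).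
have cerr : continuous err.
  by move=> s; apply: cvgB; apply: cvgB; [exact: cik|exact: ci|exact: crk|exact: cr].
have E : \int[leb]_(s in `[a, b]) resolvent_im (y + k) s - \int[leb]_(s in `[a, b]) resolvent_im y s =
    \int[leb]_(s in `[a, b]) err s + (\int[leb]_(s in `[a, b]) resolvent_re y (s + k) -
    \int[leb]_(s in `[a, b]) resolvent_re y s).
  have mab := mseg a b.
  have i1 := @continuous_seg_integrable _ a b _ cik.
  have i2 := @continuous_seg_integrable _ a b _ ci.
  have i3 := @continuous_seg_integrable _ a b _ crk.
  have i4 := @continuous_seg_integrable _ a b _ cr.
  rewrite -(RintegralB mab i1 i2) -(RintegralB mab i3 i4) -RintegralD//.
  - by apply: eq_Rintegral => s _; rewrite /err subrK.
  - exact: continuous_seg_integrable.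
  - by apply: continuous_seg_integrable => s; apply: cvgB; [exact: crk|exact: cr].
rewrite {}E; apply: le_trans (ler_normD _ _) _; rewrite addrC; apply: lerD.
  apply: (@translate_bound _ (resolvent_re y) a b ep^-1 k cr ab k0) => s.
  by apply: le_trans (Re_le_cm _) (resolvent_le _); exact: (Im_transform_le0 K0 mu_summable).
rewrite mulrAC; apply: Rintegral_bound => // s /andP[as_ sb].
have zM : cm (s +i* y) <= `|a| + `|b| + `|q|.
  apply: le_trans (cm_le_ReIm _) _ => /=.
  have ha := ler_norm b; have hq := ler_norm q; have ha' : - `|a| <= a.
    by rewrite lerNl -normrN ler_norm.
  have na : (0:R) <= `|a| by []. have nb : (0:R) <= `|b| by [].
  apply: lerD; last by rewrite ger0_norm; lra.
  by rewrite ler_norml; apply/andP; split; lra.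
have := HC (s +i* y) k ltac:(by rewrite k0) etay zM.
apply: le_trans; rewrite /err /resolvent_im /resolvent_re.
have -> : s +i* (y + k) = s +i* y + 0 +i* k by apply/eqP; rewrite eq_complex/= addr0 !eqxx.
have -> : (s + k) +i* y = s +i* y + k%:C by apply/eqP; rewrite eq_complex/= addr0 !eqxx.
set u := resolvent _; set v := resolvent _; set w := resolvent _.
apply: le_trans (Im_le_cm _).
rewrite le_eqVlt; apply/orP; left; apply/eqP; congr `|_|.
case: u v w => [u1 u2] [v1 v2] [w1 w2] /=; ring.
Qed.

(** The increments are bounded by [2 / ep] times the step up to a quadratic
    error, so [subdivision] applies. *)
Lemma contour_shift (a b p q : R) : 0 < p -> p <= q -> a <= b ->
  `|\int[leb]_(s in `[a, b]) resolvent_im q s - \int[leb]_(s in `[a, b]) resolvent_im p s| <=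
    2 / ep * (q - p).
Proof.
move=> p0 pq ab; have [be [be0 H]] := resolvent_im_increment q p0 ab.
exact: (@subdivision _ (fun y => \int[leb]_(s in `[a, b]) resolvent_im y s) _ _ _ _ be0 pq H).
Qed.

End resolvent.

(** * Spatial averages of the resolvent *)

Section countable_support.
Context {R : realType}.
Implicit Type mu : wpm R.

Lemma countable_supp mu : countable (supp mu).
Proof.
have [lf _] := wpmP mu.
have -> : supp mu = \bigcup_(n in [set: nat]) (supp mu `&` `[- n%:R, n%:R]).
  apply/seteqP; split=> [x sx|x [n _ []]//].
  exists (Num.truncn `|x|).+1 => //; split=> //=.
  by rewrite in_itv/= -ler_norml; apply/ltW/truncnS_gt.
by apply: bigcup_countable => // n _; apply: finite_set_countable; exact: lf.
Qed.

Lemma measurable_countable (S : set R) : countable S -> measurable S.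
Proof. by move=> cS; apply: countable_measurable => // x; exact: measurable_set1. Qed.

Lemma measurable_supp mu : measurable (supp mu).
Proof. apply: measurable_countable; exact: countable_supp. Qed.

Lemma measurable_fun_countable (S : set R) (f : R -> R) : countable S ->
  measurable_fun S f.
Proof.
by move=> cS mS Y mY; apply: measurable_countable; apply: sub_countable cS; apply: subset_card_le; exact: subIsetl.
Qed.

Lemma lebesgue_supp mu : @lebesgue_measure R (supp mu) = 0%E.
Proof. apply: countable_lebesgue_measure0; exact: countable_supp. Qed.

End countable_support.

Section boundary.
Context {R : realType}.
Notation leb := (@lebesgue_measure R).
Variables (mu : wpm R) (K : R).
Hypothesis K0 : 0 < K.
Hypothesis mu_summable : summable_disc mu K.
Implicit Types (s y : R).

Lemma Im_transform_real s : complex.Im (transform mu s%:C) = 0.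
Proof.
have [sx|nsx] := pselect (supp mu s).
  by rewrite /transform asboolT//; exists s.
have [d sd] := separated_real nsx.
have := cvgC_Im (transform_cvg K0 mu_summable sd).
move=> /(_ _)/cvg_lim <-//; apply/cvg_lim => //.
apply: cvg_near_cst; apply: nearW => A.
by rewrite pv_trunc_Im/= /rsum big1// => x _; rewrite /kiml oppr0 mul0r mulr0.
Qed.

Lemma transform_realE s : transform mu s%:C = (transformR mu s)%:C.
Proof.
by apply/eqP; rewrite eq_complex Im_transform_real /= /transformR !eqxx.
Qed.

Lemma transformR_cvg s : ~ supp mu s ->
  rsum mu A (krel s 0) @[A --> +oo] --> transformR mu s.
Proof.
move=> nsx; have [d sd] := separated_real nsx.
have := cvgC_Re (transform_cvg K0 mu_summable sd).
move=> /(_ _) H; rewrite /transformR.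
have -> : (fun A => rsum mu A (krel s 0)) = (fun A => complex.Re (pv_trunc mu A s%:C)).
  by apply/funext => A; rewrite pv_trunc_Re.
exact: H.
Qed.

Lemma measurable_rsum_krel A : measurable_fun setT (fun s => rsum mu A (krel s 0)).
Proof.
rewrite /rsum; elim: (atoms mu A) => [|x t ih].
  by under eq_fun do rewrite big_nil; exact: measurable_cst.
under eq_fun do rewrite big_cons; apply: measurable_funD => //.
apply: measurable_funM; first exact: measurable_cst.
apply: measurable_quot; apply: continuous_mfun.
  by move=> s; apply: cvgB; [exact: cvg_id|exact: cvg_cst].
move=> s; apply: cvgD; last exact: cvg_cst.
by apply: (@continuous_sqr _ (fun s => s - x)) => r; apply: cvgB; [exact: cvg_id|exact: cvg_cst].
Qed.

Lemma measurable_transformR_off : measurable_fun (~` supp mu) (transformR mu).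
Proof.
apply: (@measurable_fun_cvg _ _ _ _ (fun n s => rsum mu n%:R (krel s 0))).
  by move=> n; apply: measurable_funTS; exact: measurable_rsum_krel.
move=> s ns; have := transformR_cvg ns.
by move=> /(cvg_comp _ _ (@cvgr_idn R)).
Qed.

(** Off the support the transform is a limit of measurable functions, and every
    function is measurable on a countable set. *)
Lemma measurable_atom_version f : atom_version mu f -> measurable_fun setT f.
Proof.
move=> fE; rewrite -(setUv (supp mu)).
apply/(measurable_funU _ (measurable_supp mu) (measurableC (measurable_supp mu))).
split; first by apply: measurable_fun_countable; exact: countable_supp.
apply: eq_measurable_fun measurable_transformR_off => s.
by rewrite inE => /fE.
Qed.

Lemma measurable_transformR : measurable_fun setT (transformR mu).
Proof. exact: measurable_atom_version. Qed.

Variables (t ep : R).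
Hypothesis ep0 : 0 < ep.

(** On the axis the transform is real. *)
Lemma resolvent_im0E s : resolvent_im mu t ep 0 s = ep / ((t + transformR mu s) ^+ 2 + ep ^+ 2).
Proof.
rewrite /resolvent_im /resolvent (_ : s +i* 0 = s%:C)// transform_realE/= addr0.
by rewrite sqrrN -mulNr opprK.
Qed.

Lemma resolvent_im_le y s : 0 <= y -> `|resolvent_im mu t ep y s| <= ep^-1.
Proof.
rewrite le_eqVlt => /predU1P[<-|y0]; apply: le_trans (Im_le_cm _) (resolvent_le t ep0 _) => //.
  by rewrite (_ : s +i* 0 = s%:C)// Im_transform_real.
exact: (Im_transform_le0 K0 mu_summable).
Qed.

Lemma measurable_resolvent_im0 : measurable_fun setT (resolvent_im mu t ep 0).
Proof.
rewrite (_ : resolvent_im mu t ep 0 = fun s => ep / ((t + transformR mu s) ^+ 2 + ep ^+ 2)); last first.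
  by apply/funext => s; rewrite resolvent_im0E.
apply: measurable_quot; first exact: measurable_cst.
apply: measurable_funD; last exact: measurable_cst.
by apply: measurable_funX; apply: measurable_funD => //; exact: measurable_transformR.
Qed.

(** Uniform continuity of the transform near a real point outside the
    support. *)
Lemma resolvent_im_cvg0 s : ~ supp mu s -> resolvent_im mu t ep n.+1%:R^-1 s @[n --> \oo] --> resolvent_im mu t ep 0 s.
Proof.
move=> /separated_real[d [d0 sd]].
have [C [C0 HC]] := transform_lipschitz K0 mu_summable (`|s| + 1) (d := d / 2) ltac:(by rewrite divr_gt0).
have CE : 0 <= ep ^- 2 * C by rewrite mulr_ge0// invr_ge0 sqr_ge0.
apply/cvgrPdist_le => e e0.
have m0 : 0 < Num.min 1 (Num.min (d / 2) (e / (ep ^- 2 * C + 1))).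
  by rewrite !lt_min ltr01 !divr_gt0//; lra.
near=> n.
have : n.+1%:R^-1 < Num.min 1 (Num.min (d / 2) (e / (ep ^- 2 * C + 1))).
  by near: n; exact: near_infty_natSinv_lt (PosNum m0).
rewrite !lt_min => /and3P[n1 nd ne].
set y := n.+1%:R^-1 in n1 nd ne *.
have y0 : 0 < y by rewrite invr_gt0.
apply: (@le_trans _ _ (cm (resolvent mu t ep (s +i* 0) - resolvent mu t ep (s +i* y)))).
  by rewrite /resolvent_im -ImN -ImD Im_le_cm.
apply: le_trans (resolvent_dist t ep0 _ _) _.
- by rewrite (_ : s +i* 0 = s%:C)// Im_transform_real.
- exact: (Im_transform_le0 K0 mu_summable).
have cy : cm (0 +i* y) = y by rewrite cmE/= expr0n/= add0r sqrtr_sqr gtr0_norm.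
have yE : s +i* y = s%:C + 0 +i* y by apply/eqP; rewrite eq_complex/= addr0 add0r !eqxx.
have s2 : separated mu (2 * (d / 2)) s%:C by rewrite mulrC divfK.
have h1 : separated mu (d / 2) s%:C.
  by split; [rewrite divr_gt0|move=> x /sd; apply: le_trans; lra].
have h2 : separated mu (d / 2) (s +i* y).
  by rewrite yE; apply: separated_shift => //; rewrite cy ltW.
have := HC (s +i* 0) (s +i* y) h1 h2.
rewrite {1}(_ : s +i* 0 = s%:C)// cm_real => /(_ ltac:(by rewrite lerDl)).
have m2 : cm (s +i* y) <= `|s| + 1.
  by rewrite yE (le_trans (le_cmD _ _))// cm_real cy lerD2l ltW.
have cd : cm (s +i* 0 - s +i* y) = y.
  rewrite cmB -[RHS]cy; congr cm.
  by apply/eqP; rewrite eq_complex/= subrr subr0 !eqxx.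
move=> /(_ m2); rewrite cd => H.
apply: le_trans (ler_wpM2l _ H) _; first by rewrite invr_ge0 sqr_ge0.
rewrite mulrA; move: ne; rewrite ltr_pdivlMr; last lra.
nra.
Unshelve. all: by end_near. Qed.

(** Lets the lower height tend to 0; the resolvent is bounded, so dominated
    convergence applies almost everywhere. *)
Lemma contour_shift0 (a b q : R) : 0 < q -> a <= b ->
  `|\int[leb]_(s in `[a, b]) resolvent_im mu t ep q s - \int[leb]_(s in `[a, b]) resolvent_im mu t ep 0 s|
    <= 2 / ep * q.
Proof.
move=> q0 ab.
have mab := mseg a b.
have ci n : continuous (resolvent_im mu t ep n.+1%:R^-1).
  by have [] := continuous_resolvent K0 mu_summable t ep0 (y := n.+1%:R^-1) ltac:(by rewrite invr_gt0).
have i1 : leb.-integrable `[a, b] (EFin \o cst ep^-1).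
  by apply: continuous_seg_integrable => x; exact: cvg_cst.
have [i0 _ H] : [/\ leb.-integrable `[a, b] (EFin \o resolvent_im mu t ep 0),
    [sequence \int[leb]_(s in `[a, b]) `|(resolvent_im mu t ep n.+1%:R^-1 s)%:E - (resolvent_im mu t ep 0 s)%:E|]_n
      @ \oo --> 0 &
    [sequence \int[leb]_(s in `[a, b]) (resolvent_im mu t ep n.+1%:R^-1 s)%:E]_n @ \oo -->
      \int[leb]_(s in `[a, b]) (resolvent_im mu t ep 0 s)%:E]%E.
  apply: (@dominated_convergence _ _ _ leb _ mab _ _ (EFin \o cst ep^-1)) => //.
  - by move=> n; apply/measurable_EFinP/measurable_funTS; exact: continuous_mfun.
  - by apply/measurable_EFinP/measurable_funTS; exact: measurable_resolvent_im0.
  - exists (supp mu); split; [exact: measurable_supp|exact: lebesgue_supp|].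
    move=> s /= H; apply: contrapT => ns; apply: H => _.
    by apply/fine_cvgP; split; [exact: nearW|exact: resolvent_im_cvg0].
  - by apply: aeW => s n _ /=; rewrite lee_fin resolvent_im_le// invr_ge0.
have {}H : \int[leb]_(s in `[a, b]) resolvent_im mu t ep n.+1%:R^-1 s @[n --> \oo] -->
    \int[leb]_(s in `[a, b]) resolvent_im mu t ep 0 s.
  by apply: fine_cvg; rewrite /Rintegral fineK//; exact: integrable_fin_num i0.
apply/ler_addgt0Pr => e e0.
move/cvgrPdist_le : H => /(_ e e0) H.
near \oo => n.
have Hn : `|\int[leb]_(s in `[a, b]) resolvent_im mu t ep 0 s -
  \int[leb]_(s in `[a, b]) resolvent_im mu t ep n.+1%:R^-1 s| <= e by near: n.
have nq : n.+1%:R^-1 < q by near: n; exact: near_infty_natSinv_lt (PosNum q0).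
have p0 : 0 < n.+1%:R^-1 :> R by rewrite invr_gt0.
have tri (u v w c1 c2 : R) : `|u - v| <= e -> `|w - v| <= c1 -> c1 <= c2 ->
    `|w - u| <= c2 + e.
  move=> h1 h2 h3; have -> : w - u = (w - v) - (u - v) by ring.
  by apply: le_trans (ler_normB _ _) _; apply: lerD => //; exact: le_trans h3.
apply: (tri _ _ _ _ _ Hn (contour_shift K0 mu_summable t ep0 p0 (ltW nq) ab)).
apply: ler_wpM2l; first by rewrite divr_ge0// ltW.
by rewrite gerBl ltW.
Unshelve. all: by end_near. Qed.

Lemma lim_abs_le (f : R -> R) (l c : R) : f A @[A --> +oo] --> l ->
  (forall A, `|f A| <= c) -> `|l| <= c.
Proof.
move=> /cvgyP fl fc; apply/ler_addgt0Pr => e e0.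
have [A0 /(_ A0 (lexx _)) H] := fl e e0.
have -> : l = f A0 - (f A0 - l) by ring.
by apply: le_trans (ler_normB _ _) _; exact: lerD.
Qed.

(** Far from the real axis only the mean density is seen, and the transform of
    [K] times the Lebesgue measure is [- i pi K] on the upper half-plane. *)
Lemma transform_far (d e : R) : 0 < d -> 0 < e ->
  exists L0 : R, 0 < L0 /\ forall L s : R, L0 <= L -> `|s| <= L ->
    cm (transform mu (s +i* (d * L)) - 0 -i* (pi * K)) <= e.
Proof.
move=> d0 e0; have e2 : 0 < e / 2 by lra.
have [L0 [L00 H]] := poisson_small K0 mu_summable d0 e2.
exists L0; split=> // L s LL sL.
have y0 : 0 < d * L by rewrite mulr_gt0//; exact: lt_le_trans LL.
have y1 : d * L != 0 by rewrite gt_eqF.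
have [m1 [m2 [h1 h2 h3 h4]]] := half_plane_lim K0 mu_summable s y0.
have b1 : `|m1| <= e / 2.
  apply: (lim_abs_le h1) => A; apply: (H L s _ LL sL); first exact: continuous_dkrel.
  by move=> r; exact: dkrel_le.
have b2 : `|m2| <= e / 2.
  apply: (lim_abs_le h2) => A; apply: (H L s _ LL sL); first exact: continuous_dkiml.
  by move=> r; exact: dkiml_le.
have F := transform_cvg K0 mu_summable (@separated_im R mu (s +i* (d * L)) _ y0 (lexx _)).
have E1 : complex.Re (transform mu (s +i* (d * L))) = - m1.
  have := cvgC_Re F => /(_ _)/cvg_lim <-//; apply/cvg_lim => //.
  by under [X in X @ _ --> _]eq_fun do rewrite pv_trunc_Re.
have E2 : complex.Im (transform mu (s +i* (d * L))) = - (K * pi) - m2.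
  have := cvgC_Im F => /(_ _)/cvg_lim <-//; apply/cvg_lim => //.
  by under [X in X @ _ --> _]eq_fun do rewrite pv_trunc_Im.
apply: le_trans (cm_le_ReIm _) _; rewrite ReD ImD ReN ImN/= E1 E2 oppr0 addr0 opprK normrN.
rewrite (_ : - (K * pi) - m2 + pi * K = - m2); last by ring.
by rewrite normrN; lra.
Qed.

(** Shift the segment up to a height [d L] that is small compared with its
    length [L] yet large enough for the transform to be nearly constant on
    it. *)
Lemma average_resolvent : (L^-1 * \int[leb]_(s in `[(- (L / 2)), (L / 2)]) resolvent_im mu t ep 0 s)
  @[L --> +oo] --> (ep + pi * K) / (t ^+ 2 + (ep + pi * K) ^+ 2).
Proof.
have ep1 := ep0.
have pK : 0 < pi * K by rewrite mulr_gt0// pi_gt0.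
set T := (X in _ --> X).
apply/cvgyP => e e0.
(* Divided by [L], the shift to height [d L] costs [2 d / ep = e / 2]; the
   bound [ep ^ -2] for the inversion turns [e1] into the other [e / 2]. *)
pose d := e * ep / 4; pose e1 := e * ep ^+ 2 / 2.
have d0 : 0 < d by rewrite /d divr_gt0// mulr_gt0.
have ep2 : 0 < ep ^+ 2 by rewrite exprn_gt0.
have e10 : 0 < e1 by rewrite /e1 divr_gt0// mulr_gt0.
have [L0 [L00 H]] := transform_far d0 e10.
exists L0 => L LL; have Lp : 0 < L by lra.
pose target : R[i] := (t -i* ep + 0 -i* (pi * K))^-1.
have targetE : complex.Im target = T.
  by rewrite /target/T/= addr0 -opprD sqrrN -mulNr opprK.
have dL : 0 < d * L by rewrite mulr_gt0.
have close s : - (L / 2) <= s <= L / 2 -> `|resolvent_im mu t ep (d * L) s - T| <= e / 2.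
  move=> sL; rewrite -targetE /resolvent_im -ImN -ImD; apply: le_trans (Im_le_cm _) _.
  have sL2 : `|s| <= L by move: sL; rewrite ler_norml; lra.
  have HF := H L s LL sL2.
  have Fi := @Im_transform_le0 R mu K K0 mu_summable (s +i* (d * L)) dL.
  have n1 := @resolvent_neq0 R mu t ep ep0 _ Fi.
  have q1 := resolvent_le t ep0 Fi.
  have tden : ep <= cm (t -i* ep + 0 -i* (pi * K)).
    apply: le_trans (Im_le_cm _); rewrite /= -opprD normrN ger0_norm; lra.
  have n2 : t -i* ep + 0 -i* (pi * K) != 0.
    by apply: contraTneq tden => ->; rewrite cm0 -ltNge.
  have q2 : cm target <= ep^-1 by rewrite /target cmV lef_pV2 ?posrE//; exact: cm_gt0.
  have E (a b : R[i]) : a != 0 -> b != 0 -> a^-1 - b^-1 = a^-1 * b^-1 * (b - a).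
    by move=> a0 b0; field; rewrite a0 b0.
  rewrite /resolvent /target E// cmM cmM.
  apply: (@le_trans _ _ (ep^-1 * ep^-1 * e1)).
    apply: ler_pM; [by apply: mulr_ge0; exact: cm_ge0|exact: cm_ge0| |].
      apply: ler_pM; [exact: cm_ge0|exact: cm_ge0|exact: q1|exact: q2].
    by rewrite cmB opprD addrACA subrr add0r.
  by rewrite /e1 le_eqVlt; apply/orP; left; apply/eqP; field; rewrite gt_eqF.
have LL2 : - (L / 2) <= L / 2 by lra.
have c1 := contour_shift0 dL LL2.
have [_ ci] := continuous_resolvent K0 mu_summable t ep0 dL.
have c2 : `|\int[leb]_(s in `[(- (L / 2)), (L / 2)]) (resolvent_im mu t ep (d * L) s - T)|
    <= e / 2 * (L / 2 - - (L / 2)).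
  apply: Rintegral_bound => // s; apply: cvgB; [exact: ci|exact: cvg_cst].
move: c2; rewrite RintegralB//; last 2 first.
- exact: continuous_seg_integrable.
- by apply: continuous_seg_integrable => s; exact: cvg_cst.
rewrite Rint_cst// => c2.
have fin (u v : R) : `|u - v| <= 2 / ep * (d * L) ->
    `|u - T * (L / 2 - - (L / 2))| <= e / 2 * (L / 2 - - (L / 2)) ->
    `|L^-1 * v - T| <= e.
  have LE : L / 2 - - (L / 2) = L by field.
  rewrite LE => h1 h2.
  have -> : L^-1 * v - T = L^-1 * ((v - u) + (u - T * L)) by field; rewrite gt_eqF.
  rewrite normrM ger0_norm ?invr_ge0 ?(ltW Lp)// ler_pdivrMl//.
  apply: le_trans (ler_normD _ _) _; rewrite distrC.
  apply: le_trans (lerD h1 h2) _.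
  rewrite le_eqVlt; apply/orP; left; apply/eqP; rewrite /d; field.
  by rewrite gt_eqF.
exact: fin c1 c2.
Qed.

End boundary.

(** * Mollification by Cauchy laws *)

Section cauchy_density.
Context {R : realType}.
Local Notation leb := (@lebesgue_measure R).

Lemma cauchy_pdfE (x : R) : cauchy_pdf x = pi^-1 * wt x.
Proof. by rewrite /cauchy_pdf invfM. Qed.

Lemma cauchy_pdf_gt0 (x : R) : 0 < cauchy_pdf x.
Proof. rewrite cauchy_pdfE; apply: mulr_gt0; last exact: wt_gt0.
by rewrite invr_gt0 pi_gt0. Qed.

Lemma continuous_cauchy_pdf : continuous (@cauchy_pdf R).
Proof.
have -> : cauchy_pdf = (fun x : R => pi^-1 * wt x) by apply/funext => x; rewrite cauchy_pdfE.
by move=> x; apply: cvgM; [exact: cvg_cst|exact: continuous_wt].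
Qed.

Lemma measurable_cauchy_pdf : measurable_fun setT (@cauchy_pdf R).
Proof. apply: continuous_mfun; exact: continuous_cauchy_pdf. Qed.

Lemma integral_cauchy_pdf1 : (\int[leb]_x (cauchy_pdf x)%:E = 1)%E.
Proof. exact: (@probability_setT _ _ _ (@cauchy01 R)). Qed.

Lemma integrable_cauchy_pdf : leb.-integrable setT (EFin \o cauchy_pdf).
Proof.
apply/integrableP; split.
  by apply/measurable_EFinP; exact: measurable_cauchy_pdf.
under eq_integral do rewrite /= ger0_norm ?ltW ?cauchy_pdf_gt0//.
by rewrite integral_cauchy_pdf1 ltry.
Qed.

(** The Cauchy law has a density. *)
Lemma cauchy_dom : cauchy01 `<< leb.
Proof.
apply/null_content_dominatesP => A mA A0.
apply: null_set_integral => //; apply/measurable_EFinP; apply: measurable_funTS.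
exact: measurable_cauchy_pdf.
Qed.

Lemma bounded_integrable (nu : probability (measurableTypeR R) R) (f : R -> R) C :
  measurable_fun setT f -> (forall x, `|f x| <= C) -> nu.-integrable setT (EFin \o f).
Proof.
move=> mf fC; apply: measurable_bounded_integrable => //.
  by rewrite (le_lt_trans (probability_le1 _ _))// ltry.
exists C; split; first exact: num_real.
by move=> M CM x _ /=; exact: le_trans (fC x) (ltW CM).
Qed.

Lemma integral_cauchy01 (f : R -> R) C : measurable_fun setT f ->
  (forall x, `|f x| <= C) ->
  (\int[cauchy01]_x (f x)%:E = \int[leb]_x (f x * cauchy_pdf x)%:E)%E.
Proof.
move=> mf fC; have mp := measurable_cauchy_pdf.
rewrite -(Radon_Nikodym_change_of_variables cauchy_dom)//=; last first.
  exact: bounded_integrable mf fC.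
under [RHS]eq_integral do rewrite EFinM.
apply: ae_eq_integral => //.
- apply: emeasurable_funM; first exact/measurable_EFinP.
  apply: (measurable_int leb); apply: Radon_Nikodym_integrable; exact: cauchy_dom.
- by apply: emeasurable_funM; exact/measurable_EFinP.
- apply: ae_eqe_mul2l => /=.
  rewrite Radon_NikodymE//=; first exact: cauchy_dom.
  move=> abmu; case: cid => /= h [h1 h2 h3].
  apply: integral_ae_eq => //=.
  + exact/measurable_EFinP.
  + by move=> E _ mE; rewrite -h3.
Qed.

Lemma Rintegral_cauchy01 (f : R -> R) C : measurable_fun setT f ->
  (forall x, `|f x| <= C) ->
  \int[cauchy01]_x f x = \int[leb]_x (f x * cauchy_pdf x).
Proof. by move=> mf fC; rewrite /Rintegral (integral_cauchy01 mf fC). Qed.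

(** The density of [e] times a Cauchy variable. The family is a convolution
    semigroup, and the integrals of its members and their translates against a
    law determine that law. *)
Definition poisson (e u : R) : R := e / (pi * (u ^+ 2 + e ^+ 2)).

Lemma poisson_den (e u : R) : 0 < e -> 0 < pi * (u ^+ 2 + e ^+ 2).
Proof. by move=> e0; rewrite mulr_gt0 ?pi_gt0// ltr_wpDl ?sqr_ge0// exprn_gt0. Qed.

Lemma poisson_gt0 (e u : R) : 0 < e -> 0 < poisson e u.
Proof. by move=> e0; rewrite divr_gt0// poisson_den. Qed.

Lemma continuous_poisson (e : R) : 0 < e -> continuous (poisson e).
Proof.
move=> e0; apply: continuous_quot; first by move=> x; exact: cvg_cst.
  move=> x; apply: cvgM; first exact: cvg_cst.
  by apply: cvgD; [apply: cvgM; exact: cvg_id|exact: cvg_cst].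
by move=> x; rewrite gt_eqF// poisson_den.
Qed.

Lemma poisson_scale (e u : R) : 0 < e -> poisson e (e * u) * e = cauchy_pdf u.
Proof.
move=> e0; have := pi_gt0 R; rewrite /poisson /cauchy_pdf; move: (@pi R) => p p0.
have h1 : 1 + u ^+ 2 != 0 := wt_den u.
have h2 : (e * u) ^+ 2 + e ^+ 2 != 0.
  have E : (e * u) ^+ 2 + e ^+ 2 = e ^+ 2 * (1 + u ^+ 2) by ring.
  by rewrite E mulf_eq0 negb_or h1 andbT expf_neq0// gt_eqF.
by field; rewrite h1 h2 !gt_eqF.
Qed.

(** The change of variables [t = x + e u]. *)
Lemma poisson_subst (phi : R -> R) (x e : R) : 0 < e -> continuous phi ->
  (forall t, 0 <= phi t) ->
  (\int[leb]_t (phi t * poisson e (t - x))%:E =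
   \int[leb]_u (phi (x + e * u) * cauchy_pdf u)%:E)%E.
Proof.
move=> e0 cphi phi0.
have dF (u : R) : is_derive u (1 : R) (fun u => x + e * u) e.
  by apply: is_derive_eq; rewrite /GRing.scale/=; ring.
have F'E : derive1 (fun u : R => x + e * u) = cst e.
  by apply/funext => u; rewrite derive1E; apply: derive_val; exact: dF.
rewrite (@increasing_ge0_integration_by_substitutionT _ (fun u => x + e * u)
   (fun t => phi t * poisson e (t - x))).
- apply: eq_integral => u _; rewrite F'E /= /GRing.mul/=; congr EFin.
  by rewrite -[RHS]/(phi (x + e * u) * cauchy_pdf u) -(poisson_scale u e0) mulrA (addrC x) addrK.
- by move=> u v uv; rewrite ltrD2l ltr_pM2l.
- by rewrite F'E => u; exact: cvg_cst.
- by rewrite F'E; exact: is_cvg_cst.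
- by rewrite F'E; exact: is_cvg_cst.
- by move=> u; have [] := dF u.
- apply/cvgrNyPle => M; near=> u.
  rewrite addrC -lerBrDr mulrC -ler_pdivlMr//; near: u; apply: nbhs_ninfty_le; exact: num_real.
- apply/cvgryPge => M; near=> u.
  rewrite addrC -lerBlDr mulrC -ler_pdivrMr//; near: u; apply: nbhs_pinfty_ge; exact: num_real.
- move=> u; apply: cvgM; first exact: cphi.
  apply: (@continuous_comp _ _ _ (fun t => t - x) (poisson e)); last exact: continuous_poisson.
  by apply: cvgB; [exact: cvg_id|exact: cvg_cst].
- by move=> u; rewrite mulr_ge0// ltW// poisson_gt0.
Unshelve. all: by end_near. Qed.

(** The mean of [phi] under the Cauchy law of scale [e] centred at [x]. *)
Definition smooth (phi : R -> R) (e x : R) : R :=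
  \int[leb]_u (phi (x + e * u) * cauchy_pdf u).

(** A modulus of continuity for [smooth] over functions with Lipschitz constant
    [k] and values in [[0, C]]. The minimum with [C] is needed because the
    Cauchy law has no first moment. *)
Definition modulus_smooth (k C e : R) : R :=
  \int[leb]_u (Num.min (k * (e * `|u|)) C * cauchy_pdf u).

Lemma density_integrable (g : R -> R) C : measurable_fun setT g ->
  (forall u, `|g u| <= C) ->
  leb.-integrable setT (EFin \o (fun u => g u * cauchy_pdf u)).
Proof.
move=> mg gC; have mp := measurable_cauchy_pdf.
apply: (@le_integrable _ _ _ leb _ _ _ (EFin \o (fun u => C * cauchy_pdf u))) => //.
- by apply/measurable_EFinP; exact: measurable_funM.
- move=> u _; rewrite lee_fin !normrM ler_wpM2r//.
  exact: le_trans (gC u) (ler_norm _).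
- exact: (integrableZl measurableT C integrable_cauchy_pdf).
Qed.

Lemma continuous_affine (x e : R) : continuous (fun u : R => x + e * u).
Proof.
move=> u; apply: cvgD; first exact: cvg_cst.
by apply: cvgM; [exact: cvg_cst|exact: cvg_id].
Qed.

Variables (phi : R -> R) (k C : R).
Hypothesis k0 : 0 <= k.
Hypothesis C0 : 0 <= C.
Hypothesis phi_ge0 : forall x, 0 <= phi x.
Hypothesis phi_leC : forall x, phi x <= C.
Hypothesis phi_lip : forall x y, `|phi x - phi y| <= k * `|x - y|.

Lemma lip_continuous : continuous phi.
Proof.
have k1 := k0.
move=> x; apply/cvgrPdist_le => e e0; near=> y.
apply: le_trans (phi_lip x y) _.
have : `|x - y| <= e / (k + 1).
  by near: y; apply: cvgr_dist_le => //; rewrite divr_gt0//; lra.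
rewrite ler_pdivlMr; last lra.
have := normr_ge0 (x - y); nra.
Unshelve. all: by end_near. Qed.

Lemma phi_norm x : `|phi x| <= C.
Proof. by rewrite ger0_norm. Qed.

Lemma phi_diff x y : `|phi x - phi y| <= C.
Proof.
have := phi_ge0 x; have := phi_ge0 y; have := phi_leC x; have := phi_leC y.
by rewrite ler_norml => *; apply/andP; split; lra.
Qed.

Lemma measurable_phi_affine (x e : R) : measurable_fun setT (fun u => phi (x + e * u)).
Proof.
apply: continuous_mfun => u.
by apply: (@continuous_comp _ _ _ (fun u => x + e * u) phi); [exact: continuous_affine|exact: lip_continuous].
Qed.

Lemma measurable_modulus (e : R) : measurable_fun setT (fun u : R => Num.min (k * (e * `|u|)) C).
Proof.
apply: measurable_minr; last exact: measurable_cst.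
apply: continuous_mfun => u.
by do 2 (apply: cvgM; [exact: cvg_cst|]); exact: norm_continuous.
Qed.

Lemma modulus_bound (e u : R) : 0 <= e -> `|Num.min (k * (e * `|u|)) C| <= C.
Proof.
by move=> e0; rewrite ger0_norm ?ge_min ?lexx ?orbT// le_min C0 andbT !mulr_ge0.
Qed.

(** Couple the two averages through the same Cauchy variable [u]. *)
Lemma smooth_dist (x e y e' d : R) : 0 <= d ->
  (forall u, `|(x + e * u) - (y + e' * u)| <= d * `|u|) ->
  `|smooth phi e x - smooth phi e' y| <= modulus_smooth k C d.
Proof.
move=> d0 H.
have i1 := density_integrable (measurable_phi_affine x e) (fun u => phi_norm _).
have i2 := density_integrable (measurable_phi_affine y e') (fun u => phi_norm _).
have i3 := density_integrable (measurable_modulus d) (fun u => modulus_bound u d0).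
rewrite /smooth -RintegralB//.
have i12 : leb.-integrable setT (EFin \o (fun u => phi (x + e * u) * cauchy_pdf u -
     phi (y + e' * u) * cauchy_pdf u)) by exact: (integrableB measurableT i1 i2).
apply: le_trans (le_normr_Rintegral measurableT i12) _.
apply: le_Rintegral => //.
  by have /integrable_abse := i12.
move=> u _; rewrite -mulrBl normrM (gtr0_norm (cauchy_pdf_gt0 u)).
apply: ler_wpM2r; first exact/ltW/cauchy_pdf_gt0.
rewrite le_min phi_diff andbT; apply: le_trans (phi_lip _ _) _.
exact: ler_wpM2l.
Qed.

(** Dominated convergence along [e = 1 / (n + 1)]. *)
Lemma modulus_small (eta : R) : 0 < eta -> exists e : R, 0 < e /\ modulus_smooth k C e <= eta.
Proof.
move=> eta0.
have H : (fun n : nat => \int[leb]_u ((Num.min (k * (n.+1%:R^-1 * `|u|)) C * cauchy_pdf u)%:E))%E @ \oo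
    --> (\int[leb]_(u in setT) (cst 0 u))%E.
  have ip := density_integrable (@measurable_cst _ _ _ _ setT C) (fun u => ler_norm `|C| : `|C| <= `| `|C| |).
  have [] // := @dominated_convergence _ _ _ leb setT measurableT
    (fun n u => (Num.min (k * (n.+1%:R^-1 * `|u|)) C * cauchy_pdf u)%:E) (cst 0%E)
    (EFin \o (fun u => C * cauchy_pdf u)).
  - move=> n; apply/measurable_EFinP/measurable_funM; first exact: measurable_modulus.
    exact: measurable_cauchy_pdf.
  - apply: aeW => u _.
    apply/fine_cvgP; split; first exact: nearW.
    apply/cvgrPdist_le => e e0.
    have X0 : 0 < e / cauchy_pdf u / (k * `|u| + 1).
      by rewrite divr_gt0 ?divr_gt0 ?cauchy_pdf_gt0// ltr_wpDl// mulr_ge0.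
    near=> n.
    rewrite sub0r normrN normrM (gtr0_norm (cauchy_pdf_gt0 u)) -ler_pdivlMr ?cauchy_pdf_gt0//.
    rewrite ger0_norm; last by rewrite le_min C0 andbT !mulr_ge0.
    rewrite ge_min; apply/orP; left.
    have : n.+1%:R^-1 < e / cauchy_pdf u / (k * `|u| + 1).
      by near: n; exact: near_infty_natSinv_lt (PosNum X0).
    have ku : 0 < k * `|u| + 1 by rewrite ltr_wpDl// mulr_ge0.
    rewrite ltr_pdivlMr// => /ltW; apply: le_trans.
    rewrite mulrCA; apply: ler_wpM2l; first by rewrite invr_ge0.
    by rewrite lerDl.
  - apply: aeW => u n _ /=; rewrite lee_fin normrM (gtr0_norm (cauchy_pdf_gt0 u)).
    apply: ler_wpM2r; first exact/ltW/cauchy_pdf_gt0.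
    exact: modulus_bound.
rewrite integral0 in H.
have /fine_cvgP[_ /cvgrPdist_le /(_ eta eta0) Hn] := H.
near \oo => n.
exists n.+1%:R^-1; split; first by rewrite invr_gt0.
have : `|0 - modulus_smooth k C n.+1%:R^-1| <= eta by near: n.
by rewrite sub0r normrN; apply: le_trans; exact: ler_norm.
Unshelve. all: by end_near. Qed.

End cauchy_density.

(** * Convergence of Poisson averages implies weak convergence *)

Section weak_convergence.
Context {R : realType}.
Local Notation leb := (@lebesgue_measure R).

(** Values strictly below the lower limit are eventually exceeded. *)
Lemma limn_einf_gt (u : (\bar R)^nat) (a : R) : (a%:E < limn_einf u)%E ->
  exists N, forall n, (N <= n)%N -> (a%:E < u n)%E.
Proof.
move=> au; apply: contrapT => H.
suff : (limn_einf u <= a%:E)%E by rewrite leNgt au.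
rewrite limn_einf_lim; apply: lime_le; first exact: is_cvg_einfs.
apply: nearW => n; have [m nm um] : exists2 m, (n <= m)%N & (u m <= a%:E)%E.
  apply: contrapT => K; apply: H; exists n => m nm; rewrite ltNge; apply/negP => um.
  by apply: K; exists m.
by apply: le_trans um; apply: ereal_inf_lbound; exists m.
Qed.

Lemma Rintegral_prob_cst (m : probability (measurableTypeR R) R) (c : R) :
  \int[m]_x c = c.
Proof.
rewrite /Rintegral integral_cst//=.
have -> : m [set: measurableTypeR R] = 1%E by exact: probability_setT.
by rewrite mule1.
Qed.

Variable nu : (probability (measurableTypeR R) R)^nat.
Hypothesis nu_poisson : forall t e : R, 0 < e ->
  \int[nu n]_x poisson e (t - x) @[n --> \oo] --> poisson (1 + e) t.

Section lipschitz.
Variables (phi : R -> R) (k C : R).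
Hypothesis k0 : 0 <= k.
Hypothesis C0 : 0 <= C.
Hypothesis phi_ge0 : forall x, 0 <= phi x.
Hypothesis phi_leC : forall x, phi x <= C.
Hypothesis phi_lip : forall x y, `|phi x - phi y| <= k * `|x - y|.

Let cphi : continuous phi := lip_continuous k0 phi_lip.
Let mphi : measurable_fun setT phi := continuous_mfun cphi.

Lemma smoothE e x : 0 < e ->
  (smooth phi e x)%:E = (\int[leb]_t (phi t * poisson e (t - x))%:E)%E.
Proof.
move=> e0; rewrite (poisson_subst x e0 cphi phi_ge0) /smooth /Rintegral fineK//.
apply: integrable_fin_num => //.
exact: density_integrable (measurable_phi_affine k0 phi_lip x e) (fun u => phi_norm phi_ge0 phi_leC _).
Qed.

Lemma smooth_ge0 e x : 0 <= smooth phi e x.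
Proof. by apply: Rintegral_ge0 => u _; rewrite mulr_ge0// ltW// cauchy_pdf_gt0. Qed.

Lemma smooth_leC e x : `|smooth phi e x| <= C.
Proof.
rewrite ger0_norm ?smooth_ge0// -lee_fin /smooth /Rintegral fineK; last first.
  apply: integrable_fin_num => //.
  exact: density_integrable (measurable_phi_affine k0 phi_lip x e) (fun u => phi_norm phi_ge0 phi_leC _).
apply: (@le_trans _ _ (\int[leb]_u (C%:E * (cauchy_pdf u)%:E)))%E.
  apply: ge0_le_integral => //.
  - by move=> u _; rewrite lee_fin mulr_ge0// ltW// cauchy_pdf_gt0.
  - apply/measurable_EFinP/measurable_funM; last exact: measurable_cauchy_pdf.
    exact: measurable_phi_affine k0 phi_lip x e.
  - by apply/measurable_EFinP/measurable_funM => //; exact: measurable_cauchy_pdf.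
  - by move=> u _; rewrite -EFinM lee_fin ler_wpM2r// ltW// cauchy_pdf_gt0.
rewrite ge0_integralZl//; last 2 first.
- by apply/measurable_EFinP; exact: measurable_cauchy_pdf.
- by move=> u _; rewrite lee_fin ltW// cauchy_pdf_gt0.
by rewrite integral_cauchy_pdf1 mule1.
Qed.

Lemma smooth0 x : smooth phi 0 x = phi x.
Proof.
rewrite /smooth; under eq_Rintegral do rewrite mul0r addr0.
rewrite RintegralZl//; last exact: integrable_cauchy_pdf.
by rewrite /Rintegral integral_cauchy_pdf1 mulr1.
Qed.

Let kern e := fun z : measurableTypeR R * measurableTypeR R => (phi z.2 * poisson e (z.2 - z.1))%:E.

Lemma measurable_kern e : 0 < e -> measurable_fun setT (kern e).
Proof.
move=> e0; apply/measurable_EFinP/measurable_funM.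
  exact: (measurableT_comp mphi measurable_snd).
apply: (measurableT_comp (continuous_mfun (continuous_poisson e0))).
by apply: measurable_funB; [exact: measurable_snd|exact: measurable_fst].
Qed.

Lemma kern_ge0 e z : 0 < e -> (0 <= kern e z)%E.
Proof. by move=> e0; rewrite lee_fin mulr_ge0// ltW// poisson_gt0. Qed.

Lemma measurable_smooth e : 0 < e -> measurable_fun setT (smooth phi e).
Proof.
move=> e0; apply/measurable_EFinP.
have := @measurable_fun_fubini_tonelli_F _ _ _ _ _ leb (kern e) (measurable_kern e0)
  (fun z => kern_ge0 z e0).
by apply: eq_measurable_fun => x _; rewrite /fubini_F /= smoothE.
Qed.

Lemma poisson_le (e u : R) : 0 < e -> poisson e u <= (pi * e)^-1.
Proof.
move=> e0; rewrite /poisson -[e in e / _]mul1r ler_pdivrMr ?poisson_den//.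
have := pi_gt0 R; move: (@pi R) => p p0.
have -> : (p * e)^-1 * (p * (u ^+ 2 + e ^+ 2)) = (u ^+ 2 + e ^+ 2) / e.
  by field; rewrite !gt_eqF.
by rewrite mul1r ler_pdivlMr//; have := sqr_ge0 u; lra.
Qed.

(** Mollifying the function or mollifying the law gives the same integral. *)
Lemma fubini_smooth (m : probability (measurableTypeR R) R) e : 0 < e ->
  (\int[m]_x (smooth phi e x)%:E =
   \int[leb]_t (phi t * \int[m]_x poisson e (t - x))%:E)%E.
Proof.
move=> e0; have := @fubini_tonelli _ _ _ _ _ m leb (kern e) (measurable_kern e0)
  (fun z => kern_ge0 z e0).
move=> H; transitivity (\int[m]_x \int[leb]_t kern e (x, t))%E.
  by apply: eq_integral => x _; rewrite smoothE.
rewrite H; apply: eq_integral => t _; rewrite /kern/=.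
have mpk : measurable_fun setT (fun x : R => poisson e (t - x)).
  apply: (measurableT_comp (continuous_mfun (continuous_poisson e0))).
  by apply: measurable_funB; [exact: measurable_cst|exact: measurable_id].
under eq_integral do rewrite EFinM.
have -> : (\int[m]_x ((phi t)%:E * (poisson e (t - x))%:E) =
    (phi t)%:E * \int[m]_x (poisson e (t - x))%:E)%E.
  apply: ge0_integralZl => //.
  - exact/measurable_EFinP.
  - by move=> x _; rewrite lee_fin ltW// poisson_gt0.
  - by rewrite lee_fin.
rewrite EFinM /Rintegral fineK//; apply: integrable_fin_num => //.
apply: (bounded_integrable (C := (pi * e)^-1) _ mpk) => x.
by rewrite ger0_norm ?poisson_le// ltW// poisson_gt0.
Qed.

(** Fatou's lemma turns the pointwise convergence of the Poisson averages into
    a lower bound for the integrals of the mollified function. *)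
Lemma liminf_smooth e eta : 0 < e -> 0 < eta ->
  exists N, forall n, (N <= n)%N ->
    smooth phi (1 + e) 0 - eta <= \int[nu n]_x smooth phi e x.
Proof.
move=> e0 eta0; have e1 : 0 < 1 + e by lra.
pose u n := (\int[leb]_t (phi t * \int[nu n]_x poisson e (t - x))%:E)%E.
have uE n : u n = (\int[nu n]_x smooth phi e x)%:E.
  rewrite /u -fubini_smooth// /Rintegral fineK//; apply: integrable_fin_num => //.
  by apply: (bounded_integrable _ (measurable_smooth e0)); exact: smooth_leC.
have mg n : measurable_fun setT (fun t : R => \int[nu n]_x poisson e (t - x)).
  apply/measurable_EFinP.
  pose f := fun z : measurableTypeR R * measurableTypeR R => (poisson e (z.1 - z.2))%:E.
  have mf : measurable_fun setT f.
    apply/measurable_EFinP; apply: (measurableT_comp (continuous_mfun (continuous_poisson e0))).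
    by apply: measurable_funB; [exact: measurable_fst|exact: measurable_snd].
  have := @measurable_fun_fubini_tonelli_F _ _ _ _ _ (nu n) f mf
    (fun z => ltW (poisson_gt0 _ e0)).
  apply: eq_measurable_fun => t _; rewrite /fubini_F /f/= /Rintegral fineK//.
  apply: integrable_fin_num => //.
  apply: (@bounded_integrable _ _ _ ((pi * e)^-1)).
    apply: (measurableT_comp (continuous_mfun (continuous_poisson e0))).
    by apply: measurable_funB; [exact: measurable_cst|exact: measurable_id].
  by move=> x; rewrite ger0_norm ?poisson_le// ltW// poisson_gt0.
have := @fatou _ _ _ leb setT measurableT
  (fun n t => (phi t * \int[nu n]_x poisson e (t - x))%:E)%R.
move=> /(_ (fun n => proj2 (measurable_EFinP _ _) (measurable_funM mphi (mg n)))).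
have g0 n t : 0 <= \int[nu n]_x poisson e (t - x).
  by apply: Rintegral_ge0 => x _; rewrite ltW// poisson_gt0.
move=> /(_ ltac:(by move=> n t _; rewrite lee_fin mulr_ge0)).
have -> : (\int[leb]_(t in setT) limn_einf (fun n => (phi t * \int[nu n]_x poisson e (t - x))%:E)
   = (smooth phi (1 + e) 0)%:E)%E.
  rewrite smoothE//; apply: eq_integral => t _; rewrite subr0.
  have H : (phi t * \int[nu n]_x poisson e (t - x))%:E @[n --> \oo] --> (phi t * poisson (1 + e) t)%:E.
    apply/fine_cvgP; split; first exact: nearW.
    by apply: cvgM; [exact: cvg_cst|exact: nu_poisson].
  by have [-> _] := cvg_limn_einf_sup H.
move=> H.
have : ((smooth phi (1 + e) 0 - eta)%:E < limn_einf u)%E.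
  by apply: lt_le_trans H; rewrite lte_fin gtrBl.
move=> /limn_einf_gt[N HN]; exists N => n /HN; rewrite uE lte_fin; exact: ltW.
Qed.

(** Replacing [phi] by [smooth phi e] changes both integrals by a uniformly
    small amount. *)
Lemma liminf_lipschitz eta : 0 < eta -> exists N, forall n, (N <= n)%N ->
  \int[cauchy01]_x phi x - eta <= \int[nu n]_x phi x.
Proof.
move=> eta0; have eta3 : 0 < eta / 3 by lra.
have [e [e0 we]] := modulus_small k0 C0 eta3.
have [N HN] := liminf_smooth e0 eta3.
exists N => n /HN.
have bphi := phi_norm phi_ge0 phi_leC.
have E1 : \int[cauchy01]_x phi x = smooth phi 1 0.
  rewrite (Rintegral_cauchy01 mphi bphi) /smooth.
  by apply: eq_Rintegral => u _; rewrite mul1r add0r.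
have h1 : `|smooth phi 1 0 - smooth phi (1 + e) 0| <= eta / 3.
  apply: le_trans (smooth_dist k0 C0 phi_ge0 phi_leC phi_lip (ltW e0) _) we => u.
  rewrite (_ : _ - _ = - (e * u)); last by ring.
  by rewrite normrN normrM (gtr0_norm e0).
have h2 x : smooth phi e x <= phi x + eta / 3.
  rewrite -lerBlDl -{1}[phi x]smooth0.
  apply: le_trans (ler_norm _) _.
  apply: le_trans (smooth_dist k0 C0 phi_ge0 phi_leC phi_lip (ltW e0) _) we => u.
  rewrite (_ : _ - _ = e * u); last by ring.
  by rewrite normrM (gtr0_norm e0).
have i1 := bounded_integrable (nu n) (measurable_smooth e0) (fun x => smooth_leC e x).
have i2 := bounded_integrable (nu n) mphi bphi.
have ic : (nu n).-integrable setT (EFin \o cst (eta / 3)).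
  by apply: (@bounded_integrable _ _ _ `|eta / 3|) => //; exact: measurable_cst.
have h3 : \int[nu n]_x smooth phi e x <= \int[nu n]_x (phi x + eta / 3).
  apply: le_Rintegral => //.
  exact: (integrableD measurableT i2 ic).
have h4 : \int[nu n]_x (phi x + eta / 3) = \int[nu n]_x phi x + eta / 3.
  by rewrite RintegralD// Rintegral_prob_cst.
rewrite E1; move: h1 h3 h4; rewrite ler_norml => /andP[_ h1] h3 h4 h5.
move: h3; rewrite h4; move: h1 h5 => {E1}.
move: (\int[nu n]_x phi x) (\int[nu n]_x smooth phi e x) => a b.
lra.
Qed.

End lipschitz.

Section inf_convolution.
Variables (phi : R -> R) (C : R).
Hypothesis cphi : continuous phi.
Hypothesis phi_ge0 : forall x, 0 <= phi x.
Hypothesis phi_leC : forall x, phi x <= C.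

(** The largest minorant of [phi] with Lipschitz constant [k]. *)
Definition infconv (k x : R) : R := inf [set phi y + k * `|x - y| | y in [set: R]].

Lemma infconv_lb k x : 0 <= k -> lbound [set phi y + k * `|x - y| | y in [set: R]] 0.
Proof. by move=> k0 _ [y _ <-]; rewrite addr_ge0// mulr_ge0. Qed.

Lemma infconv_nonempty k x : [set phi y + k * `|x - y| | y in [set: R]] !=set0.
Proof. by exists (phi x + k * `|x - x|); exists x. Qed.

Lemma infconv_ge k x c : (forall y, c <= phi y + k * `|x - y|) -> c <= infconv k x.
Proof.
by move=> H; apply: lb_le_inf; [exact: infconv_nonempty|move=> _ [y _ <-]].
Qed.

Lemma infconv_le k x y : 0 <= k -> infconv k x <= phi y + k * `|x - y|.
Proof.
by move=> k0; apply: ge_inf; [exists 0; exact: infconv_lb|exists y].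
Qed.

Lemma infconv_ge0 k x : 0 <= k -> 0 <= infconv k x.
Proof. by move=> k0; apply: infconv_ge => y; rewrite addr_ge0// mulr_ge0. Qed.

Lemma infconv_le_phi k x : 0 <= k -> infconv k x <= phi x.
Proof. by move=> k0; have := infconv_le x x k0; rewrite subrr normr0 mulr0 addr0. Qed.

Lemma infconv_leC k x : 0 <= k -> infconv k x <= C.
Proof. by move=> k0; apply: le_trans (phi_leC x); exact: infconv_le_phi. Qed.

Lemma infconv_lip k x y : 0 <= k -> `|infconv k x - infconv k y| <= k * `|x - y|.
Proof.
move=> k0; have H a b : infconv k a - infconv k b <= k * `|a - b|.
  rewrite lerBlDl -lerBlDr; apply: infconv_ge => z.
  rewrite lerBlDr; apply: le_trans (infconv_le a z k0) _.
  rewrite -addrA lerD2l -mulrDr ler_wpM2l//.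
  by rewrite (_ : a - z = (b - z) + (a - b)) ?ler_normD//; ring.
by rewrite ler_norml H andbT lerNl opprB distrC H.
Qed.

Lemma infconv_cvg x : infconv n%:R x @[n --> \oo] --> phi x.
Proof.
apply/cvgrPdist_le => /= e e0.
have cx : phi y @[y --> x] --> phi x by exact: cphi.
have /cvgrPdist_lt/(_ _ e0)/nbhs_ballP := cx.
move=> [d /= d0 H].
near=> n; have n0 : 0 <= n%:R :> R by [].
rewrite ger0_norm ?subr_ge0 ?infconv_le_phi// lerBlDl -lerBlDr.
(* Near points are controlled by the continuity of [phi], far points by the
   penalty, which is at least [C]. *)
apply: infconv_ge => y; have [xy|xy] := ltP `|x - y| d.
  have := H y xy; rewrite /= ltr_norml => /andP[_ h].
  rewrite lerBlDr; have : (0 : R) <= n%:R * `|x - y| by rewrite mulr_ge0.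
  by move: h; move: (phi x) (phi y) (n%:R * _) => a b c; lra.
have nC : C <= n%:R * `|x - y|.
  apply: (@le_trans _ _ (n%:R * d)); last by rewrite ler_wpM2l.
  rewrite -ler_pdivrMr//; near: n; exact: nbhs_infty_ger.
have := phi_leC x; have := phi_ge0 y.
by move: nC; move: (phi x) (phi y) (n%:R * _) => a b c; lra.
Unshelve. all: by end_near. Qed.

Let C0 : 0 <= C := le_trans (phi_ge0 0) (phi_leC 0).

(** The Lipschitz minorants [infconv n] increase to [phi], and a lower bound is
    stable under passing to minorants. *)
Lemma liminf_nonneg eta : 0 < eta -> exists N, forall n, (N <= n)%N ->
  \int[cauchy01]_x phi x - eta <= \int[nu n]_x phi x.
Proof.
move=> eta0; have eta2 : 0 < eta / 2 by lra.
have mphi := continuous_mfun cphi.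
have bphi := phi_norm phi_ge0 phi_leC.
have mic (k : nat) : measurable_fun setT (infconv k%:R).
  exact: continuous_mfun (lip_continuous (ler0n _ k) (fun x y => infconv_lip x y (ler0n _ k))).
have bic (k : nat) x : `|infconv k%:R x| <= C.
  by rewrite ger0_norm ?infconv_ge0// infconv_leC.
have cv : (fine \o (fun k : nat => \int[cauchy01]_x (infconv k%:R x)%:E)%E) @ \oo -->
    fine (\int[cauchy01]_x (phi x)%:E)%E.
  have fin : (\int[cauchy01]_x (phi x)%:E)%E \is a fin_num.
    by apply: integrable_fin_num => //; exact: (bounded_integrable _ mphi bphi).
  apply: fine_cvg; rewrite fineK//.
  apply: (@dominated_cvg _ _ _ cauchy01 setT measurableT
     (fun k x => (infconv k%:R x)%:E) (fun x => (phi x)%:E) (cst C%:E)).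
  - by move=> k; apply/measurable_EFinP; exact: mic.
  - by move=> x _; apply/fine_cvgP; split; [exact: nearW|exact: infconv_cvg].
  - by [].
  - by apply: (@bounded_integrable _ _ (cst C) C) => [|x]; [exact: measurable_cst|rewrite ger0_norm].
  - by move=> k x _; rewrite lee_fin.
have /cvgrPdist_le/(_ _ eta2)[k _ /(_ k (leqnn k))/= Hk] := cv.
have [N HN] := @liminf_lipschitz (infconv k%:R) k%:R C (ler0n _ k) C0
  (fun x => infconv_ge0 x (ler0n _ k)) (fun x => infconv_leC x (ler0n _ k))
  (fun x y => infconv_lip x y (ler0n _ k)) _ eta2.
exists N => n /HN.
have : \int[nu n]_x infconv k%:R x <= \int[nu n]_x phi x.
  apply: le_Rintegral => //.
  - exact: (bounded_integrable _ (mic k) (bic k)).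
  - exact: (bounded_integrable _ mphi bphi).
  - by move=> x _; exact: infconv_le_phi.
move: Hk; rewrite -/(Rintegral cauchy01 setT phi) -/(Rintegral cauchy01 setT (infconv k%:R)).
rewrite ler_norml => /andP[_].
move: (Rintegral cauchy01 _ _) (Rintegral cauchy01 _ _) (Rintegral (nu n) _ _) (Rintegral (nu n) _ _).
by move=> a b c d0; lra.
Qed.

End inf_convolution.

(** Applying the one-sided bound to [C + phi] and to [C - phi] gives both
    inequalities. *)
Lemma cauchy_weak_limit (phi : R -> R) (C : R) : continuous phi ->
  (forall x, `|phi x| <= C) ->
  \int[nu n]_x phi x @[n --> \oo] --> \int[cauchy01]_x phi x.
Proof.
move=> cphi bphi; apply/cvgrPdist_le => e e0.
have mphi := continuous_mfun cphi.
have c1 : continuous (fun x => C + phi x) by move=> x; apply: cvgD; [exact: cvg_cst|exact: cphi].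
have c2 : continuous (fun x => C - phi x) by move=> x; apply: cvgB; [exact: cvg_cst|exact: cphi].
have h1 x : 0 <= C + phi x by have := bphi x; rewrite ler_norml => /andP[]; lra.
have h2 x : 0 <= C - phi x by have := bphi x; rewrite ler_norml => /andP[]; lra.
have h3 x : C + phi x <= 2 * C by have := bphi x; rewrite ler_norml => /andP[]; lra.
have h4 x : C - phi x <= 2 * C by have := bphi x; rewrite ler_norml => /andP[]; lra.
have iC (m : probability (measurableTypeR R) R) : m.-integrable setT (EFin \o cst C).
  by apply: (@bounded_integrable _ _ _ `|C|) => //; exact: measurable_cst.
have ip (m : probability (measurableTypeR R) R) := bounded_integrable m mphi bphi.
have e1 (m : probability (measurableTypeR R) R) :
    \int[m]_x (C + phi x) = C + \int[m]_x phi x.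
  exact: eq_trans (RintegralD measurableT (iC m) (ip m)) (congr1 (+%R^~ _) (Rintegral_prob_cst m C)).
have e2 (m : probability (measurableTypeR R) R) :
    \int[m]_x (C - phi x) = C - \int[m]_x phi x.
  exact: eq_trans (RintegralB measurableT (iC m) (ip m)) (congr1 (+%R^~ _) (Rintegral_prob_cst m C)).
have [N1 HN1] := liminf_nonneg c1 h1 h3 e0.
have [N2 HN2] := liminf_nonneg c2 h2 h4 e0.
exists (maxn N1 N2) => // n /=; rewrite geq_max => /andP[/HN1 + /HN2].
rewrite !e1 !e2 ler_norml => {HN1 HN2}.
move: (Rintegral cauchy01 _ _) (Rintegral (nu n) _ _) => a b *.
by apply/andP; split; lra.
Qed.

End weak_convergence.

(** * Empirical law of the transform *)

Section raw_integral.
Context d (T : measurableType d) (R : realType).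

Import HBNNSimple.

(** The empirical measure is a bare set function; its integral depends on its
    values on measurable sets only. *)
Lemma eq_set_integral (m1 m2 : set T -> \bar R) (f : T -> \bar R) :
  (forall A, measurable A -> m1 A = m2 A) ->
  (\int[m1]_x f x = \int[m2]_x f x)%E.
Proof.
move=> E; rewrite /integral.
have S (h : {nnsfun T >-> R}) : sintegral m1 h = sintegral m2 h.
  by apply: eq_fsbigr => r _; rewrite E.
by congr (ereal_sup _ - ereal_sup _)%E; apply/seteqP; split=> _ [h hf <-];
  exists h => //=; rewrite S.
Qed.

End raw_integral.

Lemma fineZ (R : realType) (k : R) (x : \bar R) : 0 < k -> fine (k%:E * x) = k * fine x.
Proof.
move=> k0; case: x => [r//||]; first by rewrite gt0_muley ?lte_fin//= mulr0.
by rewrite gt0_muleNy ?lte_fin//= mulr0.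
Qed.

Section empirical_law.
Context {R : realType}.
Local Notation leb := (@lebesgue_measure R).
Implicit Types f : R -> R.

(** Carries the proof of measurability, so that the image law under [f] is a
    probability measure by inference. *)
Definition as_mfun f (mf : measurable_fun setT f) :
  measurableTypeR R -> measurableTypeR R := f.

HB.instance Definition _ f (mf : measurable_fun setT f) :=
  isMeasurableFun.Build _ _ _ _ (as_mfun mf) mf.

(** The maximum with 1 makes the window nondegenerate for every [L], so that
    the law below is a probability for all [L]. *)
Lemma half_lt (L : R) : - (Num.max L 1 / 2) < Num.max L 1 / 2.
Proof.
have : 0 < Num.max L 1 by rewrite lt_max ltr01 orbT.
by move: (Num.max L 1) => l; lra.
Qed.

(** The empirical measure as a genuine probability: the image of the uniform
    law of the window. *)
Definition empirical_law f (mf : measurable_fun setT f) (L : R) :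
    probability (measurableTypeR R) R :=
  distribution (uniform_prob (half_lt L)) (as_mfun mf).

Lemma integral_empirical_law f (mf : measurable_fun setT f) (L : R)
    (phi : R -> \bar R) : 1 <= L -> measurable_fun setT phi ->
  (forall x, 0 <= phi x)%E ->
  (\int[empirical_law mf L]_x phi x =
   (L^-1)%:E * \int[leb]_(s in `[(- (L / 2))%R, (L / 2)%R]) phi (f s))%E.
Proof.
move=> L1 mphi phi0; rewrite ge0_integral_distribution//.
rewrite integral_uniform; last 2 first.
- exact: (measurableT_comp mphi mf).
- by move=> x; exact: phi0.
rewrite (_ : Num.max L 1 = L); last by apply/max_idPl.
congr (_%:E * _)%E; congr (_^-1).
by rewrite opprK -splitr.
Qed.

Lemma empirical_lawE f (mf : measurable_fun setT f) (L : R) B :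
  1 <= L -> measurable B -> empirical_measure f L B = empirical_law mf L B.
Proof.
move=> L1 mB; rewrite -[B in RHS]setIT -integral_indic//.
by rewrite integral_empirical_law//; apply/measurable_EFinP; exact: measurable_indic.
Qed.

Lemma integral_empirical_measure f (mf : measurable_fun setT f) (L : R) phi :
  1 <= L -> (\int[empirical_measure f L]_x phi x = \int[empirical_law mf L]_x phi x)%E.
Proof. by move=> L1; apply: eq_set_integral => B mB; exact: empirical_lawE. Qed.

(** Convergence along a real parameter is tested on sequences. *)
Lemma weak_cvg_cauchy f (mf : measurable_fun setT f) :
  (forall t e : R, 0 < e ->
    (L^-1 * \int[leb]_(s in `[(- (L / 2)), (L / 2)]) poisson e (t - f s)) @[L --> +oo]
      --> poisson (1 + e) t) ->
  weak_cvg (empirical_measure f) cauchy01.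
Proof.
move=> H phi cphi [C bphi].
have mphi := continuous_mfun cphi.
have fin (m : probability (measurableTypeR R) R) : (\int[m]_x (phi x)%:E)%E \is a fin_num.
  by apply: integrable_fin_num => //; exact: (bounded_integrable _ mphi bphi).
rewrite -[X in _ --> X]fineK//; apply/fine_cvgP; split.
  near=> L; have L1 : 1 <= L by near: L; exact: nbhs_pinfty_ge.
  by rewrite (integral_empirical_measure mf).
apply/cvg_pinftyP => u uy.
have u1 : \forall n \near \oo, 1 <= u n by move/cvgryPge : uy; exact.
have := @cauchy_weak_limit R (fun n => empirical_law mf (u n)).
move=> /(_ _ phi C cphi bphi) X.
apply: cvg_trans (X _); last first.
  move=> t e e0.
  have /cvg_pinftyP/(_ u uy) := H t e e0.
  apply: cvg_trans; apply: near_eq_cvg; near=> n.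
  have un : 1 <= u n by near: n.
  have mpk : measurable_fun setT (fun x : R => poisson e (t - x)).
    apply: (measurableT_comp (continuous_mfun (continuous_poisson e0))).
    by apply: measurable_funB; [exact: measurable_cst|exact: measurable_id].
  rewrite /= /Rintegral integral_empirical_law//.
  - by rewrite fineZ// invr_gt0; apply: lt_le_trans un.
  - exact/measurable_EFinP.
  - by move=> x; rewrite lee_fin ltW// poisson_gt0.
apply: near_eq_cvg; near=> n; rewrite /=.
by rewrite (integral_empirical_measure mf)//; near: n.
Unshelve. all: by end_near. Qed.

End empirical_law.

Section spatial_law_of_transform.
Context {R : realType} (mu : wpm R) (K : R).
Hypothesis K0 : 0 < K.
Hypothesis mu_summable : summable_disc mu K.
Local Notation leb := (@lebesgue_measure R).

Lemma piK_gt0 : 0 < pi * K.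
Proof. by rewrite mulr_gt0// pi_gt0. Qed.

(** Scaling of the Poisson kernel by [pi K]; the factor [K] is the one that
    [average_resolvent] produces in the limit. *)
Lemma poisson_normalized t e x : 0 < e ->
  poisson e (t - x / (pi * K)) =
    K * ((e * (pi * K)) / ((- (t * (pi * K)) + x) ^+ 2 + (e * (pi * K)) ^+ 2)).
Proof.
move=> e0; rewrite /poisson; have := pi_gt0 R; have := K0.
move: (@pi R) => p k0 p0.
have D1 : 0 < (- (t * (p * K)) + x) ^+ 2 + (e * (p * K)) ^+ 2.
  by rewrite ltr_wpDl ?sqr_ge0// exprn_gt0// !mulr_gt0.
have E : (t - x / (p * K)) ^+ 2 + e ^+ 2 =
   ((- (t * (p * K)) + x) ^+ 2 + (e * (p * K)) ^+ 2) / (p * K) ^+ 2.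
  by field; rewrite !gt_eqF.
rewrite E; move: D1; move: (_ + _) => D D1.
by field; rewrite !gt_eqF.
Qed.

(** The support is a Lebesgue null set, so the values at the atoms do not
    matter. *)
Lemma poisson_average f : atom_version mu f -> forall t e : R, 0 < e ->
  (L^-1 * \int[leb]_(s in `[(- (L / 2)), (L / 2)]) poisson e (t - f s / (pi * K))) @[L --> +oo]
      --> poisson (1 + e) t.
Proof.
move=> fv t e e0; have pK := piK_gt0.
have ep0 : 0 < e * (pi * K) by rewrite mulr_gt0.
have mf := measurable_atom_version K0 mu_summable fv.
have := average_resolvent K0 mu_summable (t := - (t * (pi * K))) ep0.
move=> /(cvgM (cvg_cst K)); set l := (X in _ --> X) => H.
have -> : poisson (1 + e) t = l.
  rewrite /l /poisson; have := pi_gt0 R; have := K0; move: (@pi R) => p k0 p0.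
  have D1 : 0 < t ^+ 2 + (1 + e) ^+ 2 by rewrite ltr_wpDl ?sqr_ge0// exprn_gt0//; lra.
  have -> : (- (t * (p * K))) ^+ 2 + (e * (p * K) + p * K) ^+ 2 =
    (p * K) ^+ 2 * (t ^+ 2 + (1 + e) ^+ 2) by ring.
  by move: D1; move: (t ^+ 2 + _) => D D1; field; rewrite !gt_eqF.
apply: cvg_trans H; apply: near_eq_cvg; near=> L.
rewrite /cst [LHS](mulrCA K); congr (L^-1 * _); apply/esym.
have mA (a b : R) : measurable (`[a, b] : set R) by [].
set I : set R := `[- (L / 2), L / 2]%classic.
have E : \int[leb]_(s in I) poisson e (t - f s / (pi * K)) =
    \int[leb]_(s in I) (K * resolvent_im mu (- (t * (pi * K))) (e * (pi * K)) 0 s).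
  rewrite /Rintegral; congr fine; apply: ae_eq_integral.
  - exact: mA.
  - apply: measurable_funTS; apply/measurable_EFinP.
    apply: (measurableT_comp (continuous_mfun (continuous_poisson e0))).
    by apply: measurable_funB => //; exact: measurable_funM.
  - apply: measurable_funTS; apply/measurable_EFinP; apply: measurable_funM => //.
    exact: (measurable_resolvent_im0 K0 mu_summable).
  - exists (supp mu); split; [exact: measurable_supp|exact: lebesgue_supp|].
    move=> s /= nE; apply: contrapT => ns; apply: nE => _; congr EFin.
    by rewrite poisson_normalized// (resolvent_im0E K0 mu_summable) fv.
rewrite E {E} /Rintegral -fineZ//; congr fine.
transitivity (\int[leb]_(s in I) (K%:E * (resolvent_im mu (- (t * (pi * K))) (e * (pi * K)) 0 s)%:E))%E.
  by apply: eq_integral => s _; rewrite EFinM.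
apply: ge0_integralZl.
- exact: mA.
- by apply: measurable_funTS; apply/measurable_EFinP; exact: (measurable_resolvent_im0 K0 mu_summable).
- by move=> s _; rewrite lee_fin (resolvent_im0E K0 mu_summable) divr_ge0 ?addr_ge0 ?sqr_ge0// ltW.
- by rewrite lee_fin ltW.
Unshelve. all: by end_near. Qed.

Lemma spatial_law_normalized f : atom_version mu f ->
  has_spatial_law (fun s => f s / (pi * K)) cauchy01.
Proof.
move=> fv; have mf := measurable_atom_version K0 mu_summable fv.
have mg : measurable_fun setT (fun s => f s / (pi * K)) by exact: measurable_funM.
by split=> //; apply: weak_cvg_cauchy => //; exact: poisson_average.
Qed.

End spatial_law_of_transform.

Section dilation.
Context {R : realType} (c : R).

Lemma measurable_dilation : measurable_fun setT (fun x : R => c * x).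
Proof. by apply: measurable_funM => //; exact: measurable_cst. Qed.

(** The spatial law of the transform before normalization. *)
Definition dilated_cauchy : probability (measurableTypeR R) R :=
  distribution cauchy01 (as_mfun measurable_dilation).

Lemma has_spatial_law_dilated f : c != 0 ->
  has_spatial_law (fun s => f s / c) cauchy01 -> has_spatial_law f dilated_cauchy.
Proof.
move=> c0 [mg wg].
have fE : f = (fun s => c * (f s / c)) by apply/funext => s; rewrite mulrC divfK.
have mf : measurable_fun setT f.
  by rewrite fE; apply: measurable_funM => //; exact: measurable_cst.
split=> // phi cphi [C bphi].
have mphi := continuous_mfun cphi.
have cphic : continuous (fun x => phi (c * x)).
  move=> x; apply: (continuous_comp (f := fun x => c * x) (g := phi)); last exact: cphi.
  by apply: cvgM; [exact: cvg_cst|exact: cvg_id].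
have /(_ _ cphic) := wg; move=> /(_ (ex_intro _ C (fun x => bphi _))) H.
have dist (m : probability (measurableTypeR R) R) :
    (\int[distribution m (as_mfun measurable_dilation)]_x (phi x)%:E =
     \int[m]_x (phi (c * x))%:E)%E.
  rewrite integral_distribution//; first exact/measurable_EFinP.
  exact: (@bounded_integrable _ m (fun x => phi (c * x)) C (continuous_mfun cphic) (fun x => bphi _)).
rewrite dist; apply: cvg_trans H; apply: near_eq_cvg; near=> L.
have L1 : 1 <= L by near: L; exact: nbhs_pinfty_ge.
rewrite (integral_empirical_measure mf)// (integral_empirical_measure mg)// -dist.
apply: eq_measure_integral => B mB _.
rewrite /= /distribution/= /pushforward/=.
by congr (uniform_prob _ _); rewrite /preimage /as_mfun; apply/seteqP; split=> s /=; rewrite (mulrC c) divfK.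
Unshelve. all: by end_near. Qed.

End dilation.

(** * Measurability of integrals against a random measure *)

Section saturation.
Context {R : realType}.

(** For [h >= 0] continuous, these increase with [n] to the indicator of the
    open set where [h] is positive. They approximate intervals and rays by
    bounded continuous functions. *)
Definition saturate (h : R -> R) (n : nat) (x : R) : R := 1 - (1 + n%:R * h x)^-1.

Variable h : R -> R.
Hypothesis h_ge0 : forall x, 0 <= h x.

Let den_ge1 n x : 1 <= 1 + n%:R * h x.
Proof. by rewrite lerDl mulr_ge0. Qed.

Let den_gt0 n x : 0 < 1 + n%:R * h x.
Proof. by apply: lt_le_trans (den_ge1 n x). Qed.

Lemma saturate_ge0 n x : 0 <= saturate h n x.
Proof. by rewrite subr_ge0 invf_le1. Qed.

Lemma saturate_le1 n x : saturate h n x <= 1.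
Proof. by rewrite lerBlDr lerDl invr_ge0 ltW. Qed.

Lemma saturate0 n x : h x = 0 -> saturate h n x = 0.
Proof. by rewrite /saturate => ->; rewrite mulr0 addr0 invr1 subrr. Qed.

Lemma saturate_nd x : {homo (fun n => saturate h n x) : n m / (n <= m)%N >-> n <= m}.
Proof.
move=> n m nm; rewrite lerD2l lerN2 lef_pV2 ?posrE// lerD2l ler_wpM2r//.
by rewrite ler_nat.
Qed.

Lemma saturate_cvg x : saturate h n x @[n --> \oo] --> (\1_[set y | 0 < h y] x : R).
Proof.
rewrite indicE; have [hx|] := ltP 0 (h x); last first.
  move=> hx; have h0 : h x = 0 by apply/le_anti; rewrite hx h_ge0.
  rewrite memNset /=; last by rewrite h0 ltxx.
  by under eq_fun do rewrite saturate0//; exact: cvg_cst.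
rewrite mem_set//=; apply/cvgrPdist_le => e e0; near=> n.
rewrite /saturate opprB addrCA subrr addr0 ger0_norm ?invr_ge0 ?ltW//.
rewrite -[ltRHS]invrK ltf_pV2 ?posrE ?invr_gt0//.
apply: (@le_lt_trans _ _ (n%:R * h x)); last by rewrite ltrDr.
rewrite -ler_pdivrMr//; near: n; exact: nbhs_infty_ger.
Unshelve. all: by end_near. Qed.

Lemma continuous_saturate n : continuous h -> continuous (saturate h n).
Proof.
move=> ch x; apply: cvgB; first exact: cvg_cst.
apply: cvgV; first by rewrite gt_eqF.
apply: cvgD; first exact: cvg_cst.
by apply: cvgM; [exact: cvg_cst|exact: ch].
Qed.

Lemma saturate_integral_cvg (mu : {measure set (measurableTypeR R) -> \bar R}) : continuous h ->
  (\int[mu]_x (saturate h n x)%:E @[n --> \oo] --> mu [set y : R | (0 < h y)%R])%E.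
Proof.
move=> ch; have mh := continuous_mfun ch.
have mU : @measurable _ (measurableTypeR R) [set y : R | 0 < h y].
  rewrite (_ : mkset _ = h @^-1` `]0, +oo[); last by apply/seteqP; split=> x /=; rewrite in_itv/= andbT.
  by rewrite -[X in measurable X]setTI; exact: mh.
rewrite -[X in mu X]setIT -integral_indic//.
rewrite (_ : (\int[mu]_x (\1__ x)%:E)%E =
  (\int[mu]_x limn (fun n => (saturate h n x)%:E))%E); last first.
  apply: eq_integral => x _; apply/esym/cvg_lim => //.
  by apply/fine_cvgP; split; [exact: nearW|exact: saturate_cvg].
apply: (@cvg_monotone_convergence _ _ _ mu setT _ (fun n x => (saturate h n x)%:E)) => //.
- by move=> n; apply/measurable_EFinP; exact: continuous_mfun (continuous_saturate ch).
- by move=> n x _; rewrite lee_fin saturate_ge0.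
- by move=> x _ n m nm; rewrite lee_fin saturate_nd.
Qed.

End saturation.

Section vague_measurability.
Context {R : realType}.

(** A test function is a coordinate of the map that defines the vague
    topology. *)
Lemma measurable_vague (f : R -> R) : continuous f -> compact (closure [set x | f x != 0]) ->
  measurable_fun setT (fun mu : wpm R => \int[mu]_x f x).
Proof.
move=> cf kf; pose F : test_function R := exist _ f (conj cf kf).
have cF : continuous (fun mu : wpm R => \int[mu]_x f x).
  have -> : (fun mu : wpm R => \int[mu]_x f x) = (fun g => g F) \o (@vague_eval R) by [].
  move=> mu; apply: (@continuous_comp (initial_topology (@vague_eval R))
    (prod_topology (fun _ : test_function R => R)) R).
    exact: (@initial_continuous _ _ (@vague_eval R) mu).
  pose I : eqType := HB.pack (test_function R) (gen_eqMixin (test_function R)).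
  exact: (@proj_continuous I (fun _ => (R : topologicalType)) F (vague_eval mu)).
apply: (measurability _ (RGenOInfty.measurableE R)) => _ [_ [a ->] <-].
rewrite setTI; apply: sub_sigma_algebra; move/continuousP : cF; apply.
by rewrite set_itvE; exact: open_gt.
Qed.

Lemma measurable_open_itv (a b : R) :
  measurable_fun setT (fun mu : wpm R => mu `]a, b[%classic).
Proof.
have [ba|ab] := leP b a.
  rewrite (_ : (fun mu : wpm R => _) = cst 0%E) //; apply/funext => mu.
  by rewrite set_itv_ge ?measure0// bnd_simp -leNgt.
(* [h] is positive exactly inside the interval. *)
pose g (x : R) := (x - a) * (b - x); pose h x := g x + `|g x|.
have cg : continuous g.
  move=> x; apply: cvgM; first by apply: cvgB; [exact: cvg_id|exact: cvg_cst].
  by apply: cvgB; [exact: cvg_cst|exact: cvg_id].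
have ch : continuous h.
  by move=> x; apply: cvgD; [exact: cg|apply: cvg_norm; exact: cg].
have h0 x : 0 <= h x by rewrite /h; have := ler_norm (- g x); rewrite normrN; lra.
have hE : [set y | 0 < h y] = `]a, b[%classic.
  apply/seteqP; split=> x /=; rewrite in_itv/= /h /g.
    have [g0|g0] := leP 0 ((x - a) * (b - x)); last by rewrite ltr0_norm// subrr ltxx.
    by rewrite (ger0_norm g0) => g1; apply/andP; split; nra.
  move=> /andP[ax xb]; have g0 : 0 < (x - a) * (b - x) by rewrite mulr_gt0// subr_gt0.
  by rewrite (gtr0_norm g0) addr_gt0.
rewrite -hE.
have supp_h n : [set x | saturate h n x != 0] `<=` `[a, b].
  move=> x /= nz; have : `]a, b[%classic x.
    rewrite -hE /= lt_neqAle h0 andbT eq_sym; apply: contra nz => /eqP hx.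
    by rewrite saturate0.
  by rewrite /= !in_itv/= => /andP[/ltW -> /ltW ->].
have ks n : compact (closure [set x | saturate h n x != 0]).
  apply: (subclosed_compact _ (@segment_compact R a b)); first exact: closed_closure.
  have /closure_id -> : closed (`[a, b] : set R) by exact: interval_closed.
  exact: closureS.
have fin (mu : wpm R) n : (\int[mu]_x (saturate h n x)%:E)%E \is a fin_num.
  rewrite ge0_fin_numE; last by apply: integral_ge0 => x _; rewrite lee_fin saturate_ge0.
  apply: (@le_lt_trans _ _ (mu (`[a, b]%classic : set R))); last first.
    apply: (@wpm_bounded_fin _ mu (`|a| + `|b|)) => // x; rewrite /= !in_itv/= => /andP[ax xb].
    have := ler_norm (- a); have := ler_norm b; have := normr_ge0 a; have := normr_ge0 b.
    rewrite normrN; move: (`|a|) (`|b|) => u v *; apply/andP; split; lra.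
  rewrite -[X in mu X]setIT -integral_indic//.
  apply: ge0_le_integral => //.
  - by move=> x _; rewrite lee_fin saturate_ge0.
  - by apply/measurable_EFinP; exact: continuous_mfun (continuous_saturate h0 ch).
  - by apply/measurable_EFinP; exact: measurable_indic.
  - move=> x _; rewrite lee_fin indicE.
    have [->|nz] := eqVneq (saturate h n x) 0; first by [].
    by rewrite mem_set ?saturate_le1//; exact: supp_h nz.
apply: (@emeasurable_fun_cvg _ _ _ _ (fun n (mu : wpm R) => (\int[mu]_x saturate h n x)%:E)).
  move=> n; apply/measurable_EFinP; apply: measurable_vague => //.
  exact: continuous_saturate.
move=> mu _; have := @saturate_integral_cvg _ h h0 mu ch.
apply: cvg_trans; apply: near_eq_cvg; near=> n; by rewrite /Rintegral fineK.
Unshelve. all: by end_near. Qed.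

End vague_measurability.

Section kernel_measurability.
Context {R : realType}.
Local Notation W n := (`](- n%:R), n%:R[%classic : set R).

Lemma window_sub n m : (n <= m)%N -> W n `<=` W m.
Proof.
move=> nm x /=; rewrite !in_itv/= => /andP[nx xn].
have nmR : n%:R <= m%:R :> R by rewrite ler_nat.
by rewrite (le_lt_trans _ nx) ?lerN2// (lt_le_trans xn).
Qed.

Lemma bigcup_window : \bigcup_n W n = [set: R].
Proof.
rewrite -subTset => x _.
exists (Num.bound `|x|) => //=; rewrite in_itv/= -ltr_norml.
exact: archi_boundP (normr_ge0 x).
Qed.

Lemma window_fin (mu : wpm R) n (B : set (measurableTypeR R)) : measurable B ->
  B `<=` W n -> (mu B < +oo)%E.
Proof.
move=> mB BW; apply: (@wpm_bounded_fin _ mu n%:R) => // x /BW /=.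
by rewrite !in_itv/= => /andP[/ltW -> /ltW ->].
Qed.

(** Restricting to a bounded window keeps the masses finite, so that
    complements can be taken in the induction. *)
Lemma measurable_eval_window n (B : set (measurableTypeR R)) : measurable B ->
  measurable_fun setT (fun mu : wpm R => mu (B `&` W n)).
Proof.
have mW : @measurable _ (measurableTypeR R) (W n) by [].
rewrite /= (RGenOInfty.measurableE R); move: B.
apply: (dynkin_induction (T := measurableTypeR R)).
- exact: RGenOInfty.measurableE.
- move=> _ _ [a ->] [b ->]; exists (Num.max a b).
  by apply/seteqP; split=> x /=; rewrite !in_itv/= !andbT gt_max; [move=> [-> ->]|move=> /andP[]].
- by under eq_fun do rewrite setTI; exact: measurable_open_itv.
- move=> _ [a ->]; rewrite (_ : _ `&` _ = `](Num.max a (- n%:R)), n%:R[%classic).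
    exact: measurable_open_itv.
  by apply/seteqP; split=> x /=; rewrite !in_itv/= andbT gt_max; [move=> [-> /andP[-> ->]]|move=> /andP[/andP[-> ->] ->]].
- move=> S mS ih.
  rewrite (_ : (fun mu : wpm R => _) = (fun mu : wpm R => mu (W n) - mu (S `&` W n))%E).
    apply: emeasurable_funB => //; exact: measurable_open_itv.
  apply/funext => mu; rewrite setIC -setDE measureD//.
    by rewrite (setIC (W n)).
  exact: (@window_fin mu n).
- move=> F mF tF ih.
  rewrite (_ : (fun mu : wpm R => _) = (fun mu : wpm R => \sum_(i <oo) mu (F i `&` W n))%E).
    by apply: ge0_emeasurable_sum => // k _.
  apply/funext => mu; rewrite setI_bigcupl measure_semi_bigcup//.
  - by move=> k; exact: measurableI.
  - exact: trivIset_setIr.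
  - by apply: bigcup_measurable => k _; exact: measurableI.
Qed.

Lemma measurable_eval (B : set (measurableTypeR R)) : measurable B ->
  measurable_fun setT (fun mu : wpm R => mu B).
Proof.
move=> mB; apply: (@emeasurable_fun_cvg _ _ _ _ (fun n (mu : wpm R) => mu (B `&` W n))).
  by move=> n; exact: measurable_eval_window.
move=> mu _; have -> : mu B = mu (\bigcup_n (B `&` W n)).
  by rewrite -setI_bigcupr bigcup_window setIT.
apply: nondecreasing_cvg_mu.
- by move=> n; exact: measurableI.
- by apply: bigcup_measurable => k _; exact: measurableI.
- by move=> n m nm; apply/subsetPset => y [By Wx]; split=> //; exact: window_sub nm _ Wx.
Qed.

End kernel_measurability.

Section random_integral.
Context {R : realType} d (X : measurableType d) (p : X -> wpm R).
Hypothesis mp : forall B : set (measurableTypeR R), measurable B ->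
  measurable_fun setT (fun x => p x B).
Local Notation W n := (`](- n%:R), n%:R[%classic : set R).

(** The random measure seen as a kernel. It need not be bounded, so the results
    on finite kernels are applied window by window. *)
Definition random_measure (x : X) : {measure set (measurableTypeR R) -> \bar R} := p x.
HB.instance Definition _ := isKernel.Build _ _ X (measurableTypeR R) R random_measure mp.

(** The kernel is finite on a window, with a bound that may depend on [x]. *)
Lemma measurable_xsection_window n (A : set (X * measurableTypeR R)) : measurable A ->
  measurable_fun setT (fun x => p x (xsection A x `&` W n)).
Proof.
have mW : @measurable _ (measurableTypeR R) (W n) by [].
move=> mA; have [|_ H] := @measurable_prod_subset_xsection_kernel _ _ _ _ _ random_measure _ mW _ A mA.
  move=> x; exists (fine (p x (W n)) + 1) => B mB.
  have fW : (p x (W n) < +oo)%E by exact: (@window_fin _ (p x) n).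
  apply: (@le_lt_trans _ _ (p x (W n))).
    by rewrite /mrestr; apply: le_measure; rewrite ?inE//=; exact: measurableI.
  by rewrite -(@fineK _ (p x (W n))) ?ge0_fin_numE//= lte_fin ltrDl.
exact: H.
Qed.

Lemma measurable_xsection_random (A : set (X * measurableTypeR R)) : measurable A ->
  measurable_fun setT (fun x => p x (xsection A x)).
Proof.
move=> mA; apply: (@emeasurable_fun_cvg _ _ _ _ (fun n x => p x (xsection A x `&` W n))).
  by move=> n; exact: measurable_xsection_window.
move=> x _; have -> : p x (xsection A x) = p x (\bigcup_n (xsection A x `&` W n)).
  by rewrite -setI_bigcupr bigcup_window setIT.
have mxA : measurable (xsection A x) by exact: measurable_xsection.
apply: nondecreasing_cvg_mu.
- by move=> n; exact: measurableI.
- by apply: bigcup_measurable => k _; exact: measurableI.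
- by move=> n m nm; apply/subsetPset => y [By Wx]; split=> //; exact: window_sub nm _ Wx.
Qed.

Import HBNNSimple.

Lemma ge0_measurable_random_integral (f : X * measurableTypeR R -> \bar R) :
  (forall z, 0 <= f z)%E -> measurable_fun setT f ->
  measurable_fun setT (fun x => (\int[p x]_y f (x, y))%E).
Proof.
move=> f0 mf.
apply: (@measurable_fun_xsection_integral _ _ _ _ _ f random_measure (nnsfun_approx measurableT mf)).
- by move=> a b ab; exact/nd_nnsfun_approx.
- by move=> z; exact: cvg_nnsfun_approx.
- by move=> n r; apply: measurable_xsection_random; exact: measurable_sfunP.
Qed.

Lemma measurable_random_integral (f : X * measurableTypeR R -> \bar R) :
  measurable_fun setT f ->
  measurable_fun setT (fun x => (\int[p x]_y f (x, y))%E).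
Proof.
move=> mf; rewrite (_ : (fun x => _) =
    (fun x => \int[p x]_y (f^\+ (x, y)) - \int[p x]_y (f^\- (x, y)))%E); last first.
  by apply/funext => x; rewrite integralE; congr (_ - _)%E; apply: eq_integral => y _; rewrite ?funeposE ?funenegE.
apply: emeasurable_funB; apply: ge0_measurable_random_integral => //.
- exact: measurable_funepos.
- exact: measurable_funeneg.
Qed.

Lemma measurable_random_Rintegral (f : X -> R -> R) :
  measurable_fun setT (fun z : X * measurableTypeR R => f z.1 z.2) ->
  measurable_fun setT (fun x => \int[p x]_y f x y).
Proof.
move=> mf; have mfine : measurable_fun setT (@fine R) by [].
apply: (measurableT_comp mfine).
by apply: (@measurable_random_integral (fun z => (f z.1 z.2)%:E)); exact/measurable_EFinP.
Qed.

End random_integral.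

(** * Measurability of the transform *)

Section rational_cauchy.
Context {R : realType}.

(** Truncated transforms are right-continuous step functions of the window, so
    rational windows suffice. *)
Lemma atoms_right (mu : wpm R) (A : R) :
  exists2 q : rat, A < ratr q & atoms mu (ratr q) = atoms mu A.
Proof.
have [c Ac H] : exists2 c, A < c & forall x, x \in atoms mu (A + 1) -> A < `|x| -> c < `|x|.
  elim: (atoms mu (A + 1)) => [|y s [c Ac ih]]; first by exists (A + 1); rewrite ?ltrDl.
  have [Ay|yA] := ltP A `|y|; last first.
    exists c => // x; rewrite inE => /predU1P[->|/ih//]; by rewrite ltNge yA.
  exists (Num.min c ((A + `|y|) / 2)).
    by rewrite lt_min Ac; move: (`|y|) Ay => u; lra.
  move=> x; rewrite inE gt_min => /predU1P[-> _|/ih H /H ->//].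
  by apply/orP; right; move: (`|y|) Ay => u; lra.
have : A < Num.min c (A + 1) by rewrite lt_min Ac ltrDl ltr01.
move=> /rat_in_itvoo[q]; rewrite in_itv/= lt_min => /andP[Aq /andP[qc qA]].
exists q => //; rewrite /atoms; congr (finmap.enum_fset (fset_set _)).
apply/seteqP; split=> x [sx]; rewrite /= !in_itv/= -!ler_norml => xq; split=> //; rewrite -?ler_norml.
  rewrite leNgt; apply/negP => Ax.
  have xa : x \in atoms mu (A + 1).
    by rewrite mem_atoms; apply/andP; split; [exact: le_trans xq (ltW qA)|exact/asboolP].
  by have := lt_trans (H _ xa Ax) (le_lt_trans xq qc); rewrite ltxx.
exact: le_trans xq (ltW Aq).
Qed.

(** An enumeration of the rationals; the default 0 is taken at the indices that
    code no rational. *)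
Definition nth_rat (n : nat) : rat := odflt (0 : rat) (choice.unpickle n).

(** The Cauchy criterion with countably many quantifiers, so that the set of
    convergence is measurable. It is needed also for measures without a limit,
    because a version of the transform has to be measurable everywhere. *)
Definition rat_cauchy (u : R -> R) := forall k : nat, exists N : nat, forall n : nat,
  N%:R <= ratr (nth_rat n) :> R -> `|u (ratr (nth_rat n)) - u N%:R| <= k.+1%:R^-1.

Lemma rat_cauchyP (u : R -> R) :
  (forall A, exists2 q : rat, A < ratr q & u (ratr q) = u A) ->
  cvg (u A @[A --> +oo]) <-> rat_cauchy u.
Proof.
move=> ru; split=> [/cvg_ex[l /cvgyP ul] k|uC].
  have k0 : 0 < k.+1%:R^-1 / 2 :> R by rewrite divr_gt0// invr_gt0.
  have [A0 A0P] := ul _ k0; exists (Num.bound `|A0|) => n Nq.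
  have AN : A0 <= (Num.bound `|A0|)%:R.
    by apply: le_trans (ler_norm _) (ltW (archi_boundP _)).
  have h1 := A0P _ AN; have h2 := A0P _ (le_trans AN Nq).
  rewrite (_ : _ - _ = (u (ratr (nth_rat n)) - l) - (u (Num.bound `|A0|)%:R - l)); last by ring.
  apply: le_trans (ler_normB _ _) _.
  by rewrite [leRHS](splitr) lerD.
apply: cauchyy => e e0.
have [k ke] : exists k : nat, k.+1%:R^-1 <= e / 2.
  have [k _ /(_ k (leqnn k)) kP] := near_infty_natSinv_lt (PosNum (divr_gt0 e0 (@ltr0n R 2))).
  by exists k; exact: ltW.
have [N NP] := uC k; exists N%:R.
have uN A : N%:R <= A -> `|u A - u N%:R| <= e / 2.
  move=> NA; have [q Aq <-] := ru A.
  have := NP (choice.pickle q); rewrite /nth_rat choice.pickleK /= => H.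
  by apply: le_trans (H _) ke; apply: le_trans NA (ltW Aq).
move=> A B NA AB; rewrite (_ : _ - _ = (u B - u N%:R) - (u A - u N%:R)); last by ring.
apply: le_trans (ler_normB _ _) _.
by rewrite [leRHS](splitr) lerD// uN// (le_trans NA).
Qed.

Lemma measurable_rat_cauchy d (X : measurableType d) (u : X -> R -> R) :
  (forall A, measurable_fun setT (u ^~ A)) -> measurable [set x | rat_cauchy (u x)].
Proof.
move=> mu.
rewrite (_ : mkset _ = \bigcap_k \bigcup_N \bigcap_n
  [set x | N%:R <= ratr (nth_rat n) :> R ->
     `|u x (ratr (nth_rat n)) - u x N%:R| <= k.+1%:R^-1]); last first.
  apply/seteqP; split=> x H k; first by move=> _; have [N NP] := H k; exists N => // n _; exact: NP.
  by have [N _ NP] := H k I; exists N => n; exact: (NP n I).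
apply: bigcapT_measurable => k; apply: bigcupT_measurable => N; apply: bigcapT_measurable => n.
have [Nn|nN] := boolP (N%:R <= ratr (nth_rat n) :> R); last first.
  by rewrite (_ : mkset _ = setT)//; apply/seteqP; split.
rewrite (_ : mkset _ = [set x | (`|u x (ratr (nth_rat n)) - u x N%:R| <= k.+1%:R^-1) = true]); last first.
  by apply/seteqP; split=> x /=; [move=> ->|move=> -> _].
have mf : measurable_fun setT (fun x => `|u x (ratr (nth_rat n)) - u x N%:R| <= k.+1%:R^-1).
  apply: measurable_fun_ler => //; apply: measurableT_comp => //.
  exact: measurable_funB.
by have := mf measurableT [set true] I; rewrite setTI.
Qed.

End rational_cauchy.

Section random_transform.
Context {R : realType} d (X : measurableType d) (p : X -> wpm R) (a b : X -> R).
Hypothesis mp : forall B : set (measurableTypeR R), measurable B ->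
  measurable_fun setT (fun x => p x B).
Hypothesis ma : measurable_fun setT a.
Hypothesis mb : measurable_fun setT b.
Local Notation XR := (X * measurableTypeR R)%type.

Let m1 : measurable_fun setT (fun z : XR => a z.1).
Proof. exact: (measurableT_comp ma measurable_fst). Qed.
Let m2 : measurable_fun setT (fun z : XR => b z.1).
Proof. exact: (measurableT_comp mb measurable_fst). Qed.
Let m3 : measurable_fun setT (fun z : XR => z.2 : R).
Proof. exact: measurable_snd. Qed.

(** The mass at a point is the integral of the indicator of the diagonal. *)
Lemma measurable_random_atom : measurable [set x | supp (p x) (a x)].
Proof.
have mE : measurable_fun setT (fun x => \int[p x]_y (if y == a x then 1 else 0)).
  apply: (measurable_random_Rintegral mp); apply: measurable_fun_ifT => //.
  exact: measurable_fun_eqr.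
have E x : \int[p x]_y (if y == a x then 1 else 0) = mass (p x) (a x).
  rewrite /mass -[[set a x]]setIT -integral_indic//.
  rewrite /Rintegral; congr fine; apply: eq_integral => y _; rewrite indicE.
  have -> : (y \in [set a x]) = (y == a x) by apply/idP/eqP; rewrite inE.
  by case: (y == a x).
rewrite (_ : mkset _ = (fun x => \int[p x]_y (if y == a x then 1 else 0)) @^-1` [set r | r != 0]).
  rewrite -[X in measurable X]setTI; apply: mE => //.
  rewrite (_ : mkset _ = ~` [set 0]); first by apply: measurableC; exact: measurable_set1.
  by apply/seteqP; split=> r /= /eqP.
apply/seteqP; split=> x /=; rewrite E => h; first by rewrite gt_eqF// mass_gt0.
by apply: contrapT => /mass_notin h0; rewrite h0 eqxx in h.
Qed.

Let mkden : measurable_fun setT (fun z : XR => kden (a z.1) (b z.1) z.2).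
Proof.
apply: measurable_funD; apply: measurable_funX => //.
exact: measurable_funB.
Qed.

Let window_integral A (f : X -> R -> R) : (forall x, measurable_fun setT (f x)) ->
  measurable_fun setT (fun z : XR => f z.1 z.2) ->
  measurable_fun setT (fun x => rsum (p x) A (f x)).
Proof.
move=> mfx mf.
rewrite (_ : (fun x => _) = (fun x => \int[p x]_y (if `|y| <= A then f x y else 0))).
  apply: (measurable_random_Rintegral mp); apply: measurable_fun_ifT => //.
  by apply: measurable_fun_ler => //; exact: measurableT_comp.
apply/funext => x; rewrite -Rintegral_window// Rintegral_mkcond.
apply: eq_Rintegral => y _; rewrite /patch.
have -> : (y \in (`[- A, A]%classic : set R)) = (`|y| <= A).
  by rewrite ler_norml; apply/idP/idP; rewrite inE /= in_itv.
by [].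
Qed.

Lemma measurable_random_krel A : measurable_fun setT (fun x => rsum (p x) A (krel (a x) (b x))).
Proof.
apply: window_integral; first by move=> x; exact: measurable_krel.
apply: measurable_funM; first exact: measurable_funB.
exact: (measurableT_comp measurable_invr mkden).
Qed.

Lemma measurable_random_kiml A : measurable_fun setT (fun x => rsum (p x) A (kiml (a x) (b x))).
Proof.
apply: window_integral; first by move=> x; exact: measurable_kiml.
apply: measurable_funM; first exact: measurableT_comp.
exact: (measurableT_comp measurable_invr mkden).
Qed.

Let z x := a x +i* b x.

Let atom := [set x | real_atom (p x) (z x)].

Let measurable_atom : measurable atom.
Proof.
rewrite (_ : atom = [set x | supp (p x) (a x)] `&` b @^-1` [set 0]); last first.
  apply/seteqP; split=> x; first by move=> [y sy]; rewrite /z /= => -[<- <-].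
  by move=> [/= sx b0]; exists (a x) => //; rewrite /z b0.
apply: measurableI; first exact: measurable_random_atom.
by rewrite -[X in measurable X]setTI; apply: mb => //; exact: measurable_set1.
Qed.

Let conv := [set x | cvg (pv_trunc (p x) A (z x) @[A --> +oo])].

Let measurable_conv : measurable conv.
Proof.
rewrite (_ : conv = [set x | rat_cauchy (fun A => rsum (p x) A (krel (a x) (b x)))] `&`
    [set x | rat_cauchy (fun A => rsum (p x) A (kiml (a x) (b x)))]).
  apply: measurableI; apply: measurable_rat_cauchy.
  - exact: measurable_random_krel.
  - exact: measurable_random_kiml.
have ru x (g : R -> R) A : exists2 q : rat, A < ratr q & rsum (p x) (ratr q) g = rsum (p x) A g.
  by have [q Aq E] := atoms_right (p x) A; exists q => //; rewrite /rsum E.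
apply/seteqP; split=> x /=.
  move=> /cvg_ex[l xl]; split; apply/rat_cauchyP => //; apply/cvg_ex.
    exists (complex.Re l); have /(_ _) := cvgC_Re xl.
    by under eq_fun do rewrite pv_trunc_Re.
  exists (complex.Im l); have /(_ _) := cvgC_Im xl.
  by under eq_fun do rewrite pv_trunc_Im.
move=> [/(rat_cauchyP (ru _ _))/cvg_ex[u xu] /(rat_cauchyP (ru _ _))/cvg_ex[v xv]].
apply/cvg_ex; exists (u +i* v); apply: cvgC_comp.
  by under eq_fun do rewrite pv_trunc_Re.
by under eq_fun do rewrite pv_trunc_Im.
Qed.

(** Three measurable pieces: atoms, points of convergence, and the rest, where
    the limit takes a default value. *)
Lemma measurable_transform_component (pr : R[i] -> R) (c : X -> R -> R) :
  (forall A, measurable_fun setT (c ^~ A)) ->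
  (forall x A, pr (pv_trunc (p x) A (z x)) = c x A) ->
  (forall (f : R -> R[i]) l, f A @[A --> +oo] --> l -> pr (f A) @[A --> +oo] --> pr l) ->
  measurable_fun setT (fun x => pr (transform (p x) (z x))).
Proof.
move=> mc prE prc.
have mna : measurable (~` atom) by exact: measurableC.
rewrite -(setUv atom); apply/measurable_funU => //; split.
  apply: (eq_measurable_fun (cst (pr 0))); last exact: measurable_cst.
  by move=> x /[!inE] ax; rewrite /transform asboolT.
rewrite -(setIT (~` atom)) -(setUv conv) setIUr.
have mc1 := measurableI _ _ mna measurable_conv.
have mc2 := measurableI _ _ mna (measurableC measurable_conv).
apply/measurable_funU => //; split.
  apply: (@measurable_fun_cvg _ _ _ _ (fun n x => c x n%:R)).
    by move=> n; exact: measurable_funTS.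
  move=> x [nax cx]; rewrite /transform asboolF//.
  have := prc _ _ cx; under eq_fun do rewrite prE.
  by move=> H; have := cvg_comp _ _ (@cvgr_idn R) H.
apply: (eq_measurable_fun (cst (pr point))); last exact: measurable_cst.
by move=> x /[!inE] -[nax cx]; rewrite /transform asboolF// (dvgP cx).
Qed.

Lemma measurable_transform_Re : measurable_fun setT (fun x => complex.Re (transform (p x) (z x))).
Proof.
apply: (measurable_transform_component measurable_random_krel).
  by move=> x A; rewrite pv_trunc_Re.
by move=> f l; exact: cvgC_Re.
Qed.

Lemma measurable_transform_Im : measurable_fun setT (fun x => complex.Im (transform (p x) (z x))).
Proof.
apply: (measurable_transform_component measurable_random_kiml).
  by move=> x A; rewrite pv_trunc_Im.
by move=> f l; exact: cvgC_Im.
Qed.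

(** At most one of the two integrals is nonzero, according to the sign of
    [a x]. *)
Lemma measurable_random_signed_count : measurable_fun setT (fun x => signed_count (p x) (a x)).
Proof.
rewrite (_ : (fun x => _) = (fun x =>
  \int[p x]_y (if (0 < y) && (y <= a x) then 1 else 0) -
  \int[p x]_y (if (a x < y) && (y <= 0) then 1 else 0))).
  apply: measurable_funB; apply: (measurable_random_Rintegral mp); apply: measurable_fun_ifT => //.
    apply: measurable_and; [exact: measurable_fun_ltr|exact: measurable_fun_ler].
  apply: measurable_and; [exact: measurable_fun_ltr|exact: measurable_fun_ler].
have E (mu : wpm R) (u v : R) :
    \int[mu]_y (if (u < y) && (y <= v) then 1 else 0) = fine (mu `]u, v]%classic).
  rewrite -[X in mu X]setIT -integral_indic// /Rintegral; congr fine.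
  apply: eq_integral => y _; rewrite indicE.
  have -> : (y \in (`]u, v]%classic : set R)) = (u < y) && (y <= v).
    by apply/idP/idP; rewrite inE /= in_itv.
  by case: ifP.
apply/funext => x; rewrite !E /signed_count; case: ifPn => [a0|].
  by rewrite (@set_itv_ge _ _ (BRight (a x)))// ?measure0 ?subr0// bnd_simp -leNgt.
rewrite -ltNge => a0.
by rewrite (@set_itv_ge _ _ (BRight (0 : R)))// ?measure0 ?sub0r// bnd_simp -leNgt ltW.
Qed.

End random_transform.

(** * Almost sure summability of the discrepancy *)

Section deterministic_tail.
Context {R : realType} (mu : wpm R) (K : R).
Hypothesis K0 : 0 < K.
Local Notation leb := (@lebesgue_measure R).

(** Only [1 <= |r|] is kept, the range of the moment hypothesis; the bounded
    range gives a contribution that is finite for every measure. *)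
Definition tail_density (r : R) : \bar R :=
  if 1 <= `|r| then (`|disc mu K r| * wt r)%:E else 0%E.

Lemma tail_density_ge0 r : (0 <= tail_density r)%E.
Proof. by rewrite /tail_density; case: ifP => // _; rewrite lee_fin mulr_ge0// ltW// wt_gt0. Qed.

Lemma measurable_dwt : measurable_fun setT (fun r : R => `|disc mu K r| * wt r).
Proof.
apply: measurable_funM; last exact: continuous_mfun continuous_wt.
by apply: measurableT_comp => //; exact: measurable_disc.
Qed.

Lemma measurable_tail_density : measurable_fun setT tail_density.
Proof.
apply: measurable_fun_ifT => //; last by apply/measurable_EFinP; exact: measurable_dwt.
by apply: measurable_fun_ler => //; exact: measurableT_comp.
Qed.

Lemma summable_disc_of_tail : (\int[leb]_r tail_density r < +oo)%E -> summable_disc mu K.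
Proof.
move=> Ioo; have I0 : (0 <= \int[leb]_r tail_density r)%E.
  by apply: integral_ge0 => r _; exact: tail_density_ge0.
exists (disc_norm mu K 1 + fine (\int[leb]_r tail_density r)) => A.
have dE B : (disc_norm mu K B)%:E = (\int[leb]_(r in `[(- B)%R, B]) (`|disc mu K r| * wt r)%:E)%E.
  by rewrite /disc_norm /Rintegral fineK//; apply: integrable_fin_num => //; exact: dabs_integrable.
have mI (B : R) : @measurable _ (measurableTypeR R) `[- B, B]%classic by [].
have g0 r : (0 <= (`|disc mu K r| * wt r)%:E)%E by rewrite lee_fin mulr_ge0// ltW// wt_gt0.
rewrite -lee_fin EFinD !dE fineK ?ge0_fin_numE// [leLHS]integral_mkcond [X in (_ <= X + _)%E]integral_mkcond.
have mr (B : R) : measurable_fun setT ((fun r => (`|disc mu K r| * wt r)%:E) \_ `[- B, B]%classic).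
  by apply/(measurable_restrictT _ _).1 => //; apply: measurable_funTS; apply/measurable_EFinP; exact: measurable_dwt.
rewrite -ge0_integralD//; last 4 first.
- by move=> r _; apply: erestrict_ge0.
- exact: mr.
- by move=> r _; exact: tail_density_ge0.
- exact: measurable_tail_density.
apply: ge0_le_integral => //.
- by move=> r _; apply: erestrict_ge0.
- exact: mr.
- by apply: emeasurable_funD; [exact: mr|exact: measurable_tail_density].
move=> r _; rewrite {1}/patch; case: ifPn => _; last first.
  by apply: adde_ge0; [exact: erestrict_ge0|exact: tail_density_ge0].
have [r1|r1] := leP 1 `|r|.
  by rewrite /tail_density r1 leeDr//; exact: erestrict_ge0.
rewrite /patch mem_set ?leeDl ?tail_density_ge0//.
by rewrite /= in_itv/= -ler_norml ltW.
Qed.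

End deterministic_tail.

Section almost_sure_tail.
Context {R : realType} d (Omega : measurableType d) (P : probability Omega R)
  (M : {RV P >-> wpm R}) (K : R) (h : R -> R).
Hypothesis K0 : 0 < K.
Hypothesis h_ge0 : forall r, 1 <= r -> 0 <= h r.
Hypothesis h_measurable : measurable_fun (`[1, +oo[%classic : set R) h.
Hypothesis h_bound : forall x : R, 1 <= `|x| ->
  (\int[P]_omega (`|signed_count (M omega) x - K * x|)%:E <= (h `|x|)%:E)%E.
Hypothesis h_integrable :
  (\int[lebesgue_measure]_(r in `[1%R, +oo[) (h r / r ^+ 2)%:E < +oo)%E.
Local Notation leb := (@lebesgue_measure R).

Lemma measurable_random_mass (B : set (measurableTypeR R)) : measurable B ->
  measurable_fun setT (fun omega => M omega B).
Proof.
by move=> mB; apply: (measurableT_comp (measurable_eval mB)); exact: measurable_funP.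
Qed.

Let f (r : R) : \bar R := ((fun r => (h r / r ^+ 2)%:E) \_ `[1, +oo[%classic) r.

Let f_ge0 r : (0 <= f r)%E.
Proof.
rewrite /f /patch; case: ifPn => //; rewrite inE /= in_itv/= andbT => r1.
by rewrite lee_fin divr_ge0 ?sqr_ge0// h_ge0.
Qed.

Let mf : measurable_fun setT f.
Proof.
apply/(measurable_restrictT _ _).1 => //; apply/measurable_EFinP.
apply: measurable_funM => //; apply: measurable_funTS.
apply: (measurableT_comp measurable_invr); exact: measurable_funX.
Qed.

Let int_f : (\int[leb]_r f r < +oo)%E.
Proof. by rewrite /f -integral_mkcond. Qed.

Let mopp : measurable_fun setT (fun r : R => - r).
Proof. by apply: continuous_mfun => x; apply: cvgN; exact: cvg_id. Qed.

Let int_f_opp : (\int[leb]_r f (- r) = \int[leb]_r f r)%E.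
Proof.
transitivity (\int[pushforward leb (-%R : _ -> measurableTypeR R)]_r f r)%E.
  by rewrite ge0_integral_pushforward.
by apply: eq_measure_integral => A mA _; exact: lebesgue_measureN.
Qed.

Let G (z : Omega * measurableTypeR R) : \bar R := tail_density (M z.1) K z.2.

Let mG : measurable_fun setT G.
Proof.
have msnd : measurable_fun setT (fun z : Omega * measurableTypeR R => z.2 : R).
  exact: measurable_snd.
apply: measurable_fun_ifT => //.
  by apply: measurable_fun_ler => //; exact: measurableT_comp.
apply/measurable_EFinP; apply: measurable_funM; last first.
  exact: (measurableT_comp (continuous_mfun continuous_wt) msnd).
apply: measurableT_comp => //; apply: measurable_funB; last exact: measurable_funM.
apply: (@measurable_random_signed_count _ _ _ (fun z : Omega * measurableTypeR R => M z.1)) => //.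
move=> B mB; exact: (measurableT_comp (measurable_random_mass mB) measurable_fst).
Qed.

Let G_ge0 z : (0 <= G z)%E.
Proof. exact: tail_density_ge0. Qed.

Let mean_G r : (\int[P]_omega G (omega, r) <= f r + f (- r))%E.
Proof.
rewrite /G /tail_density /=; have [r1|r1] := boolP (1 <= `|r|); last first.
  rewrite integral0_eq; last by move=> omega _.
  by apply: adde_ge0; exact: f_ge0.
have mD : measurable_fun setT (fun omega => `|signed_count (M omega) r - K * r|).
  apply: measurableT_comp => //; apply: measurable_funB => //.
  by apply: (@measurable_random_signed_count _ _ _ (fun omega => M omega) (cst r) measurable_random_mass).
rewrite (_ : (\int[P]_omega _)%E =
    ((wt r)%:E * \int[P]_omega (`|signed_count (M omega) r - K * r|)%:E)%E); last first.
  rewrite -ge0_integralZl//.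
  - by apply: eq_integral => o _; rewrite -EFinM mulrC.
  - exact/measurable_EFinP.
  - by rewrite lee_fin ltW// wt_gt0.
apply: (@le_trans _ _ ((wt r)%:E * (h `|r|)%:E)%E).
  by apply: lee_wpmul2l; [rewrite lee_fin ltW// wt_gt0|exact: h_bound].
have hr : 0 <= h `|r| by exact: h_ge0.
have wr : wt r <= (`|r| ^+ 2)^-1.
  rewrite /wt real_normK ?num_real// lef_pV2 ?posrE ?lerDr//.
    by rewrite ltr_wpDr ?sqr_ge0.
  by rewrite -[_ ^+ 2]real_normK ?num_real// exprn_gt0// (lt_le_trans _ r1).
apply: (@le_trans _ _ (f `|r|)).
  rewrite /f /patch mem_set; last by rewrite /= in_itv/= r1.
  by rewrite -EFinM lee_fin mulrC ler_wpM2l.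
have [r0|r0] := leP 0 r; [rewrite ger0_norm//|rewrite ltr0_norm//].
  by rewrite leeDl.
by rewrite leeDr.
Qed.

(** By Tonelli the expected weighted discrepancy is at most twice the integral
    of [h r / r ^ 2], one integral for each half-line. *)
Lemma summable_disc_ae : \forall omega \ae P, summable_disc (M omega) K.
Proof.
have mI : measurable_fun setT (fun omega => \int[leb]_r G (omega, r))%E.
  exact: (measurable_fun_fubini_tonelli_F G mG G_ge0).
have EI : (\int[P]_omega \int[leb]_r G (omega, r) < +oo)%E.
  rewrite fubini_tonelli//.
  apply: (@le_lt_trans _ _ (\int[leb]_r (f r + f (- r)))%E).
    apply: ge0_le_integral => //.
    - by move=> r _; apply: integral_ge0.
    - exact: (measurable_fun_fubini_tonelli_G G mG G_ge0).
    - by apply: emeasurable_funD => //; exact: (measurableT_comp mf mopp).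
  rewrite ge0_integralD// ?int_f_opp; last exact: (measurableT_comp mf mopp).
  by rewrite lte_add_pinfty.
have Iint : P.-integrable setT (fun omega => \int[leb]_r G (omega, r))%E.
  apply/integrableP; split=> //; under eq_integral => o _ do rewrite gee0_abs ?integral_ge0//.
  exact: EI.
have := integrable_ae measurableT Iint; apply: filterS => omega /(_ I) Ifin.
apply: summable_disc_of_tail => //; rewrite ltey_eq.
by rewrite Ifin.
Qed.

End almost_sure_tail.

(** * Conditional laws and null sets *)

Section generalities.
Context {R : realType}.

(** It is enough to look at the coordinates, which generate the algebra. *)
Lemma cylinder_preimage d (X : measurableType d) (T : Type) d' (V : measurableType d')
    (Z : X -> T -> V) (S : set (T -> V)) :
  (forall z, measurable_fun setT (Z ^~ z)) -> cylinder_algebra S ->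
  measurable [set x | S (Z x)].
Proof.
move=> mZ; move: S; apply: smallest_sub.
  split => /=.
  - by rewrite (_ : mkset _ = set0)//; exact/seteqP.
  - move=> A mA; rewrite (_ : mkset _ = ~` [set x | A (Z x)]); first exact: measurableC.
    by apply/seteqP; split=> x /=; [move=> []|].
  - move=> A mA; rewrite (_ : mkset _ = \bigcup_k [set x | A k (Z x)]).
      by apply: bigcupT_measurable.
    by apply/seteqP; split=> x [k _ Ak]; exists k.
move=> _ [z _ [B mB <-]].
rewrite (_ : mkset _ = setT `&` (Z ^~ z) @^-1` B); first exact: mZ.
by apply/seteqP; split=> x /= [].
Qed.

Lemma measure_ae_eq d (X : measurableType d) (m : {measure set X -> \bar R}) (A B : set X) :
  measurable A -> measurable B -> (\forall x \ae m, A x <-> B x) -> m A = m B.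
Proof.
move=> mA mB AB; rewrite -[A]setIT -[B in RHS]setIT -!integral_indic//.
apply: ae_eq_integral => //.
- by apply/measurable_EFinP; exact: measurable_indic.
- by apply/measurable_EFinP; exact: measurable_indic.
apply: filterS AB => x AB _; congr (_%:E); rewrite !indicE; congr (_%:R).
by congr (nat_of_bool _); apply/idP/idP; rewrite !inE => /AB.
Qed.

Lemma integral_mrestr d (X : measurableType d) (m : {measure set X -> \bar R}) (E : set X)
    (mE : measurable E) (f : X -> \bar R) : measurable_fun setT f -> (forall x, 0 <= f x)%E ->
  (\int[mrestr m mE]_x f x = \int[m]_(x in E) f x)%E.
Proof.
move=> mf f0; rewrite (@ge0_negligible_integral _ _ _ (mrestr m mE) setT (~` E))//.
- rewrite setTD setCK; apply: eq_measure_integral => A mA AE.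
  by rewrite /= /mrestr setIidl.
- exact: measurableC.
- by rewrite /= /mrestr setICl measure0.
Qed.

(** The open rays generate the Borel sets and are stable under intersection. *)
Lemma law_eq_open_rays (m1 m2 : {measure set (measurableTypeR R) -> \bar R}) :
  (forall a : R, m1 `]a, +oo[%classic = m2 `]a, +oo[%classic) ->
  (forall a : R, m1 `]a, +oo[%classic < +oo)%E ->
  forall B, measurable B -> m1 B = m2 B.
Proof.
move=> m12 fin B mB.
pose g (n : nat) : set (measurableTypeR R) := `](- n%:R), +oo[%classic.
have mG : @measurable _ (measurableTypeR R) = <<s @RGenOInfty.G R >>.
  exact: RGenOInfty.measurableE.
have GI : setI_closed (@RGenOInfty.G R).
  move=> _ _ [a ->] [b ->]; exists (Num.max a b).
  by apply/seteqP; split=> x /=; rewrite !in_itv/= !andbT gt_max; [move=> [-> ->]|move=> /andP[]].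
have Gg n : @RGenOInfty.G R (g n) by exists (- n%:R).
have gT : \bigcup_n g n = setT.
  rewrite -subTset => x _; exists (Num.bound `|x|) => //; rewrite /g /= in_itv/= andbT.
  by have := archi_boundP (normr_ge0 x); rewrite ltr_norml => /andP[].
have GE A : @RGenOInfty.G R A -> m1 A = m2 A by move=> [a ->]; exact: m12.
exact: (@measure_unique _ R (measurableTypeR R) (@RGenOInfty.G R) g mG GI Gg gT m1 m2 GE
  (fun n => fin _) B mB).
Qed.

Lemma positive_part_ray (a : R) (h := fun x : R => (x - a) + `|x - a|) :
  [/\ continuous h, forall x, 0 <= h x & [set x | 0 < h x] = `]a, +oo[%classic].
Proof.
split.
- move=> x; apply: cvgD; last apply: cvg_norm; apply: cvgB; by [exact: cvg_id|exact: cvg_cst].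
- by move=> x; rewrite /h; have := ler_norm (- (x - a)); rewrite normrN; lra.
- apply/seteqP; split=> x /=; rewrite in_itv/= andbT /h.
    by have [g0|g0] := leP 0 (x - a); [rewrite ger0_norm//|rewrite ltr0_norm//]; lra.
  by move=> ax; rewrite gtr0_norm ?subr_gt0//; lra.
Qed.

(** Countably many equalities are enough, which allows almost sure statements
    to be combined. *)
Lemma rays_rational (m1 m2 : {measure set (measurableTypeR R) -> \bar R}) :
  (m1 setT < +oo)%E ->
  (forall q : rat, m1 `](ratr q), +oo[%classic = m2 `](ratr q), +oo[%classic) ->
  forall B, measurable B -> m1 B = m2 B.
Proof.
move=> fin; have main (u v : {measure set (measurableTypeR R) -> \bar R}) :
    (forall q : rat, u `](ratr q), +oo[%classic = v `](ratr q), +oo[%classic) ->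
    forall a : R, (u `]a, +oo[%classic <= v `]a, +oo[%classic)%E.
  move=> uv a.
  have <- : \bigcup_n `](a + n.+1%:R^-1), +oo[%classic = `]a, +oo[%classic.
    apply/seteqP; split=> x /=.
      move=> [n _] /=; rewrite !in_itv/= !andbT; apply: lt_trans.
      by rewrite ltrDl invr_gt0.
    rewrite in_itv/= andbT => ax.
    have [k _ /(_ k (leqnn k)) kP] := near_infty_natSinv_lt (PosNum (eq_ind_r is_true ax (subr_gt0 a x))).
    by exists k => //=; rewrite in_itv/= andbT -ltrBrDl.
  have cu : u (`](a + n.+1%:R^-1), +oo[%classic) @[n --> \oo] --> u (\bigcup_n `](a + n.+1%:R^-1), +oo[%classic).
    apply: nondecreasing_cvg_mu => //; first exact: bigcup_measurable.
    move=> n m nm; apply/subsetPset => x /=; rewrite !in_itv/= !andbT; apply: le_lt_trans.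
    by rewrite lerD2l lef_pV2 ?posrE// ler_nat.
  rewrite -(cvg_lim _ cu)//; apply: lime_le; first by apply/cvg_ex; eexists; exact: cu.
  apply: nearW => n.
  have : a < a + n.+1%:R^-1 by rewrite ltrDl invr_gt0.
  move=> /rat_in_itvoo[q]; rewrite in_itv/= => /andP[aq qn].
  apply: (@le_trans _ _ (u `](ratr q), +oo[%classic)).
    apply: le_measure; rewrite ?inE// => x /=; rewrite !in_itv/= !andbT; exact: lt_trans.
  rewrite uv; apply: le_measure; rewrite ?inE//; first exact: bigcup_measurable.
  move=> x /=; rewrite in_itv/= andbT => qx.
  have ax : 0 < x - a by rewrite subr_gt0 (lt_trans aq).
  have [k _ /(_ k (leqnn k)) kP] := near_infty_natSinv_lt (PosNum ax).
  by exists k => //=; rewrite in_itv/= andbT -ltrBrDl.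
move=> m12 B mB; apply: law_eq_open_rays => // a; last first.
  by apply: le_lt_trans fin; apply: le_measure; rewrite ?inE.
by apply/le_anti/andP; split; apply: main.
Qed.

End generalities.

Section conditional_law.
Context {R : realType} d (Omega : measurableType d) (P : probability Omega R).
Variables (G : set (set Omega)) (X : Omega -> R) (nu : probability (measurableTypeR R) R).
Hypothesis G_algebra : sigma_algebra setT G.
Hypothesis G_measurable : G `<=` measurable.
Hypothesis mX : measurable_fun setT X.
Hypothesis X_law : forall E B, G E -> measurable B ->
  P (E `&` X @^-1` B) = (P E * nu B)%E.

(** The candidate conditional law. *)
Definition constant_kernel : g_sigma_algebraType G -> {measure set (measurableTypeR R) -> \bar R} :=
  fun=> nu.

Let mconst B : measurable B -> measurable_fun setT (constant_kernel ^~ B).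
Proof. by move=> mB; exact: measurable_cst. Qed.

HB.instance Definition _ := isKernel.Build _ _ _ _ R constant_kernel mconst.

Let const1 x : constant_kernel x setT = 1%E.
Proof. exact: probability_setT. Qed.

HB.instance Definition _ := Kernel_isProbability.Build _ _ _ _ R constant_kernel const1.

Lemma constant_cond_law : is_cond_law P X (constant_kernel : R.-pker _ ~> _).
Proof.
move=> E B GE mB; transitivity (\int[P]_(omega in E) cst (nu B) omega)%E; first by [].
by rewrite integral_cst; [rewrite X_law// muleC|exact: G_measurable].
Qed.

(** A sigma-algebra coincides with the one that it generates. *)
Lemma g_measurable_sub (E : set Omega) :
  @measurable _ (g_sigma_algebraType G) E -> G E.
Proof. by apply: smallest_sub. Qed.

(** If the conditional probability differed from [nu B] on a non-null set of
    [G], its integral over one of the two sets of [G] where it is smaller or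
    larger would be wrong. *)
Lemma cond_law_unique_set (kappa : R.-pker (g_sigma_algebraType G) ~> (measurableTypeR R)) B :
  is_cond_law P X kappa -> measurable B -> \forall omega \ae P, kappa omega B = nu B.
Proof.
move=> kl mB.
have fin omega : kappa omega B \is a fin_num.
  have := @prob_kernel _ _ _ _ _ kappa omega => k1.
  rewrite ge0_fin_numE//; apply: (@le_lt_trans _ _ (kappa omega setT)).
    by apply: le_measure; rewrite ?inE.
  by rewrite k1 ltry.
have nfin : nu B \is a fin_num by rewrite fin_num_measure.
pose f (omega : Omega) : R := fine (kappa omega B); pose c := fine (nu B).
have fE (omega : Omega) : kappa omega B = (f omega)%:E by rewrite /f fineK.
have cE : nu B = c%:E by rewrite /c fineK.
have mfG : @measurable_fun _ _ (g_sigma_algebraType G) (measurableTypeR R) setT f.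
  by apply/measurable_EFinP; have := measurable_kernel kappa B mB; apply: eq_measurable_fun => o _; rewrite /= fE.
have mf : @measurable_fun _ _ Omega (measurableTypeR R) setT f.
  move=> _ Y mY; apply: G_measurable; apply: g_measurable_sub; exact: mfG.
have f01 o : 0 <= f o <= 1.
  rewrite fine_ge0//= -lee_fin -fE.
  have := @prob_kernel _ _ _ _ _ kappa o => <-.
  by apply: le_measure; rewrite ?inE.
have c01 : 0 <= c by rewrite fine_ge0.
(* On a set of [G] where [f - c] has constant sign its integral vanishes,
   hence so does the measure of the set where it is nonzero. *)
have key (E : set Omega) : G E -> (forall o, E o -> 0 < `|f o - c|) ->
    (forall o, E o -> f o <= c) \/ (forall o, E o -> c <= f o) -> P E = 0%E.
  move=> GE Epos Esgn; have mE := G_measurable GE.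
  have iE1 : P.-integrable E (EFin \o f).
    apply: (@le_integrable _ _ _ _ _ _ _ (cst 1%E)) => //.
    - by apply/measurable_EFinP; exact: measurable_funTS.
    - move=> o _; rewrite /= normr1 lee_fin; have /andP[f0 f1] := f01 o.
      by rewrite ger0_norm.
    - exact: (finite_measure_integrable_cst P 1 mE).
  have iE2 : P.-integrable E (EFin \o cst c).
    exact: (finite_measure_integrable_cst P c mE).
  have i1 : (\int[P]_(o in E) (f o)%:E = P E * c%:E)%E.
    rewrite -cE -X_law// -(kl _ _ GE mB); apply: eq_integral => o _; by rewrite fE.
  have i2 : (\int[P]_(o in E) (cst c o)%:E = P E * c%:E)%E.
    by transitivity (\int[P]_(o in E) cst c%:E o)%E; [|rewrite integral_cst// muleC].
  have PEfin : (P E * c%:E)%E \is a fin_num by rewrite fin_numM// fin_num_measure.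
  have zero : (\int[P]_(o in E) `|(f o - c)%:E| = 0)%E.
    case: Esgn => sgn.
      rewrite (_ : (\int[P]_(o in E) _)%E = (\int[P]_(o in E) (EFin (cst c o) - (f o)%:E))%E); last first.
        apply: eq_integral => o /[!inE] Eo; rewrite -EFinB/= ler0_norm ?opprB// subr_le0; exact: sgn.
      by rewrite (integralB mE iE2 iE1) i1 i2 subee.
    rewrite (_ : (\int[P]_(o in E) _)%E = (\int[P]_(o in E) ((f o)%:E - EFin (cst c o)))%E); last first.
      apply: eq_integral => o /[!inE] Eo; rewrite -EFinB/= ger0_norm// subr_ge0; exact: sgn.
    by rewrite (integralB mE iE1 iE2) i1 i2 subee.
  have mg : measurable_fun E (fun o => (f o - c)%:E).
    by apply/measurable_EFinP; apply: measurable_funB => //; exact: measurable_funTS.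
  have [+ _] := ae_eq_integral_abs P mE mg; move=> /(_ zero) ae0.
  have -> : P E = P set0; last exact: measure0.
  apply: measure_ae_eq => //; apply: filterS ae0 => o H; split=> // Eo.
  by have := Epos _ Eo; move: (H Eo) => -[->]; rewrite normr0 ltxx.
have Elt : P [set o | f o < c] = 0%E.
  apply: key.
  - apply: g_measurable_sub; rewrite (_ : mkset _ = f @^-1` `]-oo, c[%classic); last first.
      by apply/seteqP; split=> o /=; rewrite in_itv.
    by rewrite -[X in measurable X]setTI; exact: mfG.
  - by move=> o /= oc; rewrite normr_gt0 subr_eq0 lt_eqF.
  - by left=> o /ltW.
have Egt : P [set o | c < f o] = 0%E.
  apply: key.
  - apply: g_measurable_sub; rewrite (_ : mkset _ = f @^-1` `]c, +oo[%classic); last first.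
      by apply/seteqP; split=> o /=; rewrite in_itv/= andbT.
    by rewrite -[X in measurable X]setTI; exact: mfG.
  - by move=> o /= oc; rewrite normr_gt0 subr_eq0 gt_eqF.
  - by right=> o /ltW.
have mlt : measurable [set o | f o < c].
  rewrite (_ : mkset _ = f @^-1` `]-oo, c[%classic); last by apply/seteqP; split=> o /=; rewrite in_itv.
  by rewrite -[X in measurable X]setTI; exact: mf.
have mgt : measurable [set o | c < f o].
  rewrite (_ : mkset _ = f @^-1` `]c, +oo[%classic); last by apply/seteqP; split=> o /=; rewrite in_itv/= andbT.
  by rewrite -[X in measurable X]setTI; exact: mf.
exists ([set o | f o < c] `|` [set o | c < f o]); split.
- exact: measurableU.
- by rewrite null_set_setU.
- move=> o /= kn; have [fc|fc|fc] := ltgtP (f o) c; [by left|by right|].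
  by exfalso; apply: kn; rewrite fE cE fc.
Qed.

(** Countably many rays identify a law, so the exceptional null sets can be
    united. *)
Lemma cond_law_eq_constant : cond_law_eq P G X nu.
Proof.
split=> //; first by exists constant_kernel; exact: constant_cond_law.
move=> kappa kl.
have : \forall omega \ae P, forall n, kappa (omega : Omega) `](ratr (nth_rat n)), +oo[%classic =
    nu `](ratr (nth_rat n)), +oo[%classic.
  by apply: ae_foralln => n; exact: cond_law_unique_set.
apply: filterS => omega H B mB.
apply: rays_rational => // [|q].
  by rewrite (@prob_kernel _ _ _ _ _ kappa omega) ltry.
by have := H (choice.pickle q); rewrite /nth_rat choice.pickleK.
Qed.

End conditional_law.

(** * Invariant events *)

Section stationarity.
Context {R : realType} d (Omega : measurableType d) (P : probability Omega R)
  (M : {RV P >-> wpm R}) (K : R).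
Hypothesis K0 : 0 < K.
Hypothesis M_stationary : stationary M.
Hypothesis M_summable : \forall omega \ae P, summable_disc (M omega) K.

Lemma measurable_shift_mass d' (X : measurableType d') (p : X -> wpm R) t :
  (forall B : set (measurableTypeR R), measurable B -> measurable_fun setT (fun x => p x B)) ->
  forall B : set (measurableTypeR R), measurable B ->
    measurable_fun setT (fun x => theta t (p x) B).
Proof.
move=> mp B mB.
have mB' : @measurable _ (measurableTypeR R) [set x + t | x in B].
  rewrite image_addrE -[X in measurable X]setTI.
  by apply: (measurable_funB (f := id) (g := cst t)) => //; exact: measurable_cst.
exact: mp mB'.
Qed.

(** One event of probability one serves all shifts and all points. *)
Lemma shifted_transform : \forall omega \ae P, forall t z,
  transform (theta t (M omega)) z = transform (M omega) (z + t%:C).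
Proof. by apply: filterS M_summable => omega gd t z; exact: (theta_transform K0 gd). Qed.

Let coord (mu : wpm R) (z : R[i]) : R * R :=
  (complex.Re (transform mu z), complex.Im (transform mu z)).

Let measurable_coord d' (X : measurableType d') (p : X -> wpm R) z :
  (forall B : set (measurableTypeR R), measurable B -> measurable_fun setT (fun x => p x B)) ->
  measurable_fun setT (fun x => coord (p x) z).
Proof.
case: z => a b mp; apply: measurable_fun_pair.
  exact: (@measurable_transform_Re _ _ _ p (cst a) (cst b) mp).
exact: (@measurable_transform_Im _ _ _ p (cst a) (cst b) mp).
Qed.

(** The transform of the shifted measure is a measurable function of the
    shifted measure, to which stationarity applies, and almost surely it is the
    shifted transform. *)
Lemma transform_stationary : stationary_random_function P
  (fun (t : R) (z : R[i]) => z + t%:C)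
  (fun omega z => (complex.Re (transform (M omega) z), complex.Im (transform (M omega) z))).
Proof.
have mM := measurable_random_mass M.
split=> [z|t S CS]; first exact: (measurable_coord z mM).
have mQ : measurable [set mu : wpm R | S (coord mu)].
  by apply: cylinder_preimage CS => z; apply: measurable_coord => B; exact: measurable_eval.
have := M_stationary t mQ; rewrite /pushforward => E.
transitivity (P ((theta t \o M) @^-1` [set mu | S (coord mu)])); last first.
  by rewrite E.
apply: measure_ae_eq.
- apply: (cylinder_preimage (Z := fun omega z => coord (M omega) (z + t%:C))) CS => z.
  exact: (measurable_coord _ mM).
- apply: (cylinder_preimage (Z := fun omega => coord (theta t (M omega)))) CS => z.
  by apply: measurable_coord; exact: measurable_shift_mass.
apply: filterS shifted_transform => omega H /=.
have -> : (fun z => (complex.Re (transform (M omega) (z + t%:C)),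
    complex.Im (transform (M omega) (z + t%:C)))) = coord (theta t (M omega)).
  by apply/funext => z; rewrite /coord !H.
by [].
Qed.

Definition normalized (omega : Omega) (s : R) : R := transformR (M omega) s / (pi * K).

Lemma measurable_transformR_random d' (X : measurableType d') (p : X -> wpm R) (a : X -> R) :
  (forall B : set (measurableTypeR R), measurable B -> measurable_fun setT (fun x => p x B)) ->
  measurable_fun setT a -> measurable_fun setT (fun x => transformR (p x) (a x)).
Proof. by move=> mp ma; apply: (@measurable_transform_Re _ _ _ p a (cst 0) mp ma). Qed.

Lemma measurable_normalized s : measurable_fun setT (normalized ^~ s).
Proof.
apply: measurable_funM => //.
by apply: (measurable_transformR_random (measurable_random_mass M)).
Qed.

Lemma measurable_normalized_joint :
  measurable_fun setT (fun z : Omega * measurableTypeR R => normalized z.1 z.2).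
Proof.
apply: measurable_funM => //.
apply: (@measurable_transformR_random _ _ (fun z : Omega * measurableTypeR R => M z.1) (fun z => z.2)).
  by move=> B mB; apply: (measurableT_comp (measurable_random_mass M mB)); exact: measurable_fst.
exact: measurable_snd.
Qed.

Lemma invariant_algebra : sigma_algebra setT (invariant_field M).
Proof.
split.
- exists set0; last exact: preimage_set0.
  by split=> // t; exact: preimage_set0.
- move=> _ [S [mS iS] <-]; exists (~` S); last by rewrite setTD preimage_setC.
  by split=> [|t]; [exact: measurableC|rewrite -preimage_setC iS].
- move=> A HA.
  have /choice[S SP] : forall n, exists Sn : set (wpm R),
      [/\ measurable Sn, forall t, theta t @^-1` Sn = Sn & M @^-1` Sn = A n].
    by move=> n; have [S [mS iS] <-] := HA n; exists S.
  exists (\bigcup_k S k); last first.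
    by rewrite preimage_bigcup; apply: eq_bigcupr => k _; case: (SP k).
  split=> [|t]; first by apply: bigcupT_measurable => k; case: (SP k).
  by rewrite preimage_bigcup; apply: eq_bigcupr => k _; case: (SP k).
Qed.

Lemma invariant_measurable : invariant_field M `<=` measurable.
Proof.
move=> _ [S [mS _] <-]; rewrite -[X in measurable X]setTI.
exact: (@measurable_funP _ _ _ _ setT M).
Qed.

Lemma invariant_setT : invariant_field M setT.
Proof. by exists setT; [split=> // t; rewrite preimage_setT|rewrite preimage_setT]. Qed.

(** A shift by [s] leaves the invariant event unchanged and moves the value at
    [0] to the value at [s]. *)
Lemma law_on_invariant E B s : invariant_field M E -> measurable B ->
  P (E `&` (normalized ^~ s) @^-1` B) = P (E `&` (normalized ^~ 0) @^-1` B).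
Proof.
move=> [S [mS iS] <-] mB.
pose Q := S `&` (fun mu : wpm R => transformR mu 0 / (pi * K)) @^-1` B.
have mQ : measurable Q.
  apply: measurableI => //; rewrite -[X in measurable X]setTI.
  have m : measurable_fun setT (fun mu : wpm R => transformR mu 0 / (pi * K)).
    apply: measurable_funM => //; apply: (measurable_transformR_random (p := id)) => //.
    by move=> C mC; exact: measurable_eval.
  exact: m.
have mE : measurable (M @^-1` S) by apply: invariant_measurable; exists S.
transitivity (P ((theta s \o M) @^-1` Q)); last exact: (M_stationary s mQ).
apply: measure_ae_eq.
- apply: measurableI => //; rewrite -[X in measurable X]setTI.
  exact: measurable_normalized.
- have -> : (theta s \o M) @^-1` Q = M @^-1` S `&`
      (fun omega => transformR (theta s (M omega)) 0 / (pi * K)) @^-1` B.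
    transitivity (M @^-1` (theta s @^-1` S) `&`
      (fun omega => transformR (theta s (M omega)) 0 / (pi * K)) @^-1` B); first by [].
    by rewrite iS.
  apply: measurableI => //; rewrite -[X in measurable X]setTI.
  have m : measurable_fun setT (fun omega => transformR (theta s (M omega)) 0 / (pi * K)).
    apply: measurable_funM => //; apply: measurable_transformR_random => //.
    by apply: measurable_shift_mass; exact: measurable_random_mass.
  exact: m.
apply: filterS shifted_transform => omega H; rewrite /Q /normalized /=.
have -> : transformR (theta s (M omega)) 0 = transformR (M omega) s.
  by rewrite /transformR H -rmorphD add0r.
have -> : S (theta s (M omega)) = S (M omega) by rewrite -[in RHS](iS s).
by [].
Qed.

Lemma succ_cvgy : (n.+1%:R : R) @[n --> \oo] --> +oo.
Proof.
apply/cvgryPge => A; exists (Num.bound `|A|) => // n /= bn.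
apply: le_trans (ler_norm A) (ltW (lt_le_trans (archi_boundP (normr_ge0 A)) _)).
by rewrite ler_nat; exact: leqW.
Qed.

Lemma mean_cst (c : \bar R) (L : R) : 0 < L ->
  ((L^-1)%:E * \int[lebesgue_measure]_(s in `[(- (L / 2))%R, (L / 2)%R])
     cst c s = c)%E.
Proof.
move=> L0; rewrite integral_cst; last exact: measurable_itv.
rewrite /= lebesgue_measure_itv/= lte_fin ifT; last by lra.
by rewrite -EFinD opprK -splitr muleCA -EFinM mulVf ?mule1// gt_eqF.
Qed.

Section average.
Variables (E : set Omega) (phi : R -> R) (C : R).
Hypothesis GE : invariant_field M E.
Hypothesis cphi : continuous phi.
Hypothesis phi_ge0 : forall x, 0 <= phi x.
Hypothesis phi_leC : forall x, phi x <= C.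

Let mE : measurable E := invariant_measurable GE.
Let mphi : measurable_fun setT phi := continuous_mfun cphi.

Definition nmfun s : Omega -> measurableTypeR R := normalized ^~ s.
HB.instance Definition _ s := isMeasurableFun.Build _ _ _ _ (nmfun s) (measurable_normalized s).

Lemma integral_law (g : R -> \bar R) s : measurable_fun setT g -> (forall x, 0 <= g x)%E ->
  (\int[P]_(omega in E) g (normalized omega s) =
   \int[pushforward (mrestr P mE) (nmfun s)]_x g x)%E.
Proof.
move=> mg g0; rewrite ge0_integral_pushforward// integral_mrestr//.
  exact: (measurableT_comp mg (measurable_normalized s)).
by move=> x; exact: g0.
Qed.

Lemma integral_invariant s :
  (\int[P]_(omega in E) (phi (normalized omega s))%:E =
   \int[P]_(omega in E) (phi (normalized omega 0))%:E)%E.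
Proof.
have mg : measurable_fun setT (fun x => (phi x)%:E) by exact/measurable_EFinP.
have pg x : (0 <= (phi x)%:E)%E by rewrite lee_fin.
apply: etrans (integral_law s mg pg) (etrans _ (esym (integral_law 0 mg pg))).
apply: eq_measure_integral => B mB _.
transitivity (P (E `&` nmfun s @^-1` B)); first by rewrite setIC.
transitivity (P (E `&` nmfun 0 @^-1` B)); last by rewrite setIC.
exact: law_on_invariant.
Qed.

Let W (L : R) : set (measurableTypeR R) := `[(- (L / 2)), (L / 2)]%classic.

Let mW L : measurable (W L).
Proof. exact: measurable_itv. Qed.

Let average L omega := ((L^-1)%:E * \int[lebesgue_measure]_(s in W L) (phi (normalized omega s))%:E)%E.

(** Tonelli: all points of the window have the same expectation on an invariant
    event. *)
Lemma integral_average L : 0 < L ->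
  (\int[P]_(omega in E) average L omega = \int[P]_(omega in E) (phi (normalized omega 0))%:E)%E.
Proof.
move=> L0.
pose F (z : Omega * measurableTypeR R) : \bar R :=
  ((fun z => (phi (normalized z.1 z.2))%:E) \_ (E `*` W L)) z.
have F0 z : (0 <= F z)%E by apply: erestrict_ge0 => ? _; rewrite lee_fin.
have mF : measurable_fun setT F.
  apply/(measurable_restrictT _ _).1; first exact: measurableX.
  apply: measurable_funTS; apply/measurable_EFinP.
  exact: (measurableT_comp mphi measurable_normalized_joint).
have H1 omega : (\int[lebesgue_measure]_s F (omega, s) =
   ((fun omega => \int[lebesgue_measure]_(s in W L) (phi (normalized omega s))%:E) \_ E) omega)%E.
  rewrite /patch; case: ifPn => [/[!inE] Eo|/negP nE].
    rewrite [RHS]integral_mkcond; apply: eq_integral => s _.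
    rewrite /F /patch; congr (if _ then _ else _).
    by apply/idP/idP; rewrite !inE; [move=> []|move=> ?; split].
  rewrite integral0_eq// => s _; rewrite /F /patch ifF//; apply/negP; rewrite inE => -[/= Eo _].
  by apply: nE; rewrite inE.
have H2 s : (\int[P]_omega F (omega, s) =
   ((fun s => \int[P]_(omega in E) (phi (normalized omega s))%:E) \_ (W L)) s)%E.
  rewrite /patch; case: ifPn => [/[!inE] Ws|/negP nW].
    rewrite [RHS]integral_mkcond; apply: eq_integral => o _.
    rewrite /F /patch; congr (if _ then _ else _).
    by apply/idP/idP; rewrite !inE; [move=> []|move=> ?; split].
  rewrite integral0_eq// => o _; rewrite /F /patch ifF//; apply/negP; rewrite inE => -[_ /= Ws].
  by apply: nW; rewrite inE.
have mH : measurable_fun setT (fun omega => \int[lebesgue_measure]_s F (omega, s))%E.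
  exact: (measurable_fun_fubini_tonelli_F F mF F0).
rewrite /average.
transitivity ((L^-1)%:E * \int[P]_omega \int[lebesgue_measure]_s F (omega, s))%E.
  rewrite [in RHS](eq_integral _ _ (fun o _ => H1 o)) -integral_mkcond.
  rewrite ge0_integralZl//.
  - apply: (eq_measurable_fun (fun omega => \int[lebesgue_measure]_s F (omega, s))%E).
      by move=> o oE; rewrite H1 /patch oE.
    exact: measurable_funTS.
  - by move=> o _; apply: integral_ge0 => s _; rewrite lee_fin.
  - by rewrite lee_fin invr_ge0 ltW.
rewrite fubini_tonelli// (eq_integral _ _ (fun s _ => H2 s)) -integral_mkcond.
under eq_integral do rewrite integral_invariant.
set c := (\int[P]_(omega in E) (phi (normalized omega 0))%:E)%E.
transitivity ((L^-1)%:E * \int[lebesgue_measure]_(x in W L) cst c x)%E; first by [].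
exact: mean_cst.
Qed.

(** The averages over growing windows have constant expectation and converge
    almost surely, by the spatial law, to the Cauchy integral; they are bounded
    by [C]. *)
Lemma integral_on_invariant :
  (\int[P]_(omega in E) (phi (normalized omega 0))%:E =
   P E * \int[cauchy01]_x (phi x)%:E)%E.
Proof.
have bphi := phi_norm phi_ge0 phi_leC.
have cfin : (\int[cauchy01]_x (phi x)%:E)%E \is a fin_num.
  by apply: integrable_fin_num => //; exact: (bounded_integrable _ mphi bphi).
have C0 : 0 <= C := le_trans (phi_ge0 0) (phi_leC 0).
have mphij : measurable_fun setT (fun z : Omega * measurableTypeR R => (phi (normalized z.1 z.2))%:E).
  by apply/measurable_EFinP; exact: (measurableT_comp mphi measurable_normalized_joint).
have ms omega : measurable_fun setT (fun s : R => (phi (normalized omega s))%:E).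
  exact: (measurableT_comp mphij (measurable_pair1 omega)).
have av0 (n : nat) omega : (0 <= average n.+1%:R omega)%E.
  apply: mule_ge0; first by rewrite lee_fin invr_ge0.
  by apply: integral_ge0 => s _; rewrite lee_fin.
have avC (n : nat) omega : (average n.+1%:R omega <= C%:E)%E.
  rewrite /average; have n0 : 0 < n.+1%:R :> R by [].
  move: n0; move: (n.+1%:R : R) => L L0.
  apply: (@le_trans _ _ ((L^-1)%:E * \int[lebesgue_measure]_(s in W L) cst C%:E s)%E).
    apply: lee_wpmul2l; first by rewrite lee_fin invr_ge0 ltW.
    apply: ge0_le_integral => //.
    - by move=> s _; rewrite lee_fin.
    - exact: measurable_funTS (ms omega).
    - by move=> s _; rewrite lee_fin.
  by rewrite mean_cst.
have mav (n : nat) : measurable_fun setT (average n.+1%:R).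
  apply: measurable_funeM.
  pose F (z : Omega * measurableTypeR R) : \bar R :=
    ((fun z => (phi (normalized z.1 z.2))%:E) \_ (setT `*` W n.+1%:R)) z.
  have F0 z : (0 <= F z)%E by apply: erestrict_ge0 => ? _; rewrite lee_fin.
  have mF : measurable_fun setT F.
    by apply/(measurable_restrictT _ _).1; [exact: measurableX|exact: measurable_funTS].
  have := @measurable_fun_fubini_tonelli_F _ _ _ _ _ (@lebesgue_measure R) F mF F0.
  apply: eq_measurable_fun => omega _; rewrite /fubini_F [RHS]integral_mkcond.
  apply: eq_integral => s _; rewrite /F /patch; congr (if _ then _ else _).
  by apply/idP/idP; rewrite !inE; [move=> []|move=> ?; split].
have cvav : \forall omega \ae P, average n.+1%:R omega @[n --> \oo] --> (\int[cauchy01]_x (phi x)%:E)%E.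
  apply: filterS M_summable => omega gd.
  have [mf wc] := spatial_law_normalized K0 gd (f := transformR (M omega)) (fun _ _ => erefl).
  have := wc phi cphi (ex_intro _ C bphi).
  move=> /cvge_pinftyP/(_ (fun n => n.+1%:R)) H.
  have {}H := H succ_cvgy.
  have E1 (n : nat) : average n.+1%:R omega =
      (\int[empirical_measure (fun s => transformR (M omega) s / (pi * K))%R (n.+1%:R)%R]_x (phi x)%:E)%E.
    have n1 : 1 <= n.+1%:R :> R by rewrite ler1n.
    rewrite (integral_empirical_measure mf)//.
    have mg : measurable_fun setT (fun x => (phi x)%:E) by exact/measurable_EFinP.
    have g0 x : (0 <= (phi x)%:E)%E by rewrite lee_fin.
    by rewrite (integral_empirical_law mf n1 mg g0).
  by under eq_fun do rewrite E1; exact: H.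
have PEfin : P E \is a fin_num by rewrite fin_num_measure.
have [_ _] := @dominated_convergence _ _ _ P E mE (fun n => average n.+1%:R)
  (cst (\int[cauchy01]_x (phi x)%:E)%E) (cst C%:E)
  (fun n => measurable_funTS (mav n)) ltac:(exact: measurable_cst)
  ltac:(by apply: filterS cvav => omega H _)
  (finite_measure_integrable_cst P C mE)
  ltac:(by apply: aeW => omega n _ /=; rewrite gee0_abs).
have -> : [sequence \int[P]_(x in E) average n.+1%:R x]_n%E =
    cst (\int[P]_(omega in E) (phi (normalized omega 0))%:E)%E.
  by apply/funext => n; rewrite /= integral_average.
rewrite integral_cst// => H.
by rewrite muleC; apply/esym; have := cvg_lim _ H; rewrite lim_cst// => ->.
Unshelve. all: by end_near. Qed.

End average.

(** Increase bounded continuous functions to the indicators of rays, then use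
    that rays determine a law. *)
Lemma law_given_invariant E B : invariant_field M E -> measurable B ->
  P (E `&` (normalized ^~ 0) @^-1` B) = (P E * cauchy01 B)%E.
Proof.
move=> GE; move: B; have mE := invariant_measurable GE.
pose m1 := pushforward (mrestr P mE) (nmfun 0).
have PE0 : 0 <= fine (P E) by rewrite fine_ge0.
have PEfin : P E \is a fin_num by rewrite fin_num_measure.
have key (a : R) : m1 `]a, +oo[%classic = (P E * cauchy01 `]a, +oo[%classic)%E.
  have := positive_part_ray a; set h := (fun x : R => _); move=> [ch h0 <-].
  have c1 := @saturate_integral_cvg _ h h0 (pushforward (mrestr P mE) (nmfun 0)) ch.
  have c2 := @saturate_integral_cvg _ h h0 cauchy01 ch.
  suff E1 (n : nat) : (\int[pushforward (mrestr P mE) (nmfun 0)]_x (saturate h n x)%:E =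
      P E * \int[cauchy01]_x (saturate h n x)%:E)%E.
    have -> : m1 [set x | 0 < h x] = lim ((\int[pushforward (mrestr P mE) (nmfun 0)]_x
        (saturate h n x)%:E)%E @[n --> \oo]).
      by apply/esym/cvg_lim; [exact: ereal_hausdorff|exact: c1].
    by under eq_fun do rewrite E1; apply/cvg_lim; [exact: ereal_hausdorff|exact: cvgeZl].
  have s0 x := saturate_ge0 h0 n x.
  rewrite -(integral_on_invariant GE (continuous_saturate h0 ch) s0 (fun x => saturate_le1 h0 n x)).
  apply/esym; apply: (integral_law GE) => [|x]; last by rewrite lee_fin.
  by apply/measurable_EFinP; exact: continuous_mfun (continuous_saturate h0 ch).
move=> B mB.
pose m2 : {measure set (measurableTypeR R) -> \bar R} := mscale (NngNum PE0) cauchy01.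
have m2E A : m2 A = (P E * cauchy01 A)%E by rewrite /m2 /= /mscale /= fineK.
rewrite -m2E -(@law_eq_open_rays _ (pushforward (mrestr P mE) (nmfun 0)) m2)//.
- by rewrite /= /pushforward /mrestr setIC.
- by move=> a; rewrite m2E; exact: key.
- move=> a; rewrite /= /pushforward /mrestr.
  by apply: (le_lt_trans (probability_le1 _ _)); rewrite ?ltry//; apply: measurableI => //; rewrite -[X in measurable X]setTI; exact: measurable_normalized.
Qed.

Lemma law_given_invariant_at s E B : invariant_field M E -> measurable B ->
  P (E `&` (normalized ^~ s) @^-1` B) = (P E * cauchy01 B)%E.
Proof. by move=> GE mB; rewrite law_on_invariant// law_given_invariant. Qed.

Lemma normalized_cond_law s : cond_law_eq P (invariant_field M) (normalized ^~ s) cauchy01.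
Proof.
apply: cond_law_eq_constant.
- exact: invariant_algebra.
- exact: invariant_measurable.
- exact: measurable_normalized.
- by move=> E B GE mB; exact: law_given_invariant_at.
Qed.

Lemma normalized_independent s : independent_of_field P (invariant_field M) (normalized ^~ s).
Proof.
move=> E B GE mB; rewrite law_given_invariant_at//; congr (_ * _)%E.
have := law_given_invariant_at s invariant_setT mB.
by rewrite setTI probability_setT mul1e => ->.
Qed.

End stationarity.

(** * The Cauchy law *)

Unset Implicit Arguments.
Set Strict Implicit.

Theorem theorem3p1 (R : realType) (d : measure_display)
    (Omega : measurableType d) (P : probability Omega R)
    (M : {RV P >-> wpm R}) (K : R) (h : R -> R)
    (M_stationary : stationary M)
    (K_gt0 : 0 < K)
    (M_intensity : has_intensity M K)
    (h_ge0 : forall r, 1 <= r -> 0 <= h r)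
    (h_measurable : measurable_fun (`[1, +oo[%classic : set R) h)
    (h_bound : forall x : R, 1 <= `|x| ->
      (\int[P]_omega (`|signed_count (M omega) x - K * x|)%:E
         <= (h `|x|)%:E)%E)
    (h_integrable :
      (\int[lebesgue_measure]_(r in `[1%R, +oo[) (h r / r ^+ 2)%:E < +oo)%E) :
  [/\ (* (i) *)
      \forall omega \ae P,
        [/\ forall s : R, ~ supp (M omega) s ->
              cvg (pv_trunc (M omega) A s%:C @[A --> +oo]),
            forall z, off_axis z -> cvg (pv_trunc (M omega) A z @[A --> +oo]),
            holomorphic_on off_axis (transform (M omega)),
            locally_uniform_cvg off_axis (pv_trunc (M omega))
              (transform (M omega)) &
            herglotz_pick (fun z => - transform (M omega) z)],
      (* (ii) *)
      (\forall omega \ae P, forall (t : R) (z : R[i]),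
        [\/ off_axis z, transform_defined (theta t (M omega)) z |
            transform_defined (M omega) (z + t%:C)] ->
        [/\ transform_defined (theta t (M omega)) z,
            transform_defined (M omega) (z + t%:C) &
            transform (theta t (M omega)) z =
              transform (M omega) (z + t%:C)]) /\
      stationary_random_function P (fun (t : R) (z : R[i]) => z + t%:C)
        (fun omega z => (complex.Re (transform (M omega) z),
                         complex.Im (transform (M omega) z))),
      (* (iii) *)
      [/\ \forall omega \ae P, forall f : R -> R,
            atom_version (M omega) f ->
            has_spatial_law (fun s => f s / (pi * K)) cauchy01,
          \forall omega \ae P, forall f : R -> R,
            atom_version (M omega) f -> shift_amenable f &
          exists nu, \forall omega \ae P, forall f : R -> R,
            atom_version (M omega) f -> has_spatial_law f nu] &
      (* (iv) *)
      forall s : R,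
        cond_law_eq P (invariant_field M)
          (fun omega => transformR (M omega) s / (pi * K)) cauchy01 /\
        independent_of_field P (invariant_field M)
          (fun omega => transformR (M omega) s / (pi * K))].
Proof.
have M_summable := summable_disc_ae K_gt0 h_ge0 h_measurable h_bound h_integrable.
split.
- by apply: filterS M_summable => omega mu_summable; exact: (transform_analytic K_gt0 mu_summable).
- split; last exact: (transform_stationary K_gt0 M_stationary M_summable).
  by apply: filterS M_summable => omega mu_summable t z; exact: (transform_equivariant K_gt0 mu_summable).
- have piK : pi * K != 0 by rewrite gt_eqF// mulr_gt0// pi_gt0.
  have law : \forall omega \ae P, forall f : R -> R, atom_version (M omega) f ->
      has_spatial_law f (dilated_cauchy (pi * K)).
    apply: filterS M_summable => omega mu_summable f fv; apply: has_spatial_law_dilated => //.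
    exact: (spatial_law_normalized K_gt0 mu_summable).
  split.
  + by apply: filterS M_summable => omega mu_summable f fv; exact: (spatial_law_normalized K_gt0 mu_summable).
  + by apply: filterS law => omega H f fv; exists (dilated_cauchy (pi * K)); exact: H.
  + by exists (dilated_cauchy (pi * K)).
- move=> s; split.
  + exact: (normalized_cond_law K_gt0 M_stationary M_summable).
  + exact: (normalized_independent K_gt0 M_stationary M_summable).
Qed.
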